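(* Let $0<a<\infty$. 1. If $U$ is a unitary $2\times 2$ matrix, then the operator $\mathcal{L}_U$ is a selfadjoint differential operator which is an extension of the minimal differential operator $\mathcal{L}_{\mathrm{min}}$: $\mathcal{L}_{\mathrm{min}}\subset\mathcal{L}_U\subset\mathcal{L}_{\mathrm{max}}$. 2. Every differential operator $\mathcal{L}$ which is a selfadjoint extension of the minimal differential operator $\mathcal{L}_{\mathrm{min}}$ is of the form $\mathcal{L}=\mathcal{L}_U$ for some unitary $2\times2$ matrix $U$. 3. For unitary $2\times 2$ matrices $U_1,U_2$: $U_1=U_2$ if and only if $\mathcal{L}_{U_1}=\mathcal{L}_{U_2}$.
   Context: Fix $0<a<\infty$. The formal prolate spheroid differential operator is $(Lx)(t)=-\frac{d}{dt}\Big(\big(1-\frac{t^2}{a^2}\big)\frac{dx(t)}{dt}\Big)+t^2x(t)$, $-a<t<a$. $\mathcal{A}$ is the set of functions $x:(-a,a)\to\mathbb{C}$ that are differentiable at every point of $(-a,a)$ and whose derivative is absolutely continuous on every compact subinterval of $(-a,a)$. $\mathring{\mathcal{A}}$ is the set of $x\in\mathcal{A}$ whose support is a compact subset of $(-a,a)$. The maximal operator $\mathcal{L}_{\mathrm{max}}$ in $L^2((-a,a))$ has domain $\mathcal{D}_{\mathcal{L}_{\mathrm{max}}}=\{x\in L^2((-a,a))\cap\mathcal{A}: Lx\in L^2((-a,a))\}$ and acts by $\mathcal{L}_{\mathrm{max}}x=Lx$. The minimal operator $\mathcal{L}_{\mathrm{min}}$ is the closure of the restriction of $\mathcal{L}_{\mathrm{max}}$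 to $\mathcal{D}_{\mathcal{L}_{\mathrm{max}}}\cap\mathring{\mathcal{A}}$ (this restriction is symmetric, hence closable). For $x\in\mathcal{D}_{\mathcal{L}_{\mathrm{max}}}$ the following generalized boundary values exist as finite limits: $b_{-a}(x)=\lim_{t\to -a+0}(t+a)x'(t)$, $b_a(x)=\lim_{t\to a-0}(t-a)x'(t)$, $c_{-a}(x)=\lim_{t\to -a+0}\big((t+a)\ln(a+t)\,x'(t)-x(t)\big)$, $c_a(x)=\lim_{t\to a-0}\big((t-a)\ln(a-t)\,x'(t)-x(t)\big)$. For a complex $2\times2$ matrix $U=\|u_{pq}\|_{1\le p,q\le 2}$, the operator $\mathcal{L}_U$ is the restriction of $\mathcal{L}_{\mathrm{max}}$ to the domain $\mathcal{D}_{\mathcal{L}_U}$ of all $x\in\mathcal{D}_{\mathcal{L}_{\mathrm{max}}}$ satisfying the boundary conditions $(1+u_{11})b_{-a}(x)-i(1-u_{11})c_{-a}(x)+u_{12}b_a(x)+iu_{12}c_a(x)=0$, $u_{21}b_{-a}(x)+iu_{21}c_{-a}(x)+(1+u_{22})b_a(x)-i(1-u_{22})c_a(x)=0$. *)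

(* Defs.v *)
From HB Require Import structures.
From mathcomp Require Import all_boot all_order all_algebra.
From mathcomp Require Import spectral.
From mathcomp.real_closed Require Export complex.
From mathcomp Require Import all_classical all_reals all_analysis.

Set Implicit Arguments.
Unset Strict Implicit.
Unset Printing Implicit Defensive.

Import Order.TTheory GRing.Theory Num.Theory.
Import numFieldNormedType.Exports.

Local Open Scope classical_set_scope.
Local Open Scope complex_scope.
Local Open Scope ring_scope.

Section Functions.
Context {R : realType}.
Implicit Types (x f g : R -> R[i]) (t c d : R).

(* A function with values in R[i] is differentiated, measured and integrated
   through its real and imaginary parts. *)
Definition cderivable x t : Prop :=
  derivable (fun s => complex.Re (x s)) t 1 /\
  derivable (fun s => complex.Im (x s)) t 1.

Definition cderive x t : R[i] :=
  derive1 (fun s => complex.Re (x s)) t +i* derive1 (fun s => complex.Im (x s)) t.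

Definition cmeasurable (D : set R) x : Prop :=
  measurable_fun D (fun t => complex.Re (x t)) /\
  measurable_fun D (fun t => complex.Im (x t)).

Definition cintegral (D : set R) x : R[i] :=
  Rintegral lebesgue_measure D (fun t => complex.Re (x t)) +i*
  Rintegral lebesgue_measure D (fun t => complex.Im (x t)).

Definition absolutely_continuous_on x c d : Prop :=
  forall e : R, 0 < e -> exists2 delta : R, 0 < delta &
    forall (n : nat) (u v : 'I_n -> R),
      (forall k, c <= u k /\ u k <= v k /\ v k <= d) ->
      trivIset [set: 'I_n] (fun k => `]u k, v k[%classic) ->
      \sum_(k < n) (v k - u k) < delta ->
      \sum_(k < n) Normc.normc (x (v k) - x (u k)) < e.

Definition Iaa (a : R) : set R := `]- a, a[%classic.

End Functions.

(* L^2((-a,a)) is handled through representatives R -> R[i], whose values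
   outside (-a,a) are irrelevant; [eqL2 a] is equality of classes. *)
Section L2.
Context {R : realType} (a : R).
Implicit Types (f g h : R -> R[i]).

Definition inL2 f : Prop :=
  cmeasurable (Iaa a) f /\
  (\int[lebesgue_measure]_(t in Iaa a) (Normc.normc (f t) ^+ 2)%:E < +oo)%E.

Definition eqL2 f g : Prop :=
  ae_eq lebesgue_measure (Iaa a) f g.

Definition dotL2 f g : R[i] := cintegral (Iaa a) (fun t => f t * (g t)^*).

Definition normL2 f : R :=
  Num.sqrt (Rintegral lebesgue_measure (Iaa a) (fun t => Normc.normc (f t) ^+ 2)).

(* A (possibly unbounded) operator in L^2((-a,a)) is given by its graph, as a
   set of pairs of representatives saturated for [eqL2]. Inclusion of operators
   and equality of operators are then inclusion and equality of sets. *)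
Definition graph : Type := set ((R -> R[i]) * (R -> R[i])).

Implicit Type A : graph.

Definition is_operator A : Prop :=
  [/\ forall f g, A (f, g) -> inL2 f /\ inL2 g,
      forall f g f' g', A (f, g) -> inL2 f' -> inL2 g' ->
        eqL2 f f' -> eqL2 g g' -> A (f', g'),
      A (cst 0, cst 0),
      forall (k : R[i]) f g f' g', A (f, g) -> A (f', g') ->
        A ((fun t => k * f t + f' t), (fun t => k * g t + g' t)) &
      forall f g g', A (f, g) -> A (f, g') -> eqL2 g g'].

Definition densely_defined A : Prop :=
  forall f, inL2 f -> forall e : R, 0 < e ->
    exists f' g', A (f', g') /\ normL2 (fun t => f t - f' t) < e.

Definition adjoint A : graph :=
  [set hk | [/\ inL2 hk.1, inL2 hk.2 &
     forall f g, A (f, g) -> dotL2 g hk.1 = dotL2 f hk.2]].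

Definition selfadjoint A : Prop :=
  [/\ is_operator A, densely_defined A & adjoint A = A].

Definition graph_closure A : graph :=
  [set fg | [/\ inL2 fg.1, inL2 fg.2 & forall e : R, 0 < e ->
     exists f' g', [/\ A (f', g'),
       normL2 (fun t => fg.1 t - f' t) < e &
       normL2 (fun t => fg.2 t - g' t) < e]]].

End L2.

Section Prolate.
Context {R : realType} (a : R).
Implicit Types (x : R -> R[i]) (U : 'M[R[i]]_2).

Definition prolate x : R -> R[i] := fun t =>
  - cderive (fun s => (1 - s ^+ 2 / a ^+ 2)%:C * cderive x s) t
  + (t ^+ 2)%:C * x t.

Definition classA x : Prop :=
  (forall t, - a < t < a -> cderivable x t) /\
  (forall c d, - a < c -> c <= d -> d < a ->
     absolutely_continuous_on (cderive x) c d).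

(* The set required to be compact is the support of [x] in (-a,a). *)
Definition classA0 x : Prop :=
  classA x /\
  compact (Iaa a `&` closure [set t | Iaa a t /\ x t != 0]).

(* [prolate a x] is only determined almost everywhere, hence the L^2
   representative [y]. *)
Definition Dmax x : Prop :=
  [/\ classA x, inL2 a x & exists2 y, inL2 a y & eqL2 a y (prolate x)].

Definition prolate_on (D : set (R -> R[i])) : graph :=
  [set fg | [/\ inL2 a fg.1, inL2 a fg.2 &
     exists x, [/\ D x, eqL2 a fg.1 x & eqL2 a fg.2 (prolate x)]]].

Definition Lmax : graph := prolate_on Dmax.

Definition Lmin : graph :=
  graph_closure a (prolate_on [set x | Dmax x /\ classA0 x]).

(* The topology on complex values is found on the regular algebra R[i]^o. For
   x in Dmax these limits exist; [lim] is a default value otherwise. *)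
Definition b_left x : R[i] :=
  lim (((t + a)%:C * cderive x t : R[i]^o) @[t --> (- a)^'+]).

Definition b_right x : R[i] :=
  lim (((t - a)%:C * cderive x t : R[i]^o) @[t --> a^'-]).

Definition c_left x : R[i] :=
  lim ((((t + a) * ln (a + t))%:C * cderive x t - x t : R[i]^o)
    @[t --> (- a)^'+]).

Definition c_right x : R[i] :=
  lim ((((t - a) * ln (a - t))%:C * cderive x t - x t : R[i]^o)
    @[t --> a^'-]).

Definition boundary_conditions U x : Prop :=
  (1 + U 0 0) * b_left x - 'i%C * (1 - U 0 0) * c_left x
    + U 0 1 * b_right x + 'i%C * U 0 1 * c_right x = 0 /\
  U 1 0 * b_left x + 'i%C * U 1 0 * c_left x
    + (1 + U 1 1) * b_right x - 'i%C * (1 - U 1 1) * c_right x = 0.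

Definition DU U x : Prop := Dmax x /\ boundary_conditions U x.

Definition LU U : graph := prolate_on (DU U).

End Prolate.

(* Main.v *)
(* Write p = 1 - t^2/a^2 and q = p x'. Then L x = y means that q is a primitive
   of t^2 x - y. The functions u = 1, ln (a + t), ln (a - t) are square integrable
   and (p u')' is constant, so the generalized boundary values of x are limits of
   its Wronskians with them, and Green's formula reads
     (L x, z) - (x, L z) = (2/a) sum_{-a, a} (c(x) conj b(z) - b(x) conj c(z)).
   With be = b + i c and ga = b - i c the right-hand side is a multiple of
   <be(x), be(z)> - <ga(x), ga(z)>, and the boundary conditions are ga = - U be.
   The map x |-> (be, ga) is onto C^2 x C^2 and vanishes on compactly supported
   functions. Every element of the adjoint of the minimal operator is classical:
   the functions (p x')' with x of compact support are exactly those orthogonal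
   to the kernel 1, ln ((a + t) / (a - t)) of (p x')'. Hence selfadjoint
   extensions correspond to the subspaces of C^2 x C^2 that equal their own
   orthogonal for the above form, which are the graphs of unitary matrices - U.
   Compactly supported elements of the domain are dense, by truncation followed
   by two Steklov means. Derivatives of absolutely continuous functions come from
   the Radon-Nikodym theorem for the Lebesgue-Stieltjes measure of the variation. *)

Require Import Defs.
From HB Require Import structures.
From mathcomp Require Import all_boot all_order all_algebra.
From mathcomp Require Import spectral.
From mathcomp Require Import all_classical all_reals all_analysis.
From mathcomp Require Import measurable_realfun.
From mathcomp Require Import ring lra.

Set Implicit Arguments.
Unset Strict Implicit.
Unset Printing Implicit Defensive.

Import Order.TTheory GRing.Theory Num.Theory.
Import numFieldNormedType.Exports.

Local Open Scope classical_set_scope.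
Local Open Scope ring_scope.

(** * Absolute continuity on an interval and integrable densities *)

Section AbsoluteContinuity.
Context {R : realType}.
Implicit Types (f g F G : R -> R) (e c d s t u v : R) (L : seq (R * R)).
Notation mu := (@lebesgue_measure R).

(** The obstacle is a mismatch: the domains are described by derivatives and absolute continuity,
    whereas an adjoint only supplies integral identities between classes of functions. The working
    notion is therefore [rmax x q y], in which the equation is a statement about increments of [q].
    It is linear, and it yields both Green's identity and the limits at the end points from one
    fact: a primitive of a function integrable on (-a, a) extends continuously to [-a, a]. No
    closure is computed. [Lmin] lies in [LU] because [LU] is its own adjoint and a pairing identity
    survives limits in the graph. A weak solution is compared with a particular solution of the same
    equation. Their difference annihilates every bounded test function with two vanishing moments;
    testing it with its own sign, corrected to have vanishing moments, identifies it. Density takes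
    two means because the first only makes a bounded function Lipschitz, and the second makes the
    derivative Lipschitz, as the absolute continuity of [weight * x'] demands. *)

Lemma aeS (P Q : R -> Prop) : (forall x, P x -> Q x) ->
  {ae mu, forall x, P x} -> {ae mu, forall x, Q x}.
Proof. by move=> PQ; apply: filterS; first exact: (ae_filter_ringOfSetsType mu). Qed.

Lemma aeI (P Q : R -> Prop) : {ae mu, forall x, P x} -> {ae mu, forall x, Q x} ->
  {ae mu, forall x, P x /\ Q x}.
Proof.
move=> Px Qx; have [A [mA A0 PA]] := Px; have [B [mB B0 QB]] := Qx.
exists (A `|` B); split; [exact: measurableU|by rewrite null_set_setU|].
move=> x /= /not_andP[nP|nQ]; [left; exact: PA|right; exact: QB].
Qed.

Lemma ae_neq s : {ae mu, forall t, t != s}.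
Proof.
exists [set s]; split => //; first exact: lebesgue_measure_set1.
by move=> t /= /negP; rewrite negbK => /eqP.
Qed.

Lemma lebesgue_itvoo u v : u <= v -> mu `]u, v[%classic = (v - u)%:E.
Proof.
move=> uv; rewrite lebesgue_measure_itv /= lte_fin.
move: uv; rewrite le_eqVlt => /orP[/eqP ->|->]; last by rewrite EFinB.
by rewrite ltxx subrr.
Qed.

Lemma lebesgue_setU (A B : set R) : measurable A -> measurable B ->
  A `&` B = set0 -> mu (A `|` B) = (mu A + mu B)%E.
Proof. by move=> mA mB AB; exact: measureU. Qed.

Lemma integrable_ae (D : set R) f g : measurable D -> mu.-integrable D (EFin \o g) ->
  measurable_fun D f -> {ae mu, forall t, D t -> f t = g t} ->
  mu.-integrable D (EFin \o f).
Proof.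
move=> mD /integrableP[mg ig] mf fg; apply/integrableP; split; first exact/measurable_EFinP.
rewrite (_ : (\int[mu]_(x in D) _ = \int[mu]_(x in D) `|(EFin \o g) x|)%E)//.
apply: ge0_ae_eq_integral => //.
- by apply: measurableT_comp => //; exact/measurable_EFinP.
- exact: measurableT_comp.
- by apply: aeS fg => t /= fg Dt; rewrite fg.
Qed.

Lemma ae_eq_Rintegral (D : set R) f g : measurable D ->
  measurable_fun D f -> measurable_fun D g -> {ae mu, forall t, D t -> f t = g t} ->
  \int[mu]_(x in D) f x = \int[mu]_(x in D) g x.
Proof.
move=> mD mf mg fg; congr fine; apply: ae_eq_integral => //; try exact/measurable_EFinP.
by apply: aeS fg => t /= fg Dt; rewrite fg.
Qed.

Lemma measure_bigcup_le (m : {measure set (measurableTypeR R) -> \bar R})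
  (I : nat -> set R) x : (forall k, measurable (I k)) -> trivIset setT I ->
  (forall n, \sum_(0 <= k < n) m (I k) <= x)%E -> (m (\bigcup_k I k) <= x)%E.
Proof.
move=> mI tI H; rewrite (measure_semi_bigcup m)//; last exact: bigcupT_measurable.
by apply: lime_le; [exact: is_cvg_nneseries|exact: nearW].
Qed.

Lemma measure_bigcup_ge (m : {measure set (measurableTypeR R) -> \bar R})
  (I : nat -> set R) n : (forall k, measurable (I k)) -> trivIset setT I ->
  (\sum_(0 <= k < n) m (I k) <= m (\bigcup_k I k))%E.
Proof.
move=> mI tI; rewrite (measure_semi_bigcup m)//; last exact: bigcupT_measurable.
exact: nneseries_lim_ge.
Qed.

Definition abs_cont F c d : Prop :=
  forall e : R, 0 < e -> exists2 delta : R, 0 < delta &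
    forall n (u v : 'I_n -> R),
      (forall k, c <= u k /\ u k <= v k /\ v k <= d) ->
      trivIset [set: 'I_n] (fun k => `]u k, v k[%classic) ->
      \sum_(k < n) (v k - u k) < delta ->
      \sum_(k < n) `|F (v k) - F (u k)| < e.

Definition subintervals c d L :=
  all (fun p => [&& c <= p.1, p.1 <= p.2 & p.2 <= d]) L.

(* Disjointness is expressed by counting, which is stable under concatenation
   and refinement. *)
Definition nonoverlapping L :=
  forall t, (count (fun p => p.1 < t < p.2)%R L <= 1)%N.

Definition total_length L : R := \sum_(p <- L) (p.2 - p.1).

(** The final bound is [<= e] rather than [< e], so that it passes to suprema over partitions. *)
Definition seq_abs_cont F c d : Prop :=
  forall e : R, 0 < e -> exists2 delta : R, 0 < delta &
    forall L, subintervals c d L -> nonoverlapping L ->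
      total_length L < delta -> \sum_(p <- L) `|F p.2 - F p.1| <= e.

Lemma abs_cont_seq F c d : abs_cont F c d -> seq_abs_cont F c d.
Proof.
move=> acF e e0; have [delta d0 H] := acF e e0; exists delta => // L sL nL lL.
have := H (size L) (fun k => (nth (0, 0) L k).1) (fun k => (nth (0, 0) L k).2).
rewrite /total_length !(big_nth (0, 0)) !big_mkord in lL *.
move=> K; apply/ltW/K => // [k|i j _ _ [t [/= ti tj]]].
  by have /and3P[] := all_nthP (0, 0) sL k (ltn_ord k).
apply/val_inj/eqP/contraT => ij; have := nL t.
rewrite -sum1_count big_mkcond (big_nth (0, 0)) big_mkord.
rewrite (bigD1 i)//= (bigD1 j) 1?eq_sym//=.
by rewrite !in_itv/= in ti tj; rewrite ti tj.
Qed.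

Lemma trivIset_nonoverlapping n (u v : 'I_n -> R) :
  trivIset [set: 'I_n] (fun k => `]u k, v k[%classic) ->
  nonoverlapping [seq (u k, v k) | k <- index_enum 'I_n].
Proof.
move=> tuv t; rewrite count_map -size_filter.
rewrite leqNgt; apply/negP.
set s := [seq x <- _ | _].
have us : uniq s by rewrite filter_uniq// index_enum_uniq.
case E : s => [//|i [//|j l]] _; move: us; rewrite E /= inE negb_or => /andP[/andP[ij _] _].
move/eqP : ij; apply; apply: tuv => //.
have : i \in s by rewrite E mem_head.
have : j \in s by rewrite E !inE eqxx orbT.
rewrite !mem_filter /= => /andP[tj _] /andP[ti _].
by exists t; split => /=; rewrite in_itv.
Qed.

Lemma seq_abs_contP F c d : seq_abs_cont F c d -> abs_cont F c d.
Proof.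
move=> acF e e0; have [|delta d0 H] := acF (e / 2); first by rewrite divr_gt0.
exists delta => // n u v cuvd tuv luv.
have := H [seq (u k, v k) | k <- index_enum 'I_n].
rewrite /total_length 2!big_map /= => K.
apply: (@le_lt_trans _ _ (e / 2)); last by rewrite ltr_pdivrMr// ltr_pMr// ltr1n.
apply: K => //; last exact: trivIset_nonoverlapping.
by apply/allP => _ /mapP[k _ ->]/=; have [-> [-> ->]] := cuvd k.
Qed.

Lemma nonoverlapping_le L L' :
  (forall t, (count (fun p => p.1 < t < p.2)%R L' <=
              count (fun p => p.1 < t < p.2)%R L)%N) ->
  nonoverlapping L -> nonoverlapping L'.
Proof. by move=> H nL t; exact: leq_trans (H t) (nL t). Qed.

Definition pieces u (s : seq R) : seq (R * R) := pairmap pair u s.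

Lemma path_last_le u (s : seq R) : path <%R u s -> u <= last u s.
Proof.
elim: s u => //= x s IH u /andP[ux /IH]; apply: le_trans; exact: ltW.
Qed.

Lemma count_pieces u (s : seq R) t : path <%R u s ->
  (count (fun p => p.1 < t < p.2)%R (pieces u s) <= (u < t < last u s)%R)%N.
Proof.
elim: s u => //= x s IH u /andP[ux xs]; have := IH _ xs.
have := path_last_le xs.
have [tu|ut] := leP t u.
  have -> : (x < t) = false by rewrite ltNge (le_trans tu)// ltW.
  by rewrite add0n.
have [tx|xt] := ltP t x.
  have -> : (x < t) = false by rewrite ltNge ltW.
  move=> /= xl; rewrite leqn0 => /eqP ->; rewrite addn0.
  by rewrite (lt_le_trans tx xl).
rewrite add0n => _ /leq_trans; apply.
by case: (x < t).
Qed.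

Lemma sub_pieces c d u (s : seq R) : c <= u -> path <%R u s -> last u s <= d ->
  subintervals c d (pieces u s).
Proof.
elim: s u => //= x s IH u cu /andP[ux xs] xd.
rewrite cu (ltW ux) (le_trans _ xd) ?path_last_le//= IH//.
by rewrite (le_trans cu)// ltW.
Qed.

Lemma total_pieces u (s : seq R) : total_length (pieces u s) = last u s - u.
Proof.
elim: s u => [u|x s IH u] /=; first by rewrite /total_length big_nil subrr.
by rewrite /total_length big_cons -/(total_length _) IH /=; ring.
Qed.

Lemma variation_pieces u v F (s : seq R) : itv_partition u v s ->
  variation u v F s = \sum_(p <- pieces u s) `|F p.2 - F p.1|.
Proof.
move=> _; rewrite /variation; elim: s u => [u|x s IH u] /=.
  by rewrite big_nil big_geq.
by rewrite big_cons big_nat_recl//= -IH.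
Qed.

(** Each interval of [L2] is in turn replaced by an arbitrary partition of itself, stored in [L1].
    The total length is unchanged and no point is covered more often, so the bound [e] persists, and
    the supremum over partitions turns increments into total variations. *)
Lemma seq_abs_cont_variation F c d e delta : c <= d ->
  (forall L, subintervals c d L -> nonoverlapping L ->
      total_length L < delta -> \sum_(p <- L) `|F p.2 - F p.1| <= e) ->
  forall L2 L1, subintervals c d (L1 ++ L2) -> nonoverlapping (L1 ++ L2) ->
    total_length (L1 ++ L2) < delta ->
    ((\sum_(p <- L1) `|F p.2 - F p.1|)%:E +
     \sum_(p <- L2) total_variation p.1 p.2 F <= e%:E)%E.
Proof.
move=> cd H; elim=> [|[u v] L2 IH] L1 sL nL lL.
  by rewrite big_nil adde0 lee_fin H// -[L1]cats0.
have E : L1 ++ (u, v) :: L2 = (L1 ++ [:: (u, v)]) ++ L2 by rewrite -catA.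
(* Moving [(u, v)] unrefined shows that the variation over the remaining intervals is finite, so
   that it can be subtracted. *)
have := IH (L1 ++ [:: (u, v)]); rewrite -E => /(_ sL nL lL).
have /and3P[/= cu uv vd] : [&& c <= u, u <= v & v <= d].
  by move: sL; rewrite /subintervals all_cat /= => /and3P[_].
have T0 : (0 <= \sum_(p <- L2) total_variation p.1 p.2 F)%E.
  rewrite big_seq; apply: sume_ge0 => p pL.
  apply: total_variation_ge0.
  have : p \in L1 ++ (u, v) :: L2 by rewrite mem_cat inE pL !orbT.
  by move/(allP sL) => /and3P[].
set T := (X in (_ + X <= _)%E) in T0 *.
move=> T1; have fT : T \is a fin_num.
  rewrite ge0_fin_numE//; apply: (@le_lt_trans _ _ e%:E); last exact: ltry.
  by apply: le_trans T1; rewrite leeDr// lee_fin sumr_ge0.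
rewrite big_cons -/T /= -(fineK fT) addeCA -leeBrDr -?EFinD//.
apply: ge_ereal_sup => _ [_ [s uvs <-] <-].
rewrite lee_fin lerBrDl variation_pieces//.
have [pus /eqP lus] := uvs.
have := IH (L1 ++ pieces u s).
rewrite big_cat /= -/T -(fineK fT) -EFinD lee_fin => K.
rewrite addrAC; apply: K.
- rewrite /subintervals !all_cat /= in sL *.
  have /and3P[-> _ ->] := sL; rewrite andbT /=.
  by apply: sub_pieces => //; rewrite lus.
- apply: nonoverlapping_le nL => t; rewrite !count_cat /= -addnA leq_add2l leq_add2r.
  by have := count_pieces t pus; rewrite lus.
- move: lL; rewrite /total_length !big_cat big_cons /= -!/(total_length _).
  by rewrite total_pieces lus addrA.
Qed.

Lemma nonoverlapping1 s t : nonoverlapping [:: (s, t)].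
Proof. by move=> r /=; rewrite addn0; case: (_ && _). Qed.

(** Induction on the number of steps of length [delta / 2] that separate a point from [c]. Each step
    is shorter than [delta], hence carries variation at most 1. *)
Lemma seq_abs_cont_bounded_variation F c d : c <= d -> seq_abs_cont F c d ->
  bounded_variation c d F.
Proof.
move=> cd acF; have [delta d0 H] := acF 1 ltr01.
apply/(bounded_variationP _ cd).
suff K n : forall t, c <= t <= d -> t - c <= n%:R * (delta / 2) ->
    total_variation c t F \is a fin_num.
  have [n hn] : exists n, d - c <= n%:R * (delta / 2).
    exists (Num.truncn ((d - c) / (delta / 2))).+1.
    rewrite -ler_pdivrMr ?divr_gt0//; apply/ltW.
    by rewrite truncnS_gt.
  by apply: (K n) => //; rewrite cd lexx.
elim: n => [|n IH] t /andP[ct td].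
  rewrite mul0r subr_le0 => tc.
  have -> : t = c by apply/eqP; rewrite eq_le tc.
  by rewrite total_variationxx.
move=> tn; pose s := Num.max c (t - delta / 2).
have cs : c <= s by rewrite le_max lexx.
have d20 : 0 < delta / 2 by rewrite divr_gt0.
have st : s <= t by rewrite ge_max ct gerBl ltW.
rewrite (total_variationD F cs st) fin_numD; apply/andP; split.
  apply: IH; first by rewrite cs (le_trans st).
  rewrite /s; case: (leP c (t - _)) => _; last by rewrite subrr mulr_ge0// ltW.
  by rewrite -natr1 mulrDl mul1r in tn; lra.
have := @seq_abs_cont_variation F c d 1 delta cd H [:: (s, t)] [::].
rewrite /= big_nil add0e big_seq1/= => K.
rewrite ge0_fin_numE ?total_variation_ge0//; apply: le_lt_trans (ltry 1); apply: K.
- by rewrite /subintervals /= cs st td.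
- exact: nonoverlapping1.
- rewrite /total_length big_seq1 /=.
  have : t - delta / 2 <= s by rewrite le_max lexx orbT.
  by move: d20; lra.
Qed.

Lemma seq_abs_cont_total_variation F c d : c <= d -> seq_abs_cont F c d ->
  seq_abs_cont (fun t => fine (total_variation c t F)) c d.
Proof.
move=> cd acF e e0; have [delta d0 H] := acF e e0; exists delta => // L sL nL lL.
have bF := seq_abs_cont_bounded_variation cd acF.
have fT t : c <= t -> t <= d -> total_variation c t F \is a fin_num.
  by move=> ct td; apply/(bounded_variationP _ ct)/(bounded_variationl ct td).
have := @seq_abs_cont_variation F c d e delta cd H L [::] sL nL lL.
rewrite big_nil add0e -lee_fin; apply: le_trans.
rewrite -sumEFin 2!big_seq; apply: lee_sum => p /(allP sL) /and3P[cp pp pd].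
rewrite (total_variationD F cp pp) fineD ?fT//; last 2 first.
  by rewrite (le_trans pp).
  have := fT _ (le_trans cp pp) pd.
  by rewrite (total_variationD F cp pp) fin_numD => /andP[].
rewrite addrAC subrr add0r ger0_norm ?fine_ge0 ?total_variation_ge0// fineK//.
have := fT _ (le_trans cp pp) pd.
by rewrite (total_variationD F cp pp) fin_numD => /andP[].
Qed.

Lemma seq_abs_contB F G c d : seq_abs_cont F c d -> seq_abs_cont G c d ->
  seq_abs_cont (fun t => F t - G t) c d.
Proof.
move=> acF acG e e0; have e20 : 0 < e / 2 by rewrite divr_gt0.
have [d1 d10 H1] := acF _ e20; have [d2 d20 H2] := acG _ e20.
exists (Num.min d1 d2); first by rewrite lt_min d10.
move=> L sL nL; rewrite lt_min => /andP[L1 L2].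
rewrite [e]splitr; apply: le_trans (lerD (H1 L sL nL L1) (H2 L sL nL L2)).
rewrite -big_split /=; apply: ler_sum => p _.
have -> : F p.2 - G p.2 - (F p.1 - G p.1) = (F p.2 - F p.1) - (G p.2 - G p.1).
  by ring.
exact: ler_normB.
Qed.

(** Composing with [clamp c d] extends a function on [c, d] by its end values; a Stieltjes measure
    needs a cumulative function on the whole line. *)
Definition clamp c d t := Num.min d (Num.max c t).

Lemma clamp_id c d t : c <= t <= d -> clamp c d t = t.
Proof. by move=> /andP[ct td]; rewrite /clamp (max_idPr ct) (min_idPr td). Qed.

Lemma clamp_itv c d t : c <= d -> c <= clamp c d t <= d.
Proof. by move=> cd; rewrite /clamp le_min cd le_max lexx ge_min lexx. Qed.

Lemma clamp_nd c d : {homo clamp c d : s t / s <= t}.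
Proof. by move=> s t st; rewrite /clamp le_min2// le_max2. Qed.

Lemma clamp_lip c d s t : c <= d -> s <= t ->
  clamp c d t - clamp c d s <= t - s.
Proof.
rewrite /clamp => cd st.
case: (leP c s) => h1; case: (leP c t) => h2; case: (leP d s) => h3;
  case: (leP d t) => h4; case: (leP d c) => h5; lra.
Qed.

Definition line_abs_cont F : Prop :=
  forall e : R, 0 < e -> exists2 delta : R, 0 < delta &
    forall L, all (fun p => p.1 <= p.2) L -> nonoverlapping L ->
      total_length L < delta -> \sum_(p <- L) `|F p.2 - F p.1| <= e.

Lemma seq_abs_cont_clamp F c d : c <= d -> seq_abs_cont F c d ->
  line_abs_cont (F \o clamp c d).
Proof.
move=> cd acF e e0; have [delta d0 H] := acF _ e0; exists delta => // L oL nL lL.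
pose h (p : R * R) := (clamp c d p.1, clamp c d p.2).
have := H (map h L); rewrite /total_length !big_map; apply.
- apply/allP => _ /mapP[p pL ->] /=.
  have /andP[-> _] := clamp_itv p.1 cd; have /andP[_ ->] := clamp_itv p.2 cd.
  by rewrite clamp_nd//; move/(allP oL) : pL.
- move=> t; apply: leq_trans (nL t); rewrite count_map; apply: sub_count => p /=.
  rewrite /clamp gt_min gt_max lt_min lt_max.
  by move=> /andP[/orP[h1|/andP[h1 h2]] /andP[h3 /orP[h4|h5]]]; lra.
- apply: le_lt_trans lL; rewrite /total_length 2!big_seq; apply: ler_sum => p pL.
  by apply: clamp_lip => //; move/(allP oL) : pL.
Qed.

Lemma seq_abs_cont_clamp_continuous F c d : c <= d -> seq_abs_cont F c d ->
  continuous (F \o clamp c d).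
Proof.
move=> cd acF t; apply/cvgrPdist_le => /= e e0.
have [delta d0 H] := seq_abs_cont_clamp cd acF e0.
near=> s; have st : `|t - s| < delta.
  by near: s; apply: (@cvgr_dist_lt _ R^o) => //; exact: cvg_id.
have [ts|/ltW ts] := leP t s.
- have := H [:: (t, s)]; rewrite /= /total_length !big_seq1 distrC; apply.
  + by rewrite ts.
  + exact: nonoverlapping1.
  + by rewrite distrC ger0_norm ?subr_ge0 in st.
- have := H [:: (s, t)]; rewrite /= /total_length !big_seq1; apply.
  + by rewrite ts.
  + exact: nonoverlapping1.
  + by rewrite ger0_norm ?subr_ge0 in st.
Unshelve. all: by end_near. Qed.

Lemma open_bounded_interval (X : set R) : open X -> is_interval X ->
  has_lbound X -> has_ubound X -> X = `](inf X), (sup X)[%classic.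
Proof.
move=> oX iX lX uX; rewrite -[LHS](interior_id _).1//.
by rewrite interval_bounded_interior//; apply/seteqP; split => x /=; rewrite in_itv.
Qed.

Lemma lebesgue_stieltjes_itvoc (G : cumulative R R) s t : s <= t ->
  lebesgue_stieltjes_measure G `]s, t]%classic = (G t - G s)%:E.
Proof.
move=> st; rewrite /lebesgue_stieltjes_measure /measure_extension.
rewrite (measurable_mu_extE (wlength G)); last exact: is_ocitv.
exact: wlength_itv_bnd.
Qed.

(** Outer regularity places [A] in an open set of Lebesgue measure below [delta]. Any finitely many
    of its components have total [G]-increment at most [e], and countable additivity extends the
    bound to their union. *)
Lemma lebesgue_stieltjes_null (G : cumulative R R) (A : set R) M :
  line_abs_cont G ->
  measurable A -> A `<=` `]- M, M[ ->
  mu A = 0%E -> lebesgue_stieltjes_measure G A = 0%E.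
Proof.
set nu := lebesgue_stieltjes_measure G.
move=> acG mA AM muA; apply/eqP; rewrite eq_le measure_ge0 andbT.
apply/lee_addgt0Pr => e e0; rewrite add0e.
have [delta d0 H] := acG _ e0.
have [|U [oU AU muU]] := lebesgue_regularity_outer mA _ d0.
  by rewrite [X in (X < _)%E]muA ltry.
(* The intersection makes every component bounded, so that its [inf] and [sup] are its end
   points. *)
pose V := U `&` `]- M, M[.
have oV : open V by apply: openI => //; exact: interval_open.
have mV (W : set R) : open W -> measurable W by exact: open_measurable.
pose I := open_disjoint_itv oV.
have VI : V = \bigcup_k I k by exact: open_disjoint_itv_bigcup.
have tI : trivIset setT I by exact: open_disjoint_itv_trivIset.
have mI k : measurable (I k) by apply: mV; exact: open_disjoint_itv_open.
have IV k : I k `<=` V by rewrite VI => x Ix; exists k.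
(* Components may be empty; [(0, 0)] then names the empty open interval. *)
pose E k := if I k == set0 then (0, 0) else (inf (I k), sup (I k)).
have EI k : I k = `](E k).1, (E k).2[%classic.
  rewrite /E; case: eqP => [->|I0] /=; first by rewrite set_itvoo0.
  apply: open_bounded_interval; [exact: open_disjoint_itv_open|
    exact: open_disjoint_itv_is_interval|exists (- M)|exists M] => x /IV[_] /=;
    by rewrite in_itv/= => /andP[/ltW ? /ltW ?].
have E12 k : (E k).1 <= (E k).2.
  rewrite leNgt; apply/negP => lt21; move: (lt21).
  rewrite /E; case: eqP => [_|/eqP/set0P[x]] /=; first by rewrite ltxx.
  by rewrite EI /= in_itv/= => /andP[h1 h2] _; have := lt_trans (lt_trans h1 h2) lt21; rewrite ltxx.
have muV : (mu V < delta%:E)%E.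
  apply: le_lt_trans muU; apply: (@le_trans _ _ (mu U)).
    by apply: le_measure; rewrite ?inE; [exact: mV..|exact: subIsetl].
  rewrite (measureDI mu (mV _ oU) mA) [X in (_ + X)%E](_ : _ = 0%E) ?adde0//.
  apply/eqP; rewrite eq_le measure_ge0 andbT -muA.
  by apply: le_measure; rewrite ?inE; [apply: measurableI => //; exact: mV|exact: mA|exact: subIsetr].
have AV : A `<=` V by move=> x Ax; split; [exact: AU|exact: AM].
apply: (@le_trans _ _ (nu V)); first by apply: le_measure; rewrite ?inE//; exact: mV.
rewrite VI; apply: (@measure_bigcup_le nu) => // n.
apply: (@le_trans _ _ (\sum_(0 <= k < n) (`|G (E k).2 - G (E k).1|)%:E)%E).
  apply: lee_sum => k _; apply: (@le_trans _ _ (nu `](E k).1, (E k).2]%classic)).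
    apply: le_measure; [by rewrite inE; exact: mI|by rewrite inE; exact: measurable_itv|].
    by rewrite EI => x /=; rewrite !in_itv/= => /andP[-> /ltW ->].
  have -> : nu `](E k).1, (E k).2]%classic = (G (E k).2 - G (E k).1)%:E.
    exact: lebesgue_stieltjes_itvoc.
  by rewrite lee_fin ler_norm.
rewrite sumEFin lee_fin.
have := H [seq E k | k <- iota 0 n].
rewrite /total_length !big_map /index_iota subn0; apply.
- by apply/allP => _ /mapP[k _ ->].
- move=> x; rewrite count_map -size_filter leqNgt; apply/negP.
  set s := [seq x <- _ | _] => s1.
  have us : uniq s by rewrite filter_uniq// iota_uniq.
  move: s1 us; case Es : s => [//|i [//|j l]] _ /= /andP[].
  rewrite inE negb_or => /andP[/eqP ij _] _; apply: ij; apply: tI => //.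
  have : i \in s by rewrite Es mem_head.
  have : j \in s by rewrite Es !inE eqxx orbT.
  rewrite !mem_filter /= => /andP[xj _] /andP[xi _].
  by exists x; rewrite !EI; split => /=; rewrite in_itv.
- rewrite -lte_fin; apply: le_lt_trans muV.
  rewrite VI; apply: le_trans (@measure_bigcup_ge mu I n mI tI).
  rewrite -sumEFin /index_iota subn0; apply: lee_sum => k _.
  by rewrite -lebesgue_itvoo// -EI.
Qed.

(** Restricted to []c, d]], the Stieltjes measure of the clamped function is finite and vanishes on
    Lebesgue null sets; [g] is its Radon-Nikodym density. *)
Lemma monotone_seq_abs_cont_integral F c d : c <= d ->
  {in `[c, d] &, {homo F : s t / s <= t}} -> seq_abs_cont F c d ->
  exists2 g : R -> R, mu.-integrable setT (EFin \o g) &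
    forall s t, c <= s -> s <= t -> t <= d ->
      F t - F s = \int[mu]_(x in `]s, t]) g x.
Proof.
move=> cd ndF acF.
have ndG : nondecreasing (F \o clamp c d).
  move=> s t st /=; apply: ndF; rewrite ?in_itv /= ?clamp_itv//.
  exact: clamp_nd.
have cG := seq_abs_cont_clamp_continuous cd acF.
pose G : cumulative R R := HB.pack (F \o clamp c d)
  (isCumulative.Build R _ R (F \o clamp c d) ndG (right_continuousW cG)).
have nuD : (lebesgue_stieltjes_measure G `]c, d]%classic < +oo)%E.
  by rewrite lebesgue_stieltjes_itvoc// ltry.
have mcd : (R.-ocitv.-measurable).-sigma.-measurable `]c, d]%classic := measurable_itv _.
pose nu := mfrestr mcd nuD.
have numu : nu `<< mu.
  apply/null_content_dominatesP => A mA muA.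
  rewrite /nu /mfrestr /mrestr.
  pose M := Num.max (`|c|) (`|d|) + 1.
  apply: (@lebesgue_stieltjes_null G _ M).
  - exact: (seq_abs_cont_clamp cd acF).
  - exact: measurableI.
  - move=> x [_] /=; rewrite !in_itv/= => /andP[cx xd].
    have h1 : `|c| <= M - 1 by rewrite addrK le_max lexx.
    have h2 : `|d| <= M - 1 by rewrite addrK le_max lexx orbT.
    move: h1 h2; rewrite !ler_norml => /andP[? ?] /andP[? ?].
    by apply/andP; split; lra.
  - apply/eqP; rewrite eq_le measure_ge0 andbT -muA.
    by apply: le_measure; rewrite ?inE//; try exact: measurableI; exact: subIsetl.
have [g [g0 gfin ig gE]] := @radon_nikodym_sigma_finite _ _ R
  (@lebesgue_measure R) (mfrestr mcd nuD) numu.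
exists (fine \o g).
  apply: eq_integrable ig => // x _ /=; by rewrite fineK.
move=> s t cs st td; rewrite /Rintegral.
under eq_integral do rewrite /= fineK//.
rewrite -gE; last exact: measurable_itv.
transitivity (fine (lebesgue_stieltjes_measure G `]s, t]%classic)); last first.
  congr fine; rewrite /mfrestr /mrestr; congr (lebesgue_stieltjes_measure G _).
  apply/esym/setIidPl => x /=; rewrite !in_itv/= => /andP[sx xt].
  by rewrite (le_lt_trans cs)//= (le_trans xt).
by rewrite lebesgue_stieltjes_itvoc//= !clamp_id// ?cs ?td ?(le_trans cs) ?(le_trans st).
Qed.

Definition primitive_on c d F f : Prop :=
  mu.-integrable `]c, d] (EFin \o f) /\
  forall s t, c <= s -> s <= t -> t <= d -> F t - F s = \int[mu]_(x in `]s, t]) f x.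

(** Jordan decomposition: the variation [T] and [T - F] are nondecreasing and absolutely continuous,
    and [F] is their difference. *)
Lemma seq_abs_cont_primitive F c d : c <= d -> seq_abs_cont F c d ->
  exists g, primitive_on c d F g.
Proof.
move=> cd acF; pose T t := fine (total_variation c t F).
have acT : seq_abs_cont T c d by exact: seq_abs_cont_total_variation.
have bF := seq_abs_cont_bounded_variation cd acF.
have fT t : c <= t -> t <= d -> total_variation c t F \is a fin_num.
  by move=> ct td; apply/(bounded_variationP _ ct)/(bounded_variationl ct td).
have TE s t : c <= s -> s <= t -> t <= d -> `|F t - F s| <= T t - T s.
  move=> cs st td; have ct := le_trans cs st; have sd := le_trans st td.
  rewrite -lee_fin EFinB /T !fineK ?fT//.
  rewrite (total_variationD F cs st) addeAC subee ?fT// add0e.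
  exact: total_variation_ge.
have [||g1 ig1 E1] := @monotone_seq_abs_cont_integral T c d cd.
- move=> s t; rewrite !in_itv/= => /andP[cs sd] /andP[ct td] st.
  by rewrite -subr_ge0 (le_trans _ (TE _ _ _ _ _)).
- exact: acT.
have [||g2 ig2 E2] := @monotone_seq_abs_cont_integral (fun t => T t - F t) c d cd.
- move=> s t; rewrite !in_itv/= => /andP[cs sd] /andP[ct td] st.
  have := le_trans (ler_norm _) (TE _ _ cs st td); lra.
- exact: seq_abs_contB.
have iS (h : R -> R) (D : set R) : measurable D -> mu.-integrable setT (EFin \o h) ->
    mu.-integrable D (EFin \o h).
  by move=> mD; apply: integrableS => //.
exists (fun x => g1 x - g2 x); split.
  rewrite (_ : EFin \o _ = (EFin \o g1) \- (EFin \o g2))%E//.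
  by apply: integrableB => //; exact: iS.
move=> s t cs st td; rewrite RintegralB//; [|exact: iS..].
by rewrite -E1// -E2//; ring.
Qed.

(** Lebesgue differentiation applied to the extension [g] of [f] by zero; inside the interval, [F]
    is the integral of [g] up to the constant [F c]. *)
Lemma primitive_ae_derive F f c d : primitive_on c d F f ->
  {ae mu, forall t, c < t < d -> is_derive t 1 F (f t)}.
Proof.
move=> [intf E].
pose g := f \_ `]c, d].
have ig : mu.-integrable setT (EFin \o g).
  by rewrite /g -restrict_EFin; apply/(integrable_restrict mu _ _ _).1 => //; rewrite setTI.
have /= := @FTC1 R g (BRight c).
have iy y : mu.-integrable [set` Interval (BRight c) (BRight y)] (EFin \o g).
  by apply: integrableS ig.
move=> /(_ iy) H.
have lg : locally_integrable setT g by exact: open_integrable_locally openT ig.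
move/H : lg; apply: aeS => t /= K /andP[ct td].
have [] := K; first by rewrite lte_fin.
move=> dF F'; have cd : c < d by exact: lt_trans td.
apply: (@near_eq_is_derive _ _ _ (fun x => F c + \int[mu]_(t in `]c, x]) g t)).
- have tcd : t \in `]c, d[ by rewrite in_itv/= ct.
  near=> x.
  have : x \in `]c, d[ by near: x; exact: near_in_itvoo.
  rewrite in_itv/= => /andP[cx xd].
  have := E c x (lexx _) (ltW cx) (ltW xd).
  rewrite [RHS](_ : _ = \int[mu]_(t in `]c, x]) g t); last first.
    apply: eq_Rintegral => y; rewrite inE/= in_itv/= => /andP[cy yx].
    rewrite /g patchE mem_set//= in_itv/= cy /=.
    by rewrite (le_trans yx)// ltW.
  by move=> <-; rewrite addrC subrK.
- rewrite -[f t]add0r; apply: is_deriveD.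
  rewrite (_ : f t = g t); last by rewrite /g patchE mem_set//= in_itv/= ct ltW.
  by apply: DeriveDef; [exact: dF|rewrite -F' derive1E].
Unshelve. all: by end_near. Qed.

(** Increments of [F] over disjoint intervals add up to at most the integral of [|f|] over their
    union, whose measure is the total length; the integral is absolutely continuous as a function of
    the set. *)
Lemma primitive_seq_abs_cont F f c d : primitive_on c d F f -> seq_abs_cont F c d.
Proof.
move=> [intf E] e e0.
pose g := f \_ `]c, d].
have ig : mu.-integrable setT (EFin \o g).
  by rewrite /g -restrict_EFin; apply/(integrable_restrict mu _ _ _).1 => //; rewrite setTI.
have [delta [d0 H]] := integral_normr_continuous ig e0.
exists delta => // L sL nL lL.
have igS (D : set R) : measurable D -> mu.-integrable D (EFin \o g).
  by move=> mD; apply: integrableS ig.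
have ingS (D : set R) : measurable D -> mu.-integrable D (EFin \o (fun x => `|g x|)).
  by move=> mD; apply: (@integrable_norm _ _ _ mu D g); exact: igS.
pose D := \big[setU/set0]_(p <- L) `]p.1, p.2[%classic.
have mD (L' : seq (R * R)) : measurable (\big[setU/set0]_(p <- L') `]p.1, p.2[%classic).
  by apply: bigsetU_measurable => p _; exact: measurable_itv.
have K : forall L', subintervals c d L' -> nonoverlapping L' ->
   mu (\big[setU/set0]_(p <- L') `]p.1, p.2[%classic) = (total_length L')%:E /\
   \sum_(p <- L') `|F p.2 - F p.1| <=
     \int[mu]_(x in \big[setU/set0]_(p <- L') `]p.1, p.2[%classic) `|g x|.
  elim=> [_ _|[u v] L' IH /andP[/= /and3P[cu uv vd] sL'] nL'].
    by rewrite /total_length !big_nil measure0 Rintegral_set0.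
  have nL'' : nonoverlapping L'.
    by apply: nonoverlapping_le nL' => t /=; rewrite leq_addl.
  have [IH1 IH2] := IH sL' nL''.
  have disj : [disjoint `]u, v[%classic & \big[setU/set0]_(p <- L') `]p.1, p.2[%classic].
    apply/disj_setPS => x [/= xuv]; rewrite -bigcup_seq => -[p /= pL xp].
    have := nL' x; rewrite /= !in_itv/= in xuv xp *.
    rewrite xuv add1n ltnS leqNgt => /negP; apply.
    by rewrite -has_count; apply/hasP; exists p.
  split.
    rewrite big_cons lebesgue_setU//; last exact: (disj_set2P disj).
    by rewrite IH1 /= lebesgue_itvoo// /total_length big_cons /= EFinD.
  rewrite !big_cons /= Rintegral_setU//; last 2 first.
    exact: mD.
    by apply: ingS; apply: measurableU => //; exact: mD.
  apply: lerD => //.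
  rewrite E//; apply: le_trans.
    apply: le_normr_Rintegral => //.
    by apply: integrableS intf => //; apply: subset_itv; rewrite bnd_simp.
  rewrite (_ : \int[mu]_(x in `]u, v]) `|f x| = \int[mu]_(x in `]u, v]) `|g x|); last first.
    apply: eq_Rintegral => y; rewrite inE/= in_itv/= => /andP[cy yx].
    by rewrite /g patchE mem_set//= in_itv/= (le_lt_trans cu)//= (le_trans yx).
  rewrite /Rintegral integral_itv_bndoo//.
  by have /integrableP[] := ingS `]u, v[%classic (measurable_itv _).
have [K1 K2] := K L sL nL.
apply: (le_trans K2); apply/ltW/H; first exact: mD.
by have := lL; rewrite -lte_fin -K1.
Qed.

(** Two densities of [F] agree almost everywhere, since both are its derivative there. *)
Lemma primitive_unique F f g c d : primitive_on c d F g ->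
  measurable_fun `]c, d] f ->
  {ae mu, forall t, c < t < d -> is_derive t 1 F (f t)} -> primitive_on c d F f.
Proof.
move=> Fg mf dF; have dG := primitive_ae_derive Fg.
have fg : {ae mu, forall t, `]c, d]%classic t -> f t = g t}.
  (* The derivatives are known on the open interval only, so the right end point is discarded. *)
  apply: aeS (aeI (ae_neq d) (aeI dF dG)) => t /= [td [dFt dGt]].
  rewrite in_itv/= => /andP[ct td'].
  have ctd : c < t < d by rewrite ct lt_neqAle td td'.
  have h1 := dFt ctd; have h2 := dGt ctd.
  by rewrite -(@derive_val _ _ _ _ _ _ _ h1) (@derive_val _ _ _ _ _ _ _ h2).
have [intg E] := Fg; have mg : measurable_fun `]c, d] g.
  by apply/measurable_EFinP; case/integrableP : intg.
split; first exact: integrable_ae intg mf fg.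
move=> s t cs st td; rewrite E//.
have sub : `]s, t]%classic `<=` `]c, d]%classic by apply: subset_itv; rewrite bnd_simp.
apply: ae_eq_Rintegral => //; [exact: measurable_funS mg|exact: measurable_funS mf|].
by apply: aeS fg => x fg xst; rewrite fg//; exact: sub.
Qed.

(** The fundamental theorem of calculus for absolutely continuous functions; integrability of [f] is
    part of the conclusion. *)
Lemma primitive_seq_abs_cont_unique F f c d : c <= d -> seq_abs_cont F c d ->
  measurable_fun `]c, d] f ->
  {ae mu, forall t, c < t < d -> is_derive t 1 F (f t)} -> primitive_on c d F f.
Proof.
by move=> cd /(seq_abs_cont_primitive cd)[g Fg]; exact: primitive_unique Fg.
Qed.

Lemma seq_abs_cont_bounded F c d : c <= d -> seq_abs_cont F c d ->
  exists2 M, 0 < M & forall t, c <= t -> t <= d -> `|F t| <= M.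
Proof.
move=> cd /(seq_abs_cont_bounded_variation cd)[M HM].
have M0 t : c <= t -> t <= d -> `|F t - F c| + `|F d - F t| <= M.
  move=> ct td.
  have := total_variationD F ct td.
  have bF : bounded_variation c d F by exists M.
  have bl := bounded_variationl ct td bF; have br := bounded_variationr ct td bF.
  have : (total_variation c d F <= M%:E)%E.
    by apply: ge_ereal_sup => _ [x Vx <-]; rewrite lee_fin; exact: HM.
  move=> H E; rewrite E in H; rewrite -lee_fin EFinD; apply: le_trans H.
  by apply: leeD; exact: total_variation_ge.
exists (M + `|F c| + 1).
  have := M0 c (lexx _) cd; rewrite subrr normr0 add0r.
  have := normr_ge0 (F d - F c); have := normr_ge0 (F c); lra.
move=> t ct td; have := M0 t ct td; have := ler_normD (F t - F c) (F c).
rewrite subrK; have := normr_ge0 (F d - F t); lra.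
Qed.

Lemma seq_abs_contM F G c d : c <= d -> seq_abs_cont F c d -> seq_abs_cont G c d ->
  seq_abs_cont (fun t => F t * G t) c d.
Proof.
move=> cd acF acG e e0.
have [M M0 FM] := seq_abs_cont_bounded cd acF.
have [N N0 GN] := seq_abs_cont_bounded cd acG.
have eM : 0 < e / 2 / M by rewrite !divr_gt0.
have eN : 0 < e / 2 / N by rewrite !divr_gt0.
have [d1 d10 H1] := acF _ eN; have [d2 d20 H2] := acG _ eM.
exists (Num.min d1 d2); first by rewrite lt_min d10.
move=> L sL nL; rewrite lt_min => /andP[L1 L2].
apply: (@le_trans _ _ (N * (\sum_(p <- L) `|F p.2 - F p.1|) +
                      M * (\sum_(p <- L) `|G p.2 - G p.1|))).
  rewrite !mulr_sumr -big_split /= 2!big_seq; apply: ler_sum => p /(allP sL) /and3P[cp pp pd].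
  have -> : F p.2 * G p.2 - F p.1 * G p.1 = G p.2 * (F p.2 - F p.1) + F p.1 * (G p.2 - G p.1).
    by ring.
  apply: (le_trans (ler_normD _ _)); rewrite !normrM.
  apply: lerD; apply: ler_wpM2r => //; [apply: GN|apply: FM] => //; lra.
rewrite [e]splitr; apply: lerD.
  by rewrite -ler_pdivlMl// mulrC H1.
by rewrite -ler_pdivlMl// mulrC H2.
Qed.

Lemma primitive_on_measurable F f c d : primitive_on c d F f -> measurable_fun `]c, d] f.
Proof. by case=> /integrableP[/measurable_EFinP]. Qed.

Lemma seq_abs_cont_measurable F c d : c <= d -> seq_abs_cont F c d ->
  measurable_fun `]c, d] F.
Proof.
move=> cd acF; have cF := seq_abs_cont_clamp_continuous cd acF.
apply: (eq_measurable_fun (F \o clamp c d)).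
  move=> t; rewrite inE /= in_itv/= => /andP[ct td].
  by rewrite clamp_id// td ltW.
apply: measurable_funTS; exact: continuous_measurable_fun.
Qed.

(** Integration by parts: the product is absolutely continuous, and the product rule holds wherever
    both factors are differentiable. *)
Lemma primitive_onM F f G g c d : c <= d -> primitive_on c d F f -> primitive_on c d G g ->
  primitive_on c d (fun t => F t * G t) (fun t => f t * G t + F t * g t).
Proof.
move=> cd Ff Gg; have acF := primitive_seq_abs_cont Ff; have acG := primitive_seq_abs_cont Gg.
have mf := primitive_on_measurable Ff; have mg := primitive_on_measurable Gg.
have mF := seq_abs_cont_measurable cd acF; have mG := seq_abs_cont_measurable cd acG.
apply: primitive_seq_abs_cont_unique => //; first exact: seq_abs_contM.
  by apply: measurable_funD; exact: measurable_funM.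
apply: aeS (aeI (primitive_ae_derive Ff) (primitive_ae_derive Gg)) => t [dF dG] ctd.
have h1 := dF ctd; have h2 := dG ctd.
have := is_deriveM h1 h2; rewrite /GRing.scale /= => h.
by apply: (is_derive_eq h); ring.
Qed.
End AbsoluteContinuity.

(** * Primitives on (-a, a) and the equation (weight x')' = f *)

Section Primitives.
Context {R : realType}.
Implicit Types (f g h F G x z q r : R -> R) (e c d s t u v : R).
Notation mu := (@lebesgue_measure R).

Lemma integrable_lin (D : set R) k f g : measurable D ->
  mu.-integrable D (EFin \o f) -> mu.-integrable D (EFin \o g) ->
  mu.-integrable D (EFin \o (fun t => k * f t + g t)).
Proof.
move=> mD intf intg.
rewrite (_ : EFin \o _ = (fun y => k%:E * (EFin \o f) y) \+ (EFin \o g))%E//.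
by apply: integrableD => //; exact: integrableZl.
Qed.

Lemma Rintegral_lin (D : set R) k f g : measurable D ->
  mu.-integrable D (EFin \o f) -> mu.-integrable D (EFin \o g) ->
  \int[mu]_(y in D) (k * f y + g y) = k * (\int[mu]_(y in D) f y) + \int[mu]_(y in D) g y.
Proof.
move=> mD intf intg; have int0 : mu.-integrable D (EFin \o (fun=> 0%R)) by exact: integrable0.
rewrite RintegralD// ?RintegralZl//.
have := integrable_lin k mD intf int0.
by apply: eq_integrable => // t _ /=; rewrite addr0.
Qed.

Lemma is_derive_mul_fun f g t (df dg : R) : is_derive t 1 f df -> is_derive t 1 g dg ->
  is_derive t 1 (fun y => f y * g y) (df * g t + f t * dg).
Proof.
move=> h1 h2; apply: (is_derive_eq (is_deriveM h1 h2)).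
by rewrite /GRing.scale /=; ring.
Qed.

Lemma is_derive_lin_fun (k : R) f g t (df dg : R) : is_derive t 1 f df -> is_derive t 1 g dg ->
  is_derive t 1 (fun y => k * f y + g y) (k * df + dg).
Proof. by move=> h1 h2; exact: (is_deriveD (is_deriveZ k h1) h2). Qed.

Lemma near_is_derive f g t (df : R) : (\forall s \near t, f s = g s) ->
  is_derive t 1 f df -> is_derive t 1 g df.
Proof. exact: near_eq_is_derive. Qed.

Lemma primitive_on_eq F f g c d : {in `]c, d], f =1 g} -> primitive_on c d F f ->
  primitive_on c d F g.
Proof.
move=> fg [intf E]; split.
  by apply: eq_integrable intf => // t; rewrite inE /= => ?; rewrite /= fg.
move=> s t cs st td; rewrite E//; apply: eq_Rintegral => y; rewrite inE/= in_itv/= => /andP[sy yt].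
by rewrite fg// in_itv/= (le_lt_trans cs)//= (le_trans yt).
Qed.

Lemma primitive_onB F f G g c d : primitive_on c d F f -> primitive_on c d G g ->
  primitive_on c d (fun t => F t - G t) (fun t => f t - g t).
Proof.
move=> [intf Ef] [intg Eg]; split.
  by rewrite (_ : EFin \o _ = (EFin \o f) \- (EFin \o g))%E//; apply: integrableB.
move=> s t cs st td.
have sub : `]s, t]%classic `<=` `]c, d]%classic by apply: subset_itv; rewrite bnd_simp.
rewrite RintegralB//; [|exact: integrableS intf|exact: integrableS intg].
by rewrite -Ef// -Eg//; ring.
Qed.

Lemma primitive_on_integral g c d : mu.-integrable `]c, d] (EFin \o g) ->
  primitive_on c d (fun t => \int[mu]_(x in `]c, t]) g x) g.
Proof.
move=> ig; split => // s t cs st td.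
apply: Rintegral_itvB; rewrite ?bnd_simp//.
by apply: integrableS ig => //; apply: subset_itv; rewrite bnd_simp.
Qed.

Lemma lipschitz_seq_abs_cont F c d M : 0 < M ->
  (forall s t, c <= s -> s <= t -> t <= d -> `|F t - F s| <= M * (t - s)) ->
  seq_abs_cont F c d.
Proof.
move=> M0 H e e0; exists (e / M); first exact: divr_gt0.
move=> L sL nL lL.
apply: (@le_trans _ _ (M * total_length L)).
  rewrite /total_length mulr_sumr 2!big_seq; apply: ler_sum => p /(allP sL) /and3P[cp pp pd].
  exact: H.
by rewrite -ler_pdivlMl// mulrC ltW.
Qed.

(** The mean value theorem makes [F] Lipschitz, hence absolutely continuous. *)
Lemma bounded_derive_primitive F f c d M : c <= d ->
  (forall t, c <= t -> t <= d -> is_derive t 1 F (f t)) ->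
  (forall t, c <= t -> t <= d -> `|f t| <= M) ->
  measurable_fun `]c, d] f -> primitive_on c d F f.
Proof.
move=> cd dF fM mf; apply: primitive_seq_abs_cont_unique => //; last first.
  by apply: aeW => t /andP[/ltW ct /ltW td]; exact: dF.
apply: (@lipschitz_seq_abs_cont _ _ _ (`|M| + 1)); first by rewrite ltr_wpDl.
move=> s t cs; rewrite le_eqVlt => /orP[/eqP <- _|st td].
  by rewrite !subrr normr0 mulr0.
have sub y : s <= y <= t -> c <= y /\ y <= d.
  by move=> /andP[sy yt]; split; [exact: le_trans sy|exact: le_trans td].
have [||y] := @MVT_segment R F f s t (ltW st).
- by move=> y; rewrite in_itv/= => /andP[/ltW sy /ltW yt]; apply: dF; apply sub; rewrite sy.
- apply: derivable_within_continuous => y; rewrite in_itv/= => syt.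
  by have [h1 h2] := sub _ syt; have [] := dF _ h1 h2.
rewrite in_itv/= => syt ->; rewrite normrM (ger0_norm (x := t - s)) ?subr_ge0 ?(ltW st)//.
apply: ler_wpM2r; first by rewrite subr_ge0 ltW.
have [h1 h2] := sub _ syt.
by apply: (le_trans (fM _ h1 h2)); apply: (le_trans (ler_norm _)); rewrite lerDl.
Qed.

Context (a : R).
Definition prim F f : Prop :=
  mu.-integrable (Iaa a) (EFin \o f) /\
  forall s t, - a < s -> s <= t -> t < a -> F t - F s = \int[mu]_(x in `]s, t]) f x.

Lemma sub_Iaa s t : - a <= s -> t < a -> `]s, t]%classic `<=` Iaa a.
Proof.
move=> as' ta x /=; rewrite /Iaa/= !in_itv/= => /andP[sx xt].
by rewrite (le_lt_trans as')//= (le_lt_trans xt).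
Qed.

Lemma measurable_Iaa : measurable (Iaa a).
Proof. exact: measurable_itv. Qed.

Lemma integrable_Iaa f : mu.-integrable (Iaa a) (EFin \o f) ->
  mu.-integrable `]- a, a] (EFin \o f) /\
  \int[mu]_(x in Iaa a) f x = \int[mu]_(x in `]- a, a]) f x.
Proof.
move=> intf; split; last exact: Rintegral_itv_bndo_bndc.
move/integrableP : intf => [mf if_]; apply/integrableP; split.
  by apply/emeasurable_fun_itv_bndo_bndcP.
rewrite -integral_itv_bndo_bndc//; first exact: measurableT_comp.
Qed.

Lemma prim_on F f c d : prim F f -> - a < c -> d < a -> primitive_on c d F f.
Proof.
move=> [intf E] ac da; split.
  by apply: integrableS intf => //; [exact: measurable_Iaa|apply: sub_Iaa => //; exact: ltW].
by move=> s t cs st td; apply: E => //; [exact: lt_le_trans cs|exact: le_lt_trans da].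
Qed.

Lemma prim_integral f : mu.-integrable (Iaa a) (EFin \o f) ->
  prim (fun t => \int[mu]_(x in `]- a, t]) f x) f.
Proof.
move=> intf; split => // s t cs st td.
apply: Rintegral_itvB; rewrite ?bnd_simp ?(ltW cs)//.
by apply: integrableS intf => //; [exact: measurable_Iaa|exact: sub_Iaa].
Qed.

(** [F] differs by a constant from the primitive based at [-a], which is continuous on [-a, a]; the
    limits are the corresponding values at the ends. *)
Lemma prim_limits F f : 0 < a -> prim F f -> exists l1 l2,
  [/\ F t @[t --> (- a)^'+] --> l1, F t @[t --> a^'-] --> l2 &
   l2 - l1 = \int[mu]_(x in Iaa a) f x].
Proof.
move=> a0 [intf E]; have aa : - a <= a by lra.
pose G t := \int[mu]_(x in `]- a, t]) f x.
have [inta intE] := integrable_Iaa intf.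
have Gp := primitive_on_integral inta.
have cG := seq_abs_cont_clamp_continuous aa (primitive_seq_abs_cont Gp).
have FG t : - a < t -> t < a -> F t = F 0 - G 0 + (G \o clamp (- a) a) t.
  move=> at' ta /=; rewrite clamp_id ?(ltW at') ?(ltW ta)//.
  have [t0|/ltW t0] := leP 0 t.
    have := E 0 t; rewrite oppr_lt0 => /(_ a0 t0 ta).
    have [_ E'] := Gp; rewrite -E' -/(G t) -/(G 0) ?oppr_le0 ?(ltW a0) ?(ltW ta)//; lra.
  have := E t 0 at' t0 a0.
  have [_ E'] := Gp; rewrite -E' -/(G t) -/(G 0) ?(ltW a0) ?(ltW at')//; lra.
exists (F 0 - G 0 + (G \o clamp (- a) a) (- a)), (F 0 - G 0 + (G \o clamp (- a) a) a); split.
- have H : (F 0 - G 0 + (G \o clamp (- a) a) t) @[t --> (- a)^'+] -->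
      F 0 - G 0 + (G \o clamp (- a) a) (- a).
    by apply: cvgD; [exact: cvg_cst|apply: cvg_at_right_filter; exact: cG].
  apply: cvg_trans H; apply: near_eq_cvg; near=> t; rewrite (FG t)//.
  by near: t; apply: nbhs_right_lt; lra.
- have H : (F 0 - G 0 + (G \o clamp (- a) a) t) @[t --> a^'-] -->
      F 0 - G 0 + (G \o clamp (- a) a) a.
    by apply: cvgD; [exact: cvg_cst|apply: cvg_at_left_filter; exact: cG].
  apply: cvg_trans H; apply: near_eq_cvg; near=> t; rewrite (FG t)//.
  by near: t; apply: nbhs_left_gt; lra.
- rewrite /= !clamp_id ?lexx ?aa//.
  transitivity (G a - G (- a)); first by ring.
  by rewrite intE; have [_ E'] := Gp; exact: E'.
Unshelve. all: by end_near. Qed.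

Definition weight t := 1 - t ^+ 2 / a ^+ 2.

Context (a_gt0 : 0 < a).

Lemma weightE t : weight t = (a - t) * (a + t) / a ^+ 2.
Proof. by rewrite /weight; field; rewrite gt_eqF. Qed.

Lemma weight_gt0 t : - a < t -> t < a -> 0 < weight t.
Proof.
move=> h1 h2; rewrite weightE divr_gt0 ?mulr_gt0 ?exprn_gt0//; lra.
Qed.

Lemma weight_ge c d t : - a < c -> d < a -> c <= t -> t <= d ->
  (a - d) * (a + c) / a ^+ 2 <= weight t.
Proof.
move=> h1 h2 h3 h4; rewrite weightE ler_pM2r ?invr_gt0 ?exprn_gt0//.
by apply: ler_pM; lra.
Qed.

Lemma measurable_weightV : measurable_fun (Iaa a) (fun t => (weight t)^-1).
Proof.
apply: open_continuous_measurable_fun; first exact: interval_open.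
move=> t; rewrite inE /Iaa /= in_itv/= => /andP[h1 h2].
apply: (@cvgV R R); first by rewrite gt_eqF// weight_gt0.
apply: (@cvgB _ R^o); first exact: cvg_cst.
apply: (@cvgM R); last exact: cvg_cst.
exact: exprn_continuous.
Qed.

(* That is, q = weight * x' and f = (weight * x')' almost everywhere. *)
Definition sol x q f : Prop :=
  prim q f /\ forall t, - a < t -> t < a -> is_derive t 1 x (q t / weight t).

(** Away from the ends [q] is bounded and [weight] stays above the positive constant [m], so the
    derivative of [x] is bounded. *)
Lemma sol_primitive x q f c d : sol x q f -> - a < c -> c <= d -> d < a ->
  primitive_on c d x (fun t => q t / weight t).
Proof.
move=> [pq dx] ac cd da; have qp := prim_on pq ac da.
have acq := primitive_seq_abs_cont qp.
have [M M0 qM] := seq_abs_cont_bounded cd acq.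
pose m := (a - d) * (a + c) / a ^+ 2.
have m0 : 0 < m by rewrite /m divr_gt0 ?mulr_gt0 ?exprn_gt0//; lra.
apply: (@bounded_derive_primitive _ _ _ _ (M / m)) => //.
- by move=> t ct td; apply: dx; lra.
- move=> t ct td; rewrite normrM; apply: ler_pM => //; first exact: qM.
  have w0 : 0 < weight t by apply: weight_gt0; lra.
  rewrite normfV (gtr0_norm w0) lef_pV2 ?posrE//; exact: weight_ge.
- apply: measurable_funM; first exact: seq_abs_cont_measurable.
  apply: measurable_funS measurable_weightV; first exact: measurable_Iaa.
  by apply: sub_Iaa => //; exact: ltW.
Qed.

(** Integration by parts in [q z] and in [x r]: both produce the term [q r / weight], which
    cancels. *)
Lemma sol_green x q f z r g s t : sol x q f -> sol z r g ->
  - a < s -> s <= t -> t < a ->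
  (q t * z t - x t * r t) - (q s * z s - x s * r s) =
  \int[mu]_(y in `]s, t]) (f y * z y - x y * g y).
Proof.
move=> sx sz as' st ta.
have xp := sol_primitive sx as' st ta; have zp := sol_primitive sz as' st ta.
have qp := prim_on sx.1 as' ta; have rp := prim_on sz.1 as' ta.
have := primitive_onB (primitive_onM st qp zp) (primitive_onM st xp rp).
move=> /(@primitive_on_eq _ _ (fun y => f y * z y - x y * g y))[|_ E]; last exact: E.
by move=> y _ /=; ring.
Qed.

Lemma prim_lin k F f G g : prim F f -> prim G g ->
  prim (fun t => k * F t + G t) (fun t => k * f t + g t).
Proof.
move=> [intf Ef] [intg Eg]; split; first by apply: integrable_lin => //; exact: measurable_Iaa.
move=> s t as' st ta; have sub : `]s, t]%classic `<=` Iaa a by apply: sub_Iaa => //; exact: ltW.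
have iS (h : R -> R) : mu.-integrable (Iaa a) (EFin \o h) -> mu.-integrable `]s, t] (EFin \o h).
  by apply: integrableS => //; exact: measurable_Iaa.
rewrite Rintegral_lin//; [|exact: iS..].
by rewrite -Ef// -Eg//; ring.
Qed.

Lemma sol_lin k x q f z r g : sol x q f -> sol z r g ->
  sol (fun t => k * x t + z t) (fun t => k * q t + r t) (fun t => k * f t + g t).
Proof.
move=> [pq dx] [pr dz]; split; first exact: prim_lin.
move=> t h1 h2; apply: (is_derive_eq (is_derive_lin_fun k (dx t h1 h2) (dz t h1 h2))).
by rewrite mulrDl mulrA.
Qed.

End Primitives.

(** * Real square integrable functions; the logarithmic solutions *)

Section SquareIntegrable.
Context {R : realType} (a : R) (a_gt0 : 0 < a).
Implicit Types (f g h F G : R -> R) (e c d s t u v : R).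
Notation mu := (@lebesgue_measure R).

Definition rL2 f : Prop :=
  measurable_fun (Iaa a) f /\ mu.-integrable (Iaa a) (EFin \o (fun t => f t ^+ 2)).

Lemma integrable_le (D : set R) f g : measurable D -> measurable_fun D f ->
  mu.-integrable D (EFin \o g) -> (forall t, D t -> `|f t| <= g t) ->
  mu.-integrable D (EFin \o f).
Proof.
move=> mD mf ig fg; apply: le_integrable ig => //; first exact/measurable_EFinP.
move=> t Dt /=; rewrite lee_fin; apply: le_trans (fg t Dt) _; exact: ler_norm.
Qed.

Lemma rL2_mul f g : rL2 f -> rL2 g -> mu.-integrable (Iaa a) (EFin \o (fun t => f t * g t)).
Proof.
move=> [mf if_] [mg ig].
have i2 := integrable_lin 1 (measurable_Iaa a) if_ ig.
apply: (integrable_le (measurable_Iaa a) _ i2) => /=; first exact: measurable_funM.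
move=> t _; rewrite mul1r ler_norml; have := sqr_ge0 (f t - g t); have := sqr_ge0 (f t + g t).
rewrite sqrrB sqrrD !mulr2n; have := sqr_ge0 (f t); have := sqr_ge0 (g t) => ? ? ? ?.
by apply/andP; split; lra.
Qed.

Lemma lebesgue_itvoc s t : s <= t -> mu `]s, t]%classic = (t - s)%:E.
Proof.
rewrite lebesgue_measure_itv /= lte_fin le_eqVlt.
by move=> /orP[/eqP ->|->]; rewrite ?ltxx ?subrr -?EFinB.
Qed.

Lemma Rintegral_cst_itvoc (k : R) s t : s <= t ->
  \int[mu]_(x in `]s, t]) k = k * (t - s).
Proof.
move=> st; rewrite Rintegral_cst//; congr (_ * _).
exact: (congr1 fine (lebesgue_itvoc st)).
Qed.

Lemma integrable_cst_itvoc (k : R) s t : mu.-integrable `]s, t] (EFin \o (fun=> k)).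
Proof.
have [st|ts] := leP s t; last first.
  by rewrite set_itv_ge ?bnd_simp -?leNgt ?(ltW ts)//; exact: integrable_set0.
apply/integrableP; split; first exact/measurable_EFinP.
rewrite (_ : (\int[mu]_(x in `]s, t]) _ = \int[mu]_(x in `]s, t]) (cst `|k|%:E) x)%E)//.
rewrite integral_cst//; apply: (@le_lt_trans _ _ (`|k|%:E * mu `]s, t]%classic)%E); first exact: lexx.
by rewrite lebesgue_itvoc// -EFinM ltry.
Qed.

Lemma integrable_cst_Iaa (k : R) : mu.-integrable (Iaa a) (EFin \o (fun=> k)).
Proof.
apply: integrableS (integrable_cst_itvoc k (- a) a) => //; first exact: measurable_Iaa.
by apply: subset_itvl; rewrite bnd_simp.
Qed.

Lemma rL2_bounded f (M : R) : measurable_fun (Iaa a) f ->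
  (forall t, Iaa a t -> `|f t| <= M) -> rL2 f.
Proof.
move=> mf fM; split => //.
have iM : mu.-integrable (Iaa a) (EFin \o (fun=> M ^+ 2)).
  exact: integrable_cst_Iaa.
apply: (integrable_le (measurable_Iaa a) _ iM); first exact: measurable_funX.
move=> t It; rewrite normrX; apply: lerXn2r; rewrite ?nnegrE ?fM//.
by apply: le_trans (fM t It).
Qed.

Lemma rL2_mulb (b : R -> R) f (M : R) : measurable_fun (Iaa a) b -> (forall t, Iaa a t -> `|b t| <= M) ->
  rL2 f -> rL2 (fun t => b t * f t).
Proof.
move=> mb bM [mf if_]; split; first exact: measurable_funM.
have int0 : mu.-integrable (Iaa a) (EFin \o (fun=> 0)) by exact: integrable0.
have i2 := integrable_lin (M ^+ 2) (measurable_Iaa a) if_ int0.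
apply: (integrable_le (measurable_Iaa a) _ i2).
  by apply: measurable_funX; exact: measurable_funM.
move=> t It; rewrite addr0 normrX normrM exprMn -[X in _ * X <= _]normrX (ger0_norm (sqr_ge0 (f t))).
rewrite ler_wpM2r ?sqr_ge0//; apply: lerXn2r; rewrite ?nnegrE ?bM//.
by apply: le_trans (bM t It).
Qed.

Lemma rL2_cst k : rL2 (fun=> k).
Proof. by apply: (@rL2_bounded _ `|k|) => // t _. Qed.

Lemma rL2_integrable f : rL2 f -> mu.-integrable (Iaa a) (EFin \o f).
Proof.
move=> f2; have := rL2_mul f2 (rL2_cst 1).
apply: eq_integrable; first exact: measurable_Iaa.
by move=> t _ /=; rewrite mulr1.
Qed.

Lemma rL2_lin k f g : rL2 f -> rL2 g -> rL2 (fun t => k * f t + g t).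
Proof.
move=> f2 g2; have [mf if_] := f2; have [mg ig] := g2; split.
  by apply: measurable_funD => //; exact: measurable_funM.
have ifg := rL2_mul f2 g2.
have := integrable_lin (k ^+ 2) (measurable_Iaa a) if_
  (integrable_lin (2 * k) (measurable_Iaa a) ifg ig).
apply: eq_integrable; first exact: measurable_Iaa.
by move=> t _ /=; congr EFin; ring.
Qed.

Lemma rL2_eq f g : (forall t, Iaa a t -> f t = g t) -> rL2 f -> rL2 g.
Proof.
move=> fg [mf if_]; split.
  by apply: eq_measurable_fun mf => t; rewrite inE; exact: fg.
apply: eq_integrable if_; first exact: measurable_Iaa.
by move=> t; rewrite inE /= => It; rewrite fg.
Qed.

Lemma rL2_ae f g : measurable_fun (Iaa a) g ->
  {ae mu, forall t, Iaa a t -> g t = f t} -> rL2 f -> rL2 g.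
Proof.
move=> mg gf [mf if_]; split => //.
apply: (integrable_ae (measurable_Iaa a) if_); first exact: measurable_funX.
by apply: aeS gf => t /= gf It; rewrite gf.
Qed.

Lemma continuous_measurable_Iaa f :
  (forall t, - a < t -> t < a -> {for t, continuous f}) -> measurable_fun (Iaa a) f.
Proof.
move=> cf; apply: open_continuous_measurable_fun; first exact: interval_open.
by move=> t; rewrite inE /Iaa /= in_itv/= => /andP[]; exact: cf.
Qed.

Lemma derivable_measurable_Iaa f g :
  (forall t, - a < t -> t < a -> is_derive t 1 f (g t)) -> measurable_fun (Iaa a) f.
Proof.
move=> df; apply: continuous_measurable_Iaa => t h1 h2.
by apply: differentiable_continuous; apply/derivable1_diffP; case: (df t h1 h2).
Qed.

(** On each compact subinterval the integral of [h] is an increment of [F], hence at most [2 * M];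
    monotone convergence along an exhaustion does the rest. *)
Lemma integrable_bounded_primitive h F (M : R) : measurable_fun (Iaa a) h ->
  (forall t, Iaa a t -> 0 <= h t) -> (forall t, Iaa a t -> `|F t| <= M) ->
  (forall c d, - a < c -> c <= d -> d < a -> primitive_on c d F h) ->
  mu.-integrable (Iaa a) (EFin \o h).
Proof.
move=> mh h0 FM ph.
apply/integrableP; split; first exact/measurable_EFinP.
rewrite (_ : (\int[mu]_(x in Iaa a) _ = \int[mu]_(x in Iaa a) (h x)%:E)%E); last first.
  by apply: eq_integral => t; rewrite inE => It /=; rewrite ger0_norm ?h0.
(* The index starts at 2 so that [eps n < a] and every [K n] is a nondegenerate interval around
   0. *)
pose eps n := a / n.+2%:R.
have eps0 n : 0 < eps n by rewrite divr_gt0.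
have epsa n : eps n < a by rewrite ltr_pdivrMr// ltr_pMr// ltr1n.
pose K n : set (measurableTypeR R) := `](- (a - eps n)), (a - eps n)]%classic.
have KI n : K n `<=` Iaa a.
  by apply: sub_Iaa; have := eps0 n; have := epsa n; lra.
have UK : \bigcup_n K n = Iaa a.
  apply/seteqP; split => [t [n _]|t]; first exact: KI.
  rewrite /Iaa /= in_itv/= => /andP[h1 h2].
  have m0 : 0 < (a - `|t|) by rewrite subr_gt0 ltr_norml h1.
  exists (Num.truncn (a / (a - `|t|))) => //; rewrite /K /= in_itv/=.
  have et : eps (Num.truncn (a / (a - `|t|))) < a - `|t|.
    rewrite /eps ltr_pdivrMr// mulrC -ltr_pdivrMr//.
    by apply: (lt_trans (truncnS_gt _)); rewrite ltr_nat.
  have := ler_norm t; have := ler_norm (- t); rewrite normrN => ? ?.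
  by apply/andP; split; lra.
have nK : nondecreasing_seq K.
  have ele m n : (m <= n)%N -> eps n <= eps m.
    by move=> mn; rewrite ler_pM2l// lef_pV2 ?posrE// ler_nat.
  by move=> m n /ele mn; apply/subsetPset; apply: subset_itv; rewrite bnd_simp; lra.
have := @ge0_nondecreasing_set_cvg_integral _ _ R K (EFin \o h) (@lebesgue_measure R) nK.
rewrite UK => /(_ _ _ _)H.
apply: (@le_lt_trans _ _ (2 * M)%:E); last exact: ltry.
have Hc : ((\int[mu]_(x in K n) (h x)%:E)%E @[n --> \oo] --> (\int[mu]_(x in Iaa a) (h x)%:E)%E).
  apply: H => //.
  - by move=> n; exact: measurable_itv.
  - move=> n; apply/measurable_EFinP; apply: measurable_funS mh; [exact: measurable_Iaa|exact: KI].
  - by move=> n t Kt; rewrite lee_fin h0//; exact: KI Kt.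
rewrite -(cvg_lim _ Hc)//.
apply: lime_le; first by apply/cvg_ex; eexists; exact: Hc.
apply: nearW => n.
have e0 := eps0 n; have ea := epsa n.
have [intK E] : primitive_on (- (a - eps n)) (a - eps n) F h by apply: ph; lra.
have fin : (\int[mu]_(x in K n) (h x)%:E)%E \is a fin_num.
  by apply: integrable_fin_num intK; exact: measurable_itv.
rewrite -(fineK fin).
have {}E : F (a - eps n) - F (- (a - eps n)) = fine (\int[mu]_(x in K n) (h x)%:E).
  by apply: E; lra.
rewrite -E lee_fin.
have h1 : `|F (a - eps n)| <= M.
  by apply: FM; rewrite /Iaa/= in_itv/=; have := eps0 n; have := epsa n => ? ?; apply/andP; split; lra.
have h2 : `|F (- (a - eps n))| <= M.
  by apply: FM; rewrite /Iaa/= in_itv/=; have := eps0 n; have := epsa n => ? ?; apply/andP; split; lra.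
move: h1 h2; rewrite !ler_norml => /andP[? ?] /andP[? ?]; lra.
Qed.

Lemma ln_bound s : 0 < s -> `|ln s| <= s + s^-1.
Proof.
move=> s0; have sV0 : 0 < s^-1 by rewrite invr_gt0.
have := ln_sublinear s0; have := ln_sublinear sV0; rewrite lnV ?posrE// => h1 h2.
by rewrite ler_norml; apply/andP; split; lra.
Qed.

(* F s = s ln^2 s - 2 s ln s + 2 s is a primitive of ln^2. *)
Lemma ln2_primitive_bound s : 0 < s ->
  `|s * ln s ^+ 2 - 2 * (s * ln s) + 2 * s| <= 4 * (s + 1) ^+ 2 + 2 * (s ^+ 2 + 1) + 2 * s.
Proof.
move=> s0; have r0 : 0 < Num.sqrt s by rewrite sqrtr_gt0.
have sE : Num.sqrt s ^+ 2 = s by rewrite sqr_sqrtr// ltW.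
have sl (w : R) : 0 < w -> `|w * ln w| <= w ^+ 2 + 1.
  move=> w0; rewrite normrM (gtr0_norm w0).
  have -> : w ^+ 2 + 1 = w * (w + w^-1) by rewrite mulrDr divff ?gt_eqF// expr2.
  by rewrite ler_pM2l// ln_bound.
have h1 : `|s * ln s ^+ 2| <= 4 * (s + 1) ^+ 2.
  have -> : s * ln s ^+ 2 = 4 * (Num.sqrt s * ln (Num.sqrt s)) ^+ 2.
    rewrite -{1 2}sE lnXn// mulr2n; ring.
  rewrite normrM (ger0_norm (x := 4))// ler_pM2l// normrX.
  apply: lerXn2r; rewrite ?nnegrE//; first by lra.
  by rewrite -[X in _ <= X + _]sE; exact: sl.
have h2 := sl _ s0.
apply: (le_trans (ler_normD _ _)); apply: lerD; last by rewrite ger0_norm// mulr_ge0// ltW.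
apply: (le_trans (ler_normB _ _)); apply: lerD => //.
by rewrite normrM (ger0_norm (x := 2))// ler_pM2l.
Qed.

Lemma is_derive_affine (k : R) t : is_derive t 1 (fun y : R => a + k * y) k.
Proof.
have := is_deriveD (is_derive_cst a t 1) (is_deriveZ k (is_derive_id t (1 : R))).
by move=> /is_derive_eq; apply; rewrite /GRing.scale /= mulr1 add0r.
Qed.

Lemma is_derive_ln_affine (k : R) t : k ^+ 2 = 1 -> - a < t -> t < a ->
  0 < a + k * t /\ is_derive t 1 (fun y => ln (a + k * y)) (k / (a + k * t)).
Proof.
move=> k2 h1 h2; have p0 : 0 < a + k * t.
  have /eqP := k2; rewrite sqrf_eq1 => /orP[] /eqP ->; lra.
split=> //; have d1 := is_derive_affine k t.
have := is_derive1_comp (g := fun y : R => a + k * y) (is_derive1_ln p0) d1.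
by move=> /is_derive_eq; apply; rewrite mulrC.
Qed.

(** The parameter [k] is 1 or -1 and treats both ends at once. As [weight] is
    [(a - k t)(a + k t) / a^2], multiplying the derivative [k / (a + k t)] by it leaves an affine
    function, with constant derivative. *)
Lemma sol_ln (k : R) : k ^+ 2 = 1 ->
  sol a (fun t => ln (a + k * t)) (fun t => k * (a - k * t) / a ^+ 2) (fun=> - (a ^- 2)).
Proof.
move=> k2; have a0 : a != 0 by rewrite gt_eqF.
split.
  split; first exact: integrable_cst_Iaa.
  move=> s t as' st ta; rewrite Rintegral_cst_itvoc//.
  have -> : k * (a - k * t) / a ^+ 2 - k * (a - k * s) / a ^+ 2 =
     - (k ^+ 2 * (t - s) / a ^+ 2) by field.
  by rewrite k2; field.
move=> t h1 h2; have [p0 d] := is_derive_ln_affine k2 h1 h2.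
apply: (is_derive_eq d); rewrite weightE//.
have -> : (a - t) * (a + t) = (a - k * t) * (a + k * t).
  by rewrite -!subr_sqr exprMn k2 mul1r.
have q0 : a - k * t != 0.
  have /eqP := k2; rewrite sqrf_eq1 => /orP[] /eqP ->; apply/eqP; lra.
by field; rewrite a0 (gt_eqF p0) q0.
Qed.

(** By [k ^+ 2 = 1], the function [k * G (a + k * t)] is a primitive of the squared logarithm, and
    it is bounded because [s ln^2 s] stays bounded near 0. *)
Lemma rL2_ln (k : R) : k ^+ 2 = 1 -> rL2 (fun t => ln (a + k * t)).
Proof.
move=> k2; have ml : measurable_fun (Iaa a) (fun t => ln (a + k * t)).
  by apply: derivable_measurable_Iaa => t h1 h2; exact: (is_derive_ln_affine k2 h1 h2).2.
split=> //.
pose G s := s * ln s ^+ 2 - 2 * (s * ln s) + 2 * s.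
have lb t : Iaa a t -> 0 < a + k * t /\ a + k * t < 2 * a.
  rewrite /Iaa/= in_itv/= => /andP[h1 h2]; split.
    exact: (is_derive_ln_affine k2 h1 h2).1.
  have /eqP := k2; rewrite sqrf_eq1 => /orP[] /eqP ->; lra.
apply: (@integrable_bounded_primitive _ (fun t => k * G (a + k * t))
   (4 * (2 * a + 1) ^+ 2 + 2 * ((2 * a) ^+ 2 + 1) + 2 * (2 * a))).
- exact: measurable_funX.
- by move=> t _; exact: sqr_ge0.
- move=> t /lb[p0 p2]; rewrite normrM (_ : `|k| = 1); last first.
    by have /eqP := k2; rewrite sqrf_eq1 => /orP[] /eqP ->; rewrite ?normrN normr1.
  rewrite mul1r; apply: (le_trans (ln2_primitive_bound p0)).
  apply: lerD; [apply: lerD|lra].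
    by rewrite ler_pM2l//; apply: lerXn2r; rewrite ?nnegrE; lra.
  by rewrite ler_pM2l// lerD2r; apply: lerXn2r; rewrite ?nnegrE; lra.
move=> c d ac cd da.
(* An affine function is smallest at an end of [c, d]; through [ln_bound] this bounds the squared
   logarithm there. *)
pose m := Num.min (a + k * c) (a + k * d).
have Ic : Iaa a c by rewrite /Iaa/= in_itv/= ac (le_lt_trans cd).
have Id : Iaa a d by rewrite /Iaa/= in_itv/= da (lt_le_trans ac).
have m0 : 0 < m by rewrite lt_min (lb _ Ic).1 (lb _ Id).1.
apply: (@bounded_derive_primitive _ _ _ _ _ ((2 * a + m^-1) ^+ 2) cd).
- move=> t ct td; have at' : - a < t by lra. have ta : t < a by lra.
  have [p0 dl] := is_derive_ln_affine k2 at' ta.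
  have d1 := is_derive_affine k t.
  have d2 := is_derive_mul_fun d1 dl.
  have d3 := is_derive_mul_fun d2 dl.
  have d4 := is_derive_lin_fun (- 2) d2 (is_derive_lin_fun 2 d1 d3).
  have d5 := is_derive_lin_fun k d4 (is_derive_cst (0 : R) t 1).
  rewrite (_ : (fun t => k * G (a + k * t)) = (fun y => k *
     (- 2 * ((a + k * y) * ln (a + k * y)) + (2 * (a + k * y) +
     (a + k * y) * ln (a + k * y) * ln (a + k * y))) + cst 0 y)); last first.
    by apply/funext => y; rewrite /G /=; ring.
  apply: (is_derive_eq d5).
  have p0' : a + k * t != 0 by rewrite gt_eqF.
  transitivity (k ^+ 2 * ln (a + k * t) ^+ 2); last by rewrite k2 mul1r.
  by field.
- move=> t ct td; have It : Iaa a t by rewrite /Iaa/= in_itv/=; apply/andP; split; lra.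
  have [p0 p2] := lb _ It.
  rewrite normrX; apply: lerXn2r; rewrite ?nnegrE// ?addr_ge0 ?invr_ge0 ?(ltW m0)//.
    by have := a_gt0; lra.
  apply: (le_trans (ln_bound p0)); apply: lerD; first exact: ltW.
  rewrite lef_pV2 ?posrE// /m ge_min.
  have /eqP := k2; rewrite sqrf_eq1 => /orP[] /eqP ->; apply/orP; [left|right]; lra.
- apply: measurable_funX; apply: measurable_funS ml; first exact: measurable_Iaa.
  by apply: sub_Iaa => //; exact: ltW.
Qed.
End SquareIntegrable.

(** * The real maximal domain: boundary values and Green's formula *)

Section RealMaximal.
Context {R : realType} (a : R) (a_gt0 : 0 < a).
Implicit Types (f g h x y z w q r : R -> R) (s t : R).
Notation mu := (@lebesgue_measure R).

(* x is a real function in the domain of the maximal operator, q = weight * x'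
   and y = L x. *)
Definition rmax x q y : Prop :=
  [/\ rL2 a x, rL2 a y & sol a x q (fun t => t ^+ 2 * x t - y t)].

Lemma rmax_lin k x q y z r w : rmax x q y -> rmax z r w ->
  rmax (fun t => k * x t + z t) (fun t => k * q t + r t) (fun t => k * y t + w t).
Proof.
move=> [x2 y2 sx] [z2 w2 sz]; split; [exact: rL2_lin..|].
have := sol_lin k sx sz.
by congr (sol _ _ _ _); apply/funext => t; ring.
Qed.

Lemma rL2_sqr f : rL2 a f -> rL2 a (fun t => t ^+ 2 * f t).
Proof.
apply: (@rL2_mulb _ _ _ _ (a ^+ 2)); first by apply: measurable_funTS; exact: exprn_measurable.
move=> t; rewrite /Iaa/= in_itv/= => /andP[h1 h2].
rewrite normrX; apply: lerXn2r; rewrite ?nnegrE ?(ltW a_gt0)//.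
by rewrite ler_norml; apply/andP; split; lra.
Qed.

Lemma sol_rmax x q f : rL2 a x -> rL2 a f -> sol a x q f ->
  rmax x q (fun t => t ^+ 2 * x t - f t).
Proof.
move=> x2 f2 sx; split => //.
  have := rL2_lin (-1) f2 (rL2_sqr x2); apply: rL2_eq => t _; ring.
by move: sx; congr (sol _ _ _ _); apply/funext => t; ring.
Qed.

Lemma rmax1 : rmax (fun=> 1) (fun=> 0) (fun t => t ^+ 2).
Proof.
have : rmax (fun=> 1) (fun=> 0) (fun t => t ^+ 2 * 1 - 0).
  apply: sol_rmax; [exact: rL2_cst..|]; split; last first.
    by move=> t _ _; rewrite mul0r; exact: is_derive_cst.
  split; first exact: integrable_cst_Iaa.
  by move=> s t as' st ta; rewrite Rintegral_cst_itvoc// subrr mul0r.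
by congr rmax; apply/funext => t; ring.
Qed.

Lemma rmax_ln (k : R) : k ^+ 2 = 1 ->
  rmax (fun t => ln (a + k * t)) (fun t => k * (a - k * t) / a ^+ 2)
    (fun t => t ^+ 2 * ln (a + k * t) - - (a ^- 2)).
Proof.
by move=> k2; apply: sol_rmax; [exact: rL2_ln|exact: rL2_cst|exact: sol_ln].
Qed.

Definition wronskian x q z r t := q t * z t - x t * r t.

(** Green's identity makes the Wronskian a primitive of [x w - y z], integrable on (-a, a) as a
    combination of products of square integrable functions; [prim_limits] applies. *)
Lemma rmax_wronskian x q y z r w : rmax x q y -> rmax z r w ->
  exists l1 l2, [/\ wronskian x q z r t @[t --> (- a)^'+] --> l1,
    wronskian x q z r t @[t --> a^'-] --> l2 &
    l2 - l1 = \int[mu]_(t in Iaa a) (x t * w t - y t * z t)].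
Proof.
move=> [x2 y2 sx] [z2 w2 sz]; apply: prim_limits => //; split.
  have := integrable_lin (-1) (measurable_Iaa a) (rL2_mul y2 z2) (rL2_mul x2 w2).
  by apply: eq_integrable; [exact: measurable_Iaa|move=> t _ /=; congr EFin; ring].
move=> s t as' st ta; rewrite /wronskian (sol_green a_gt0 sx sz)//.
by apply: eq_Rintegral => u _; ring.
Qed.

Lemma real_cvg_unique (F : set_system R) {FF : ProperFilter F} f (l l' : R) :
  f t @[t --> F] --> l -> f t @[t --> F] --> l' -> l = l'.
Proof.
by move=> h1 h2; rewrite -(cvg_lim (@Rhausdorff R) h1) -(cvg_lim (@Rhausdorff R) h2).
Qed.

(** A relation rather than four values of [lim]: it carries the existence of the limits. *)
Definition boundary_values x (bl cl br cr : R) : Prop :=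
  [/\ (t + a) * derive1 x t @[t --> (- a)^'+] --> bl,
      ((t + a) * ln (a + t)) * derive1 x t - x t @[t --> (- a)^'+] --> cl,
      (t - a) * derive1 x t @[t --> a^'-] --> br &
      ((t - a) * ln (a - t)) * derive1 x t - x t @[t --> a^'-] --> cr].

Lemma near_left_end (P : R -> Prop) : (forall t, - a < t -> t < a -> P t) ->
  \forall t \near (- a)^'+, P t.
Proof.
move=> H; near=> t; apply: H => //; near: t; apply: nbhs_right_lt.
by have := a_gt0; lra.
Unshelve. all: by end_near. Qed.

Lemma near_right_end (P : R -> Prop) : (forall t, - a < t -> t < a -> P t) ->
  \forall t \near a^'-, P t.
Proof.
move=> H; near=> t; apply: H => //; near: t; apply: nbhs_left_gt.
by have := a_gt0; lra.
Unshelve. all: by end_near. Qed.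

Lemma cvg_left_end f g (l : R) : (forall t, - a < t -> t < a -> f t = g t) ->
  g t @[t --> (- a)^'+] --> l -> f t @[t --> (- a)^'+] --> l.
Proof.
move=> fg; apply: cvg_trans; apply: near_eq_cvg; apply: near_left_end => t h1 h2.
by rewrite fg.
Qed.

Lemma cvg_right_end f g (l : R) : (forall t, - a < t -> t < a -> f t = g t) ->
  g t @[t --> a^'-] --> l -> f t @[t --> a^'-] --> l.
Proof.
move=> fg; apply: cvg_trans; apply: near_eq_cvg; apply: near_right_end => t h1 h2.
by rewrite fg.
Qed.

Lemma rmax_derive1 x q y t : rmax x q y -> - a < t -> t < a ->
  derive1 x t = q t / weight a t.
Proof.
by move=> [_ _ [_ dx]] h1 h2; have d := dx t h1 h2; rewrite derive1E (@derive_val _ _ _ _ _ _ _ d).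
Qed.

(** The point [- (k * a)] is the end at which [a + k * t] vanishes. There the two coefficients are
    the reciprocal factors, up to sign, between boundary quantities and Wronskians, the other factor
    of [weight] being absorbed in [t + a] or [t - a]. *)
Lemma cvg_coef (k : R) : k ^+ 2 = 1 ->
  (a ^+ 2 / (a - k * t) @[t --> (- (k * a))] --> a / 2) /\
  ((a - k * t) / a ^+ 2 @[t --> (- (k * a))] --> 2 / a).
Proof.
move=> k2; have a0 : a != 0 by rewrite gt_eqF.
have c : a - k * t @[t --> (- (k * a))] --> (2 * a : R).
  have -> : 2 * a = a - k * (- (k * a)) by have := k2; rewrite expr2 mulrN mulrA => ->; ring.
  apply: (@cvgB _ R^o); first exact: cvg_cst.
  by apply: (@cvgM R); [exact: cvg_cst|exact: cvg_id].
split.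
  have -> : a / 2 = a ^+ 2 * (2 * a)^-1 by field.
  apply: (@cvgM R); first exact: cvg_cst.
  by apply: (@cvgV R R); rewrite ?mulf_neq0.
have -> : 2 / a = (2 * a) / a ^+ 2 by field.
by apply: (@cvgM R); last exact: cvg_cst.
Qed.

Lemma cvg_coef_left :
  (a ^+ 2 / (a - t) @[t --> (- a)^'+] --> a / 2) /\
  ((a - t) / a ^+ 2 @[t --> (- a)^'+] --> 2 / a).
Proof.
have [] := @cvg_coef 1 (expr1n _ _); rewrite mul1r => h1 h2.
split; [move: h1|move: h2] => /cvg_at_right_filter h.
  by apply: cvg_trans h; apply: near_eq_cvg; near=> t; rewrite mul1r.
by apply: cvg_trans h; apply: near_eq_cvg; near=> t; rewrite mul1r.
Unshelve. all: by end_near. Qed.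

Lemma cvg_coef_right :
  (a ^+ 2 / (a + t) @[t --> a^'-] --> a / 2) /\
  ((a + t) / a ^+ 2 @[t --> a^'-] --> 2 / a).
Proof.
have k2 : (-1 : R) ^+ 2 = 1 by rewrite sqrrN expr1n.
have [] := cvg_coef k2; rewrite mulN1r opprK => h1 h2.
split; [move: h1|move: h2] => /cvg_at_left_filter h.
  by apply: cvg_trans h; apply: near_eq_cvg; near=> t; rewrite mulN1r opprK.
by apply: cvg_trans h; apply: near_eq_cvg; near=> t; rewrite mulN1r opprK.
Unshelve. all: by end_near. Qed.

(* Each boundary quantity is, up to a nonvanishing factor, the Wronskian of x
   with 1, ln (a + t) or ln (a - t). *)
Lemma rmax_boundary x q y : rmax x q y -> exists bl cl br cr, boundary_values x bl cl br cr.
Proof.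
move=> mx; have a0 : a != 0 by rewrite gt_eqF.
have k1 : (1 : R) ^+ 2 = 1 by rewrite expr1n.
have k2 : (-1 : R) ^+ 2 = 1 by rewrite sqrrN expr1n.
have [b1 [b2 [B1 B2 _]]] := rmax_wronskian mx rmax1.
have [c1 [_ [C1 _ _]]] := rmax_wronskian mx (rmax_ln k1).
have [_ [c2 [_ C2 _]]] := rmax_wronskian mx (rmax_ln k2).
have [L _] := cvg_coef_left; have [Rt _] := cvg_coef_right.
exists (a / 2 * b1), (a / 2 * c1), (- (a / 2 * b2)), (- (a / 2 * c2)); split.
- apply: cvg_left_end (cvgM L B1) => t h1 h2 /=.
  rewrite (rmax_derive1 mx)// /wronskian weightE//; field.
  by rewrite a0 !gt_eqF//; lra.
- apply: cvg_left_end (cvgM L C1) => t h1 h2 /=.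
  rewrite (rmax_derive1 mx)// /wronskian weightE// !mul1r; field.
  by rewrite a0 !gt_eqF//; lra.
- apply: cvg_right_end (cvgN (cvgM Rt B2)) => t h1 h2 /=.
  rewrite (rmax_derive1 mx)// /wronskian weightE//; field.
  by rewrite a0 !gt_eqF//; lra.
- apply: cvg_right_end (cvgN (cvgM Rt C2)) => t h1 h2 /=.
  rewrite (rmax_derive1 mx)// /wronskian weightE// !mulN1r opprK; field.
  by rewrite a0 !gt_eqF//; lra.
Qed.

Lemma boundary_unique x bl cl br cr bl' cl' br' cr' :
  boundary_values x bl cl br cr -> boundary_values x bl' cl' br' cr' ->
  [/\ bl = bl', cl = cl', br = br' & cr = cr'].
Proof.
move=> [h1 h2 h3 h4] [g1 g2 g3 g4].
by split; [exact: real_cvg_unique h1 g1|exact: real_cvg_unique h2 g2|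
  exact: real_cvg_unique h3 g3|exact: real_cvg_unique h4 g4].
Qed.

Lemma boundary_lin k x q y bl cl br cr z r w bl' cl' br' cr' :
  rmax x q y -> rmax z r w ->
  boundary_values x bl cl br cr -> boundary_values z bl' cl' br' cr' ->
  boundary_values (fun t => k * x t + z t)
    (k * bl + bl') (k * cl + cl') (k * br + br') (k * cr + cr').
Proof.
move=> mx mz [h1 h2 h3 h4] [g1 g2 g3 g4]; have mxz := rmax_lin k mx mz.
have a0 : a != 0 by rewrite gt_eqF.
have K (l : R) (F : set_system R) f (FF : Filter F) : f t @[t --> F] --> l ->
    k * f t @[t --> F] --> k * l.
  by move=> h; apply: (@cvgM R) => //; exact: cvg_cst.
have E t : - a < t -> t < a -> derive1 (fun t => k * x t + z t) t = k * derive1 x t + derive1 z t.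
  move=> k1 k2; rewrite (rmax_derive1 mx)// (rmax_derive1 mz)// (rmax_derive1 mxz)//.
  by rewrite mulrDl mulrA.
split.
- by apply: cvg_left_end (cvgD (K _ _ _ _ h1) g1) => t k1 k2 /=; rewrite E//; ring.
- by apply: cvg_left_end (cvgD (K _ _ _ _ h2) g2) => t k1 k2 /=; rewrite E//; ring.
- by apply: cvg_right_end (cvgD (K _ _ _ _ h3) g3) => t k1 k2 /=; rewrite E//; ring.
- by apply: cvg_right_end (cvgD (K _ _ _ _ h4) g4) => t k1 k2 /=; rewrite E//; ring.
Qed.

(** Before the limit, the logarithms cancel in [c b' - b c'] and leave [(t + a)(x' z - x z')]; the
    factor [(a - t) / a^2] completes this to the Wronskian. At the right end [t - a] replaces
    [t + a], which reverses the sign. *)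
Lemma rmax_green x q y bl cl br cr z r w bl' cl' br' cr' :
  rmax x q y -> rmax z r w ->
  boundary_values x bl cl br cr -> boundary_values z bl' cl' br' cr' ->
  \int[mu]_(t in Iaa a) (y t * z t) - \int[mu]_(t in Iaa a) (x t * w t) =
  2 / a * ((cl * bl' - bl * cl') + (cr * br' - br * cr')).
Proof.
move=> mx mz [h1 h2 h3 h4] [g1 g2 g3 g4].
have [l1 [l2 [W1 W2 E]]] := rmax_wronskian mx mz.
have a0 : a != 0 by rewrite gt_eqF.
have [_ L] := cvg_coef_left; have [_ Rt] := cvg_coef_right.
have e1 : l1 = 2 / a * (cl * bl' - bl * cl').
  apply: (real_cvg_unique W1).
  apply: (@cvg_left_end _ (fun t => (a - t) / a ^+ 2 *
    ((((t + a) * ln (a + t)) * derive1 x t - x t) * ((t + a) * derive1 z t) -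
     (t + a) * derive1 x t * (((t + a) * ln (a + t)) * derive1 z t - z t))));
    last exact: (cvgM L (cvgB (cvgM h2 g1) (cvgM h1 g2))).
  move=> t k1 k2; rewrite /wronskian !(rmax_derive1 mx, rmax_derive1 mz)// weightE//; field.
  by rewrite a0 !gt_eqF//; lra.
have e2 : l2 = - (2 / a * (cr * br' - br * cr')).
  apply: (real_cvg_unique W2).
  apply: (@cvg_right_end _ (fun t => - ((a + t) / a ^+ 2 *
    ((((t - a) * ln (a - t)) * derive1 x t - x t) * ((t - a) * derive1 z t) -
     (t - a) * derive1 x t * (((t - a) * ln (a - t)) * derive1 z t - z t)))));
    last exact: (cvgN (cvgM Rt (cvgB (cvgM h4 g3) (cvgM h3 g4)))).
  move=> t k1 k2; rewrite /wronskian !(rmax_derive1 mx, rmax_derive1 mz)// weightE//; field.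
  by rewrite a0 !gt_eqF//; lra.
have [x2 y2 _] := mx; have [z2 w2 _] := mz.
rewrite RintegralB in E; [|exact: measurable_Iaa|exact: rL2_mul|exact: rL2_mul].
move: E; rewrite e1 e2 => E.
have -> : \int[mu]_(t in Iaa a) (y t * z t) - \int[mu]_(t in Iaa a) (x t * w t) =
  - (\int[mu]_(t in Iaa a) (x t * w t) - \int[mu]_(t in Iaa a) (y t * z t)) by ring.
by rewrite -E; ring.
Qed.

Lemma derive1_eq_Iaa x z t : (forall t, - a < t -> t < a -> x t = z t) ->
  - a < t -> t < a -> derive1 x t = derive1 z t.
Proof.
move=> xz k1 k2; rewrite !derive1E; apply: near_eq_derive.
have tI : t \in `]- a, a[ by rewrite in_itv/= k1.
near=> s; have : s \in `]- a, a[ by near: s; exact: near_in_itvoo.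
by rewrite in_itv/= => /andP[]; exact: xz.
Unshelve. all: by end_near. Qed.

Lemma boundary_ext x z bl cl br cr : (forall t, - a < t -> t < a -> x t = z t) ->
  boundary_values x bl cl br cr -> boundary_values z bl cl br cr.
Proof.
move=> xz [h1 h2 h3 h4]; have E t := derive1_eq_Iaa xz.
by split; [move: h1|move: h2|move: h3|move: h4];
  [apply: cvg_left_end|apply: cvg_left_end|apply: cvg_right_end|apply: cvg_right_end] => t k1 k2;
  rewrite ?xz// -E.
Qed.

(** Write [s ln s] as [2 sqrt s (sqrt s ln (sqrt s))]. By [ln_bound] the last factor is at most
    [s + 1] in absolute value, and the remaining [sqrt s] gives the limit 0 at 0. *)
Lemma xlnx_bound s : 0 < s -> `|s * ln s| <= 2 * Num.sqrt s * (s + 1).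
Proof.
move=> s0; have r0 : 0 < Num.sqrt s by rewrite sqrtr_gt0.
have sE : Num.sqrt s ^+ 2 = s by rewrite sqr_sqrtr// ltW.
have -> : s * ln s = 2 * Num.sqrt s * (Num.sqrt s * ln (Num.sqrt s)).
  by rewrite -{1 2}sE lnXn// mulr2n; ring.
rewrite normrM (gtr0_norm (x := 2 * _)) ?mulr_gt0// ler_pM2l ?mulr_gt0//.
rewrite normrM (gtr0_norm r0) -[X in _ <= X + _]sE.
have -> : Num.sqrt s ^+ 2 + 1 = Num.sqrt s * (Num.sqrt s + (Num.sqrt s)^-1).
  by rewrite mulrDr divff ?gt_eqF// expr2.
by rewrite ler_pM2l// ln_bound.
Qed.

Lemma cvg_xlnx (F : set_system R) {FF : ProperFilter F} f :
  f t @[t --> F] --> (0 : R) -> (\forall t \near F, 0 < f t) ->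
  f t * ln (f t) @[t --> F] --> (0 : R).
Proof.
move=> f0 fpos.
have H : 2 * Num.sqrt (f t) * (f t + 1) @[t --> F] --> (0 : R).
  have -> : 0 = 2 * Num.sqrt 0 * (0 + 1) :> R by rewrite sqrtr0 mulr0 mul0r.
  apply: (@cvgM R); last by apply: cvgD => //; exact: cvg_cst.
  apply: (@cvgM R); first exact: cvg_cst.
  by apply: (@cvg_comp _ _ _ f Num.sqrt _ _ _ f0); exact: sqrt_continuous.
apply: (squeeze_cvgr (f := fun t => - (2 * Num.sqrt (f t) * (f t + 1)))
  (h := fun t => 2 * Num.sqrt (f t) * (f t + 1))) => //.
- near=> t; have /xlnx_bound : 0 < f t by near: t.
  by rewrite ler_norml.
- by rewrite -oppr0; exact: cvgN.
Unshelve. all: by end_near. Qed.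

Lemma xlnx_left : (t + a) * ln (a + t) @[t --> (- a)^'+] --> (0 : R).
Proof.
apply: (@cvg_left_end _ (fun t => (a + t) * ln (a + t))).
  by move=> t _ _; rewrite addrC.
apply: cvg_xlnx; last by apply: near_left_end => t; lra.
rewrite -[0](subrr a); apply: cvg_at_right_filter.
by apply: cvgD; [exact: cvg_cst|exact: cvg_id].
Qed.

Lemma xlnx_right : (t - a) * ln (a - t) @[t --> a^'-] --> (0 : R).
Proof.
apply: (@cvg_right_end _ (fun t => - ((a - t) * ln (a - t)))).
  by move=> t _ _; ring.
rewrite -[0]oppr0; apply: cvgN.
apply: cvg_xlnx; last by apply: near_right_end => t; lra.
rewrite -[0](subrr a); apply: cvg_at_left_filter.
by apply: cvgB; [exact: cvg_cst|exact: cvg_id].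
Qed.

(** The function [t] completes 1 and the two logarithms to four independent sets of boundary values;
    its [q] is [weight] itself. *)
Lemma rmax_id : exists q y, rmax id q y.
Proof.
have Iid t : Iaa a t -> `|t| <= a.
  by rewrite /Iaa/= in_itv/= => /andP[h1 h2]; rewrite ler_norml (ltW h1) ltW.
have i2 : rL2 a id by apply: (@rL2_bounded _ _ _ a) => //; exact: measurable_id.
have f2 : rL2 a (fun t => - 2 / a ^+ 2 * t).
  have := rL2_lin (- 2 / a ^+ 2) i2 (rL2_cst a 0); apply: rL2_eq => t _.
  by rewrite addr0.
exists (weight a), (fun t => t ^+ 2 * t - (- 2 / a ^+ 2 * t)).
apply: sol_rmax => //; split; last first.
  move=> t h1 h2; rewrite divff ?gt_eqF ?weight_gt0//; exact: is_derive_id.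
split; first exact: rL2_integrable.
move=> s t as' st ta.
have : primitive_on s t (weight a) (fun y : R => - 2 / a ^+ 2 * y).
  apply: (@bounded_derive_primitive _ _ _ _ _ (`|2 / a ^+ 2| * a) st).
  - move=> y _ _.
    have d := is_derive_lin_fun (- (a ^- 2)) (is_derive_mul_fun (is_derive_id y (1 : R)) (is_derive_id y (1 : R)))
      (is_derive_cst (1 : R) y 1).
    have -> : weight a = (fun y : R => - (a ^- 2) * (id y * id y) + cst 1 y).
      by apply/funext => u; rewrite /weight /=; ring.
    by apply: (is_derive_eq d); rewrite /=; ring.
  - move=> y sy yt; rewrite normrM mulNr normrN ler_wpM2l// Iid// /Iaa/= in_itv/=.
    by apply/andP; split; lra.
  - by apply: measurable_funM.
by case=> _; apply.
Qed.

Lemma boundary_id : boundary_values id 0 a 0 (- a).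
Proof.
have d t : derive1 (@id R) t = 1.
  by rewrite derive1E; exact: (@derive_val _ _ _ _ _ _ _ (is_derive_id t (1 : R))).
split.
- apply: (@cvg_left_end _ (fun t => t + a)); first by move=> t _ _; rewrite d mulr1.
  rewrite -[0](subrr a) addrC; apply: cvg_at_right_filter.
  by apply: cvgD; [exact: cvg_id|exact: cvg_cst].
- apply: (@cvg_left_end _ (fun t => (t + a) * ln (a + t) - t)).
    by move=> t _ _; rewrite d mulr1.
  suff : (t + a) * ln (a + t) - t @[t --> (- a)^'+] --> 0 - - a by rewrite sub0r opprK.
  by apply: cvgB; [exact: xlnx_left|apply: cvg_at_right_filter; exact: cvg_id].
- apply: (@cvg_right_end _ (fun t => t - a)); first by move=> t _ _; rewrite d mulr1.
  rewrite -[0](subrr a); apply: cvg_at_left_filter.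
  by apply: cvgB; [exact: cvg_id|exact: cvg_cst].
- apply: (@cvg_right_end _ (fun t => (t - a) * ln (a - t) - t)).
    by move=> t _ _; rewrite d mulr1.
  suff : (t - a) * ln (a - t) - t @[t --> a^'-] --> 0 - a by rewrite sub0r.
  by apply: cvgB; [exact: xlnx_right|apply: cvg_at_left_filter; exact: cvg_id].
Qed.

Lemma boundary1 : boundary_values (fun=> 1) 0 (-1) 0 (-1).
Proof.
have d t : derive1 (fun=> 1 : R) t = 0.
  by rewrite derive1E; exact: (@derive_val _ _ _ _ _ _ _ (is_derive_cst (1 : R) t 1)).
by split; [apply: (@cvg_left_end _ (cst 0))|apply: (@cvg_left_end _ (cst (-1)))|
  apply: (@cvg_right_end _ (cst 0))|apply: (@cvg_right_end _ (cst (-1)))];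
  try (by move=> t _ _ /=; rewrite d ?mulr0 ?sub0r); exact: cvg_cst.
Qed.

Lemma boundary_ln_left :
  boundary_values (fun t => ln (a + 1 * t)) 1 0 0 (- ln (2 * a)).
Proof.
have k1 : (1 : R) ^+ 2 = 1 by rewrite expr1n.
have d t : - a < t -> t < a -> derive1 (fun t => ln (a + 1 * t)) t = (a + t)^-1.
  move=> h1 h2; have [_ D] := is_derive_ln_affine k1 h1 h2.
  by rewrite derive1E (@derive_val _ _ _ _ _ _ _ D) mul1r mul1r.
have ca : a + t @[t --> a] --> 2 * a.
  by rewrite (mulr_natl a 2) mulr2n; apply: cvgD; [exact: cvg_cst|exact: cvg_id].
have caV : (a + t)^-1 @[t --> a^'-] --> (2 * a)^-1.
  apply: cvg_at_left_filter; apply: (@cvgV R R) => //.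
  by rewrite mulf_neq0 ?gt_eqF.
split.
- apply: (@cvg_left_end _ (cst 1)); last exact: cvg_cst.
  by move=> t h1 h2; rewrite d// addrC divff// gt_eqF//; lra.
- apply: (@cvg_left_end _ (cst 0)); last exact: cvg_cst.
  move=> t h1 h2; rewrite d// mul1r /=; field; rewrite gt_eqF//; lra.
- apply: (@cvg_right_end _ (fun t => (t - a) * (a + t)^-1)).
    by move=> t h1 h2; rewrite d.
  rewrite -[0](mul0r (2 * a)^-1); apply: (@cvgM R); last exact: caV.
  rewrite -[0](subrr a); apply: cvg_at_left_filter.
  by apply: cvgB; [exact: cvg_id|exact: cvg_cst].
- apply: (@cvg_right_end _ (fun t => (t - a) * ln (a - t) * (a + t)^-1 - ln (a + t))).
    by move=> t h1 h2; rewrite d// mul1r.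
  rewrite -[- ln _]add0r; apply: cvgB.
    by rewrite -[0](mul0r (2 * a)^-1); apply: (@cvgM R); [exact: xlnx_right|exact: caV].
  apply: cvg_at_left_filter.
  apply: (@cvg_comp _ _ _ (fun t => a + t) (@ln R)); first exact: ca.
  by apply: continuous_ln; rewrite mulr_gt0.
Qed.

Lemma boundary_ln_right :
  boundary_values (fun t => ln (a + -1 * t)) 0 (- ln (2 * a)) 1 0.
Proof.
have k1 : (-1 : R) ^+ 2 = 1 by rewrite sqrrN expr1n.
have d t : - a < t -> t < a -> derive1 (fun t => ln (a + -1 * t)) t = - (a - t)^-1.
  move=> h1 h2; have [_ D] := is_derive_ln_affine k1 h1 h2.
  by rewrite derive1E (@derive_val _ _ _ _ _ _ _ D) !mulN1r.
have ca : a - t @[t --> - a] --> 2 * a.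
  have -> : 2 * a = a - - a by ring.
  by apply: cvgB; [exact: cvg_cst|exact: cvg_id].
have caV : (a - t)^-1 @[t --> (- a)^'+] --> (2 * a)^-1.
  apply: cvg_at_right_filter; apply: (@cvgV R R) => //.
  by rewrite mulf_neq0 ?gt_eqF.
split.
- apply: (@cvg_left_end _ (fun t => - (t + a) * (a - t)^-1)).
    by move=> t h1 h2; rewrite d//; ring.
  rewrite -[0](mul0r (2 * a)^-1); apply: (@cvgM R); last exact: caV.
  rewrite -[0](subrr a); have -> : a - a = - (- a + a) by ring.
  apply: cvgN; apply: cvg_at_right_filter.
  by apply: cvgD; [exact: cvg_id|exact: cvg_cst].
- apply: (@cvg_left_end _ (fun t => - ((t + a) * ln (a + t)) * (a - t)^-1 - ln (a - t))).
    by move=> t h1 h2; rewrite d// mulN1r; ring.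
  rewrite -[- ln _]add0r; apply: cvgB.
    rewrite -[0](mul0r (2 * a)^-1); apply: (@cvgM R); last exact: caV.
    by rewrite -[0]oppr0; apply: cvgN; exact: xlnx_left.
  apply: cvg_at_right_filter.
  apply: (@cvg_comp _ _ _ (fun t => a - t) (@ln R)); first exact: ca.
  by apply: continuous_ln; rewrite mulr_gt0.
- apply: (@cvg_right_end _ (cst 1)); last exact: cvg_cst.
  by move=> t h1 h2; rewrite d//=; field; rewrite gt_eqF//; lra.
- apply: (@cvg_right_end _ (cst 0)); last exact: cvg_cst.
  by move=> t h1 h2; rewrite d// mulN1r /=; field; rewrite gt_eqF//; lra.
Qed.

(* 1, t, ln (a + t) and ln (a - t) have linearly independent boundary values. *)
Lemma boundary_surjective bl cl br cr :
  exists x q y, rmax x q y /\ boundary_values x bl cl br cr.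
Proof.
have a0 : a != 0 by rewrite gt_eqF.
have k1 : (1 : R) ^+ 2 = 1 by rewrite expr1n.
have k2 : (-1 : R) ^+ 2 = 1 by rewrite sqrrN expr1n.
have [qi [yi mi]] := rmax_id.
pose l := ln (2 * a).
(* The logarithms enter with coefficients [bl] and [br], as 1 and [t] have zero [b] values; [al] and
   [be] then solve the two equations for [cl] and [cr]. The combination starts from [m0], the zero
   function. *)
pose al := - (cl + br * l + cr + bl * l) / 2; pose be := (cl + br * l - cr - bl * l) / (2 * a).
have m0 := rmax_lin (-1) rmax1 rmax1.
have b0 := boundary_lin (-1) rmax1 rmax1 boundary1 boundary1.
have m1 := rmax_lin al rmax1 m0; have b1 := boundary_lin al rmax1 m0 boundary1 b0.
have m2 := rmax_lin be mi m1; have b2 := boundary_lin be mi m1 boundary_id b1.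
have m3 := rmax_lin bl (rmax_ln k1) m2.
have b3 := boundary_lin bl (rmax_ln k1) m2 boundary_ln_left b2.
have m4 := rmax_lin br (rmax_ln k2) m3.
have b4 := boundary_lin br (rmax_ln k2) m3 boundary_ln_right b3.
do 3 eexists; split; first exact: m4.
move: b4; congr boundary_values; rewrite /al /be -/l; try by field.
Qed.
End RealMaximal.

(** * Weak solutions have classical representatives *)

Section Regularity.
Context {R : realType} (a : R) (a_gt0 : 0 < a).
Implicit Types (f g h x y z w q r N P : R -> R) (s t c d : R).
Notation mu := (@lebesgue_measure R).

Lemma prim_continuous F f t : prim a F f -> - a < t -> t < a -> {for t, continuous F}.
Proof.
move=> pF h1 h2; pose c := (t - a) / 2; pose d := (t + a) / 2.
have ac : - a < c by rewrite /c; lra.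
have da : d < a by rewrite /d; lra.
have cd : c <= d by rewrite /c /d; have := a_gt0; lra.
have cF := seq_abs_cont_clamp_continuous cd (primitive_seq_abs_cont (prim_on pF ac da)).
have ct : c < t by rewrite /c; lra.
have td : t < d by rewrite /d; lra.
have tcd : t \in `]c, d[ by rewrite in_itv/= ct td.
have E s : s \in `]c, d[ -> F s = (F \o clamp c d) s.
  by rewrite in_itv/= => /andP[/ltW h3 /ltW h4]; rewrite /= clamp_id// h3 h4.
rewrite /prop_for /continuous_at E//; apply: cvg_trans (cF t).
apply: near_eq_cvg; near=> s; apply/esym/E; near: s; exact: near_in_itvoo.
Unshelve. all: by end_near. Qed.

Lemma weight_continuous t : {for t, continuous (weight a)}.
Proof.
apply: (@cvgB _ R^o); first exact: cvg_cst.
by apply: (@cvgM R); [exact: exprn_continuous|exact: cvg_cst].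
Qed.

(** Here [h] may blow up at the ends, so the integral starts from the interior point 0, with
    reversed sign to its left. *)
Lemma antiderivative h : (forall t, - a < t -> t < a -> {for t, continuous h}) ->
  exists N, forall t, - a < t -> t < a -> is_derive t 1 N (h t).
Proof.
move=> ch.
pose N t := if 0 <= t then \int[mu]_(y in `]0, t]) h y else - \int[mu]_(y in `]t, 0]) h y.
exists N => t h1 h2.
(* Midpoints towards the ends: [c, d] is a compact part of (-a, a) with both 0 and [t] in its
   interior. *)
pose c := (Num.min t 0 - a) / 2; pose d := (Num.max t 0 + a) / 2.
have [ac c0 ct] : [/\ - a < c, c < 0 & c < t].
  by rewrite /c; have := a_gt0; have [t0|t0] := leP t 0; split; lra.
have [da d0 td] : [/\ d < a, 0 < d & t < d].
  by rewrite /d; have := a_gt0; have [t0|t0] := leP t 0; split; lra.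
have intc : mu.-integrable `[c, d] (EFin \o h).
  apply: continuous_compact_integrable; first exact: segment_compact.
  apply: continuous_in_subspaceT => y; rewrite inE/= in_itv/= => /andP[cy yd].
  by apply: ch; lra.
have intd : mu.-integrable `]c, d] (EFin \o h).
  by apply: integrableS intc => //; apply: subset_itv; rewrite bnd_simp.
have [_ E] := primitive_on_integral intd.
have NE (y : R) : c < y -> y < d -> N y = \int[mu]_(u in `]c, y]) h u - \int[mu]_(u in `]c, 0]) h u.
  move=> cy yd; rewrite /N; case: leP => y0; first by rewrite E ?(ltW c0) ?(ltW yd).
  by rewrite -E ?(ltW cy) ?(ltW y0) ?(ltW d0)// opprB.
have [|] := continuous_FTC1 td intd _ (ch t h1 h2); first by rewrite lte_fin.
set F := (X in derivable X _ _) => dF F'.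
have tcd : t \in `]c, d[ by rewrite in_itv/= ct td.
apply: (near_is_derive (f := fun y : R => F y - \int[mu]_(u in `]c, 0]) h u)).
  near=> y; have : y \in `]c, d[ by near: y; exact: near_in_itvoo.
  by rewrite in_itv/= => /andP[cy yd]; rewrite NE.
rewrite -[h t]subr0; apply: is_deriveB.
by apply: DeriveDef; [exact: dF|rewrite -F' derive1E].
Unshelve. all: by end_near. Qed.

Lemma sol_exists f : mu.-integrable (Iaa a) (EFin \o f) ->
  exists x, sol a x (fun t => \int[mu]_(y in `]- a, t]) f y) f.
Proof.
move=> intf; have pq := prim_integral intf.
have [|x dx] := @antiderivative (fun t => (\int[mu]_(y in `]- a, t]) f y) / weight a t).
  move=> t h1 h2; apply: (@cvgM R); first exact: (prim_continuous pq h1 h2).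
  apply: (@cvgV R R); first by rewrite gt_eqF// weight_gt0.
  exact: weight_continuous.
by exists x.
Qed.

Lemma sol_cst k : sol a (fun=> k) (fun=> 0) (fun=> 0).
Proof.
split; last by move=> t _ _; rewrite mul0r; exact: is_derive_cst.
split; first exact: integrable_cst_Iaa.
by move=> s t as' st ta; rewrite Rintegral_cst_itvoc// subrr mul0r.
Qed.

(** This is [a / 2 * ln ((a + t) / (a - t))] on the interval, normalised so that [weight] times its
    derivative is 1. The shape of the formula is the one that [sol_lin] produces. *)
Definition logit t := a / 2 * ln (a + 1 * t) + (- (a / 2) * ln (a + -1 * t) + 0).

Lemma sol_logit : sol a logit (fun=> 1) (fun=> 0).
Proof.
have a0 : a != 0 by rewrite gt_eqF.
have k1 : (1 : R) ^+ 2 = 1 by rewrite expr1n.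
have k2 : (-1 : R) ^+ 2 = 1 by rewrite sqrrN expr1n.
have := sol_lin (a / 2) (sol_ln a_gt0 k1) (sol_lin (- (a / 2)) (sol_ln a_gt0 k2) (sol_cst 0)).
by congr (sol _ _ _ _); apply/funext => t; field.
Qed.

Lemma sol_derivable x q f : sol a x q f -> measurable_fun (Iaa a) x.
Proof. by case=> _ dx; exact: derivable_measurable_Iaa dx. Qed.

Lemma sub_sym d : 0 < d -> d < a -> `](- d), d]%classic `<=` Iaa a.
Proof. by move=> d0 da; apply: sub_Iaa; lra. Qed.

Lemma Rintegral_sub (D E : set R) f : D `<=` E -> (forall t, E t -> ~ D t -> f t = 0) ->
  \int[mu]_(t in E) f t = \int[mu]_(t in D) f t.
Proof.
move=> DE f0; rewrite Rintegral_mkcond [RHS]Rintegral_mkcond.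
apply: eq_Rintegral => t _; rewrite !patchE.
case: ifPn; rewrite ?inE ?notin_setE => Et; case: ifPn; rewrite ?inE ?notin_setE => Dt //.
  exact: f0.
by case: Et; exact: DE.
Qed.

Lemma integrable_patch (D E : set R) f : measurable D -> measurable E -> D `<=` E ->
  mu.-integrable D (EFin \o f) -> mu.-integrable E (EFin \o (f \_ D)).
Proof.
move=> mD mE DE intf; rewrite -restrict_EFin; apply/(integrable_restrict mu _ _ _).1 => //.
by have -> : E `&` D = D by rewrite setIC; apply/setIidPl.
Qed.

Lemma integrable_bounded_mul (D : set R) (M : R) f g : measurable D -> measurable_fun D f ->
  (forall t, D t -> `|f t| <= M) -> mu.-integrable D (EFin \o g) ->
  mu.-integrable D (EFin \o (fun t => f t * g t)).
Proof.
move=> mD mf fM ig; have /integrableP[/measurable_EFinP mg _] := ig.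
have ig' : mu.-integrable D (EFin \o (fun t => `|g t|)) by exact: (@integrable_norm _ _ _ mu D g).
have i0 : mu.-integrable D (EFin \o (fun=> 0)) by exact: integrable0.
apply: (integrable_le mD _ (integrable_lin M mD ig' i0)); first exact: measurable_funM.
by move=> t Dt; rewrite addr0 normrM ler_wpM2r// fM.
Qed.

Lemma bounded_sol_on x q f d : 0 < d -> d < a -> sol a x q f ->
  exists M : R, forall t, `](- d), d]%classic t -> `|x t| <= M.
Proof.
move=> d0 da sx; have dd : - d <= d by lra.
have ad : - a < - d by lra.
have [M _ xM] := seq_abs_cont_bounded dd (primitive_seq_abs_cont (sol_primitive a_gt0 sx ad dd da)).
by exists M => t /=; rewrite in_itv/= => /andP[/ltW]; exact: xM.
Qed.

Lemma integrable_sol_sym x q f d : 0 < d -> d < a -> sol a x q f ->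
  mu.-integrable `](- d), d] (EFin \o x).
Proof.
move=> d0 da sx; have [M xM] := bounded_sol_on d0 da sx.
have mx : measurable_fun `](- d), d] x.
  apply: measurable_funS (sol_derivable sx); [exact: measurable_Iaa|exact: sub_sym].
have := integrable_bounded_mul (measurable_itv _) mx xM (integrable_cst_itvoc 1 (- d) d).
by apply: eq_integrable => // t _ /=; rewrite mulr1.
Qed.

(** The integral [q] of the extended [f] vanishes beyond [d] because [f] has mean zero. Green's
    identity against [logit], whose own [q] is 1, turns the second moment condition into equality of
    the values of a solution at [-d] and [d]; subtracting that value makes it vanish outside. *)
Lemma test_function d (M : R) f : 0 < d -> d < a -> measurable_fun `](- d), d] f ->
  (forall t, `](- d), d]%classic t -> `|f t| <= M) ->
  \int[mu]_(t in `](- d), d]) f t = 0 ->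
  \int[mu]_(t in `](- d), d]) (f t * logit t) = 0 ->
  exists x q, sol a x q (f \_ `](- d), d]) /\
    forall t, - a < t -> t < a -> t <= - d \/ d <= t -> x t = 0 /\ q t = 0.
Proof.
move=> d0 da mf fM f0 f1; set D := `](- d), d]%classic.
have mD : measurable D by exact: measurable_itv.
have DI : D `<=` Iaa a by exact: sub_sym.
have intf : mu.-integrable D (EFin \o f).
  have := integrable_bounded_mul mD mf fM (integrable_cst_itvoc 1 (- d) d).
  by apply: eq_integrable => // t _ /=; rewrite mulr1.
pose F := f \_ D.
have intF : mu.-integrable (Iaa a) (EFin \o F).
  exact: (integrable_patch mD (measurable_Iaa a) DI).
have [N sN] := sol_exists intF.
set q := (fun t => _) in sN.
have FD t : D t -> F t = f t by move=> Dt; rewrite /F patchE mem_set.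
have FN t : ~ D t -> F t = 0 by move=> Dt; rewrite /F patchE memNset.
have q0 t : - a < t -> t < a -> t <= - d \/ d <= t -> q t = 0.
  move=> h1 h2 [td|dt]; rewrite /q.
    rewrite (_ : \int[mu]_(y in `]- a, t]) F y = \int[mu]_(y in `]- a, t]) 0).
      by rewrite Rintegral_cst// mul0r.
    apply: eq_Rintegral => y; rewrite inE/= in_itv/= => /andP[_ yt].
    by apply: FN; rewrite /D/= in_itv/= => /andP[]; lra.
  rewrite (@Rintegral_sub D).
  - by rewrite -[RHS]f0; apply: eq_Rintegral => y; rewrite inE; exact: FD.
  - by apply: subset_itv; rewrite bnd_simp; lra.
  - by move=> y _; exact: FN.
have K s t : - a < s -> s <= t -> t < a -> q s = 0 -> q t = 0 ->
    N s - N t = \int[mu]_(y in `]s, t]) (F y * logit y).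
  move=> as' st ta qs qt; have := sol_green a_gt0 sN sol_logit as' st ta.
  rewrite qs qt !mul0r !mulr1 !sub0r opprK addrC => ->.
  by apply: eq_Rintegral => y _; rewrite mulr0 subr0.
have ad : - a < - d by lra.
exists (fun t => - N (- d) * 1 + N t), q; split.
  have := sol_lin (- N (- d)) (sol_cst 1) sN.
  by congr (sol _ _ _ _); apply/funext => t; rewrite mulr0 add0r.
move=> t h1 h2 tD; split; last exact: q0.
have qd0 : q (- d) = 0 by apply: q0; [lra|lra|left].
rewrite mulr1; have [td|dt] := tD.
  have := K t (- d) h1 td _ (q0 t h1 h2 tD) qd0.
  have -> : \int[mu]_(y in `]t, - d]) (F y * logit y) = \int[mu]_(y in `]t, - d]) 0.
    apply: eq_Rintegral => y; rewrite inE/= in_itv/= => /andP[_ yt].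
    by rewrite FN ?mul0r// /D/= in_itv/= => /andP[]; lra.
  rewrite Rintegral_cst// mul0r => H; have := H ltac:(lra); lra.
have dt' : - d <= t by lra.
have := K (- d) t ad dt' h2 qd0 (q0 t h1 h2 tD).
rewrite (@Rintegral_sub D).
- rewrite (_ : \int[mu]_(y in D) (F y * logit y) = \int[mu]_(y in D) (f y * logit y)).
    by rewrite f1; lra.
  by apply: eq_Rintegral => y; rewrite inE => Dy; rewrite FD.
- by apply: subset_itv; rewrite bnd_simp; lra.
- by move=> y _ Dy; rewrite FN// mul0r.
Qed.

Definition supported_in x : Prop :=
  exists d, [/\ 0 < d, d < a & forall t, - a < t -> t < a -> t <= - d \/ d <= t -> x t = 0].

Lemma supported_rL2 x q f d : 0 < d -> d < a -> sol a x q f ->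
  (forall t, - a < t -> t < a -> t <= - d \/ d <= t -> x t = 0) -> rL2 a x.
Proof.
move=> d0 da sx x0; have [M xM] := bounded_sol_on d0 da sx.
apply: (@rL2_bounded _ _ _ `|M|); first exact: sol_derivable sx.
move=> t; rewrite /Iaa /= in_itv/= => /andP[h1 h2].
have [td|td] := leP t (- d); first by rewrite x0 ?normr0//; left.
have [dt|dt] := leP d t; first by rewrite x0 ?normr0//; right.
by apply: le_trans (ler_norm M); apply: xM; rewrite /= in_itv/= td ltW.
Qed.

Lemma rL2_patch d (M : R) f : 0 < d -> d < a -> measurable_fun `](- d), d] f ->
  (forall t, `](- d), d]%classic t -> `|f t| <= M) -> rL2 a (f \_ `](- d), d]).
Proof.
move=> d0 da mf fM; apply: (@rL2_bounded _ _ _ `|M|).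
  by apply: measurable_funTS; apply/(measurable_restrictT _ _).1.
move=> t _; rewrite patchE; case: ifPn; rewrite ?inE => Dt; last by rewrite normr0.
by apply: le_trans (ler_norm M); exact: fM.
Qed.

(** [K] is an even primitive of [logit], which gives the opposite signs; positivity comes from the
    mean value theorem and the monotonicity of the logarithm. *)
Lemma logit_integral : exists2 kappa : R, 0 < kappa &
  \int[mu]_(t in `]0, (a / 2)]) logit t = kappa /\
  \int[mu]_(t in `](- (a / 2)), 0]) logit t = - kappa.
Proof.
have a2 : 0 < a / 2 by rewrite divr_gt0.
have a2a : a / 2 < a by rewrite ltr_pdivrMr// ltr_pMr// ltr1n.
have k1 : (1 : R) ^+ 2 = 1 by rewrite expr1n.
have k2 : (-1 : R) ^+ 2 = 1 by rewrite sqrrN expr1n.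
pose K t := a / 2 * ((a + 1 * t) * ln (a + 1 * t)) + a / 2 * ((a + -1 * t) * ln (a + -1 * t)).
have dK t : - a < t -> t < a -> is_derive t 1 K (logit t).
  move=> h1' h2'; have [p1 d1] := is_derive_ln_affine k1 h1' h2'.
  have [p2 d2] := is_derive_ln_affine k2 h1' h2'.
  have D1 := is_derive_mul_fun (is_derive_affine a 1 t) d1.
  have D2 := is_derive_mul_fun (is_derive_affine a (-1) t) d2.
  have D3 := is_derive_lin_fun (a / 2) D1 (is_derive_lin_fun (a / 2) D2 (is_derive_cst (0 : R) t 1)).
  have -> : K = (fun y : R => a / 2 * ((a + 1 * y) * ln (a + 1 * y)) +
      (a / 2 * ((a + -1 * y) * ln (a + -1 * y)) + cst 0 y)).
    by apply/funext => y; rewrite /K /= addr0.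
  apply: (is_derive_eq D3); rewrite /logit; field.
  by rewrite !gt_eqF//; lra.
have Kp : primitive_on (- (a / 2)) (a / 2) K logit.
  have h1' : - a < - (a / 2) by lra.
  have h2' : - (a / 2) <= a / 2 by lra.
  have [M _ HM] := seq_abs_cont_bounded h2'
    (primitive_seq_abs_cont (sol_primitive a_gt0 sol_logit h1' h2' a2a)).
  apply: (@bounded_derive_primitive _ _ _ _ _ M h2'); [|exact: HM|].
    by move=> t u1 u2; apply: dK; lra.
  apply: measurable_funS (sol_derivable sol_logit); first exact: measurable_Iaa.
  exact: sub_sym.
have KN : K (- (a / 2)) = K (a / 2) by rewrite /K !mul1r !mulN1r opprK addrC.
exists (K (a / 2) - K 0).
  have [||c] := @MVT R K logit 0 (a / 2) a2.
  - by move=> t; rewrite in_itv/= => /andP[u1 u2]; apply: dK; lra.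
  - apply: derivable_within_continuous => t; rewrite in_itv/= => /andP[u1 u2].
    by have [] := dK t ltac:(lra) ltac:(lra).
  rewrite in_itv/= => /andP[c0 ca] ->; rewrite subr0 mulr_gt0//.
  have -> : logit c = a / 2 * (ln (a + c) - ln (a - c)) by rewrite /logit mul1r mulN1r; ring.
  by rewrite mulr_gt0// subr_gt0 ltr_ln ?posrE; lra.
have [_ E] := Kp; split; first by rewrite E//; lra.
by rewrite -E ?KN ?opprB//; lra.
Qed.

Lemma Rintegral_indic_mul (A D : set R) F : A `<=` D ->
  \int[mu]_(t in D) (\1_A t * F t) = \int[mu]_(t in A) F t.
Proof.
move=> AD; rewrite (@Rintegral_sub A)//.
  by apply: eq_Rintegral => t tA; rewrite indicE tA mul1r.
by move=> t _ At; rewrite indicE memNset// mul0r.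
Qed.

Let K0 : set R := `](- (a / 2)), (a / 2)]%classic.
Let Kp : set R := `]0, (a / 2)]%classic.
Let Kn : set R := `](- (a / 2)), 0]%classic.

Lemma dual_tests : exists e0 e1 : R -> R, [/\
  measurable_fun setT e0 /\ measurable_fun setT e1,
  exists M : R, forall t, `|e0 t| <= M /\ `|e1 t| <= M,
  forall t, ~ K0 t -> e0 t = 0 /\ e1 t = 0 &
  forall d, a / 2 <= d -> d < a ->
  [/\ \int[mu]_(t in `](- d), d]) e0 t = 1, \int[mu]_(t in `](- d), d]) (e0 t * logit t) = 0,
      \int[mu]_(t in `](- d), d]) e1 t = 0 & \int[mu]_(t in `](- d), d]) (e1 t * logit t) = 1]].
Proof.
have a2 : 0 < a / 2 by rewrite divr_gt0.
have a2a : a / 2 < a by rewrite ltr_pdivrMr// ltr_pMr// ltr1n.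
have a0 : a != 0 by rewrite gt_eqF.
have [kappa kappa0 [EP EN]] := logit_integral.
have kap0 : kappa != 0 by rewrite gt_eqF.
pose e (al be : R) t := al * \1_Kp t + be * \1_Kn t.
have me al be : measurable_fun setT (e al be).
  by apply: measurable_funD; apply: measurable_funM => //; apply: measurable_indic; exact: measurable_itv.
have eM al be t : `|e al be t| <= `|al| + `|be|.
  apply: (le_trans (ler_normD _ _)); rewrite !normrM.
  have i1 (A : set R) : `|\1_A t| <= 1 :> R by rewrite indicE; case: (_ \in _); rewrite ?normr1 ?normr0.
  by apply: lerD; rewrite -[leRHS]mulr1 ler_wpM2l.
have e0 al be t : ~ K0 t -> e al be t = 0.
  rewrite /K0 /= in_itv/= => /negP; rewrite negb_and -leNgt -ltNge => H.
  rewrite /e !indicE !memNset ?mulr0 ?addr0// /Kp /Kn /= in_itv/= => /andP[u1 u2];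
    by case/orP: H => ?; lra.
have eI d al be F : a / 2 <= d -> d < a -> mu.-integrable `](- d), d] (EFin \o F) ->
   \int[mu]_(t in `](- d), d]) (e al be t * F t) =
   al * (\int[mu]_(t in Kp) F t) + be * \int[mu]_(t in Kn) F t.
  move=> d1 d2 iF; set D := `](- d), d]%classic.
  have pD : Kp `<=` D by apply: subset_itv; rewrite bnd_simp; lra.
  have nD : Kn `<=` D by apply: subset_itv; rewrite bnd_simp; lra.
  have mD : measurable D by exact: measurable_itv.
  have i1 (A : set R) : measurable A -> mu.-integrable D (EFin \o (fun t => \1_A t * F t)).
    move=> mA; apply: (@integrable_bounded_mul _ 1) => //.
    by move=> t _; rewrite indicE; case: (_ \in _); rewrite ?normr1 ?normr0.
  have i0 : mu.-integrable D (EFin \o (fun=> 0)) by exact: integrable0.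
  have ip := i1 Kp (measurable_itv _); have in_ := i1 Kn (measurable_itv _).
  have z : \int[mu]_(t in D) (0 : R) = 0 by rewrite Rintegral_cst// mul0r.
  transitivity (al * (\int[mu]_(t in D) (\1_Kp t * F t)) +
     (be * (\int[mu]_(t in D) (\1_Kn t * F t)) + \int[mu]_(t in D) (0 : R))).
    rewrite -(Rintegral_lin _ mD in_ i0) -(Rintegral_lin _ mD ip (integrable_lin _ mD in_ i0)).
    by apply: eq_Rintegral => t _; rewrite /e; ring.
  by rewrite z addr0 !Rintegral_indic_mul.
have one F (D : set R) : \int[mu]_(t in D) F t = \int[mu]_(t in D) (F t * 1).
  by apply: eq_Rintegral => t _; rewrite mulr1.
have Ep : \int[mu]_(t in Kp) (1 : R) = a / 2 by rewrite Rintegral_cst_itvoc ?ltW// subr0 mul1r.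
have En : \int[mu]_(t in Kn) (1 : R) = a / 2.
  by rewrite Rintegral_cst_itvoc ?sub0r ?opprK ?mul1r//; lra.
exists (e a^-1 a^-1), (e (2 * kappa)^-1 (- (2 * kappa)^-1)); split.
- by split; exact: me.
- exists (`|a^-1| + `|a^-1| + (`|(2 * kappa)^-1| + `|- (2 * kappa)^-1|)) => t; split.
    by apply: le_trans (eM _ _ t) _; rewrite lerDl.
  by apply: le_trans (eM _ _ t) _; rewrite lerDr.
- by move=> t K; split; exact: e0.
- move=> d d1 d2; have d0 : 0 < d by exact: lt_le_trans d1.
  have I1 := integrable_cst_itvoc 1 (- d) d; have Il := integrable_sol_sym d0 d2 sol_logit.
  split.
  + by rewrite one eI// Ep En; field.
  + by rewrite eI// EP EN; field.
  + by rewrite one eI// Ep En; field.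
  + by rewrite eI// EP EN; field.
Qed.

Section Weak.
Context (h k : R -> R) (h2 : rL2 a h) (k2 : rL2 a k)
  (weak : forall x q y : R -> R, rmax a x q y -> supported_in x ->
    \int[mu]_(t in Iaa a) (y t * h t) = \int[mu]_(t in Iaa a) (x t * k t)).

Lemma rL2_on d f : 0 < d -> d < a -> rL2 a f -> mu.-integrable `](- d), d] (EFin \o f).
Proof.
move=> d0 da f2; apply: integrableS (rL2_integrable f2) => //.
  exact: measurable_Iaa.
exact: sub_sym.
Qed.

(** [N] solves classically the equation that [h] solves weakly. With the compactly supported [x]
    built from [f], the weak identity computes the integral of [f h], Green's identity computes that
    of [f N], and the two values agree. *)
Lemma weak_test N r d (M : R) f : sol a N r (fun t => t ^+ 2 * h t - k t) ->
  0 < d -> d < a -> measurable_fun `](- d), d] f ->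
  (forall t, `](- d), d]%classic t -> `|f t| <= M) ->
  \int[mu]_(t in `](- d), d]) f t = 0 ->
  \int[mu]_(t in `](- d), d]) (f t * logit t) = 0 ->
  \int[mu]_(t in `](- d), d]) (f t * (h t - N t)) = 0.
Proof.
move=> sN d0 da mf fM f0 f1; set D := `](- d), d]%classic.
have mD : measurable D by exact: measurable_itv.
have DI : D `<=` Iaa a by exact: sub_sym.
have dd : - d <= d by lra.
have ad : - a < - d by lra.
have [x [q [sx x0]]] := test_function d0 da mf fM f0 f1.
have F2 := rL2_patch d0 da mf fM.
have x2 : rL2 a x by apply: (supported_rL2 d0 da sx) => t u v w; exact: (x0 t u v w).1.
have mx := sol_rmax a_gt0 x2 F2 sx.
have E := weak mx _.
have {E} : \int[mu]_(t in Iaa a) ((t ^+ 2 * x t - (f \_ D) t) * h t) =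
  \int[mu]_(t in Iaa a) (x t * k t).
  by apply: E; exists d; split => // t u v w; exact: (x0 t u v w).1.
have i1 := rL2_mul (rL2_sqr a_gt0 x2) h2.
have i2 := rL2_mul F2 h2.
have i3 := rL2_mul x2 k2.
have i4 := rL2_mul x2 (rL2_lin (-1) k2 (rL2_sqr a_gt0 h2)).
move=> E.
have E1 : \int[mu]_(t in Iaa a) ((f \_ D) t * h t) =
    \int[mu]_(t in Iaa a) (x t * (-1 * k t + t ^+ 2 * h t)).
  have -> : \int[mu]_(t in Iaa a) (x t * (-1 * k t + t ^+ 2 * h t)) =
    \int[mu]_(t in Iaa a) (t ^+ 2 * x t * h t) - \int[mu]_(t in Iaa a) (x t * k t).
    rewrite -RintegralB//; last exact: measurable_Iaa.
    by apply: eq_Rintegral => t _; ring.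
  rewrite -E -RintegralB//.
  - by apply: eq_Rintegral => t _; ring.
  - exact: measurable_Iaa.
  - have := integrable_lin (-1) (measurable_Iaa a) i2 i1.
    by apply: eq_integrable; [exact: measurable_Iaa|move=> t _ /=; congr EFin; ring].
have [xd qd] : x (- d) = 0 /\ q (- d) = 0 by apply: x0; [lra|lra|left].
have [xd' qd'] : x d = 0 /\ q d = 0 by apply: x0; [lra|lra|right].
have G := sol_green a_gt0 sx sN ad dd da.
rewrite xd qd xd' qd' !mul0r !subr0 in G.
have sD g : mu.-integrable (Iaa a) (EFin \o g) -> mu.-integrable D (EFin \o g).
  by apply: integrableS => //; exact: measurable_Iaa.
have iN := integrable_sol_sym d0 da sN; have ih := rL2_on d0 da h2.
have ifh := integrable_bounded_mul mD mf fM ih.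
have ifN := integrable_bounded_mul mD mf fM iN.
have FE g : \int[mu]_(t in D) ((f \_ D) t * g t) = \int[mu]_(t in D) (f t * g t).
  by apply: eq_Rintegral => t tD; rewrite patchE tD.
rewrite RintegralB// in G; last 2 first.
- by apply: eq_integrable ifN => // t tD; rewrite /= patchE tD.
- by apply: sD; move: i4; apply: eq_integrable; [exact: measurable_Iaa|move=> t _ /=; congr EFin; ring].
rewrite FE in G.
have xI t : Iaa a t -> ~ D t -> x t = 0.
  rewrite /Iaa /D /= !in_itv/= => /andP[u1 u2] /negP; rewrite negb_and -leNgt -ltNge.
  by move=> /orP[u3|/ltW u3]; apply x0 => //; [left|right].
rewrite (@Rintegral_sub D) ?FE// in E1; last first.
  by move=> t It Dt; rewrite patchE memNset// mul0r.
have xE : \int[mu]_(t in Iaa a) (x t * (-1 * k t + t ^+ 2 * h t)) =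
    \int[mu]_(t in D) (x t * (-1 * k t + t ^+ 2 * h t)).
  by apply: Rintegral_sub => // t It Dt; rewrite xI// mul0r.
rewrite xE in E1.
transitivity (\int[mu]_(t in D) (f t * h t) - \int[mu]_(t in D) (f t * N t)).
  by rewrite -RintegralB//; apply: eq_Rintegral => t _; ring.
rewrite E1; move: G.
have -> : \int[mu]_(t in D) (x t * (t ^+ 2 * h t - k t)) =
   \int[mu]_(t in D) (x t * (-1 * k t + t ^+ 2 * h t)).
  by apply: eq_Rintegral => t _; ring.
by lra.
Qed.

(** An argument in the manner of du Bois-Reymond: the sign of the defect [u], corrected by [e0] and
    [e1] so that both moments vanish, is an admissible test, and it forces the integral of [|u|] to
    be 0. *)
Lemma weak_affine N r : sol a N r (fun t => t ^+ 2 * h t - k t) ->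
  exists al be, {ae mu, forall t, Iaa a t -> h t = N t + (al + be * logit t)}.
Proof.
move=> sN; have [e0 [e1 [[me0' me1'] [M0 eM] eK dualE]]] := dual_tests.
(* Biorthogonality dictates these coefficients. They are integrals over the fixed set [K0], hence
   the same for all [d]. *)
pose al := \int[mu]_(t in K0) (e0 t * (h t - N t)).
pose be := \int[mu]_(t in K0) (e1 t * (h t - N t)).
exists al, be.
pose u t := h t - N t - (al + be * logit t).
have a2 : 0 < a / 2 by rewrite divr_gt0.
suff H d : a / 2 <= d -> d < a -> {ae mu, forall t, `](- d), d]%classic t -> u t = 0}.
  pose d n := a - (a / 2) / n.+1%:R.
  have d1 n : a / 2 <= d n.
    rewrite /d lerBrDr -lerBrDl (_ : a - a / 2 = a / 2); last by field.
    by rewrite ler_pdivrMr// ler_peMr ?ler1n// ltW.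
  have d2 n : d n < a by rewrite /d ltrBlDr ltrDl divr_gt0.
  have : {ae mu, forall t, forall n, `](- d n), (d n)]%classic t -> u t = 0}.
    by apply/ae_foralln => n; exact: H.
  apply: aeS => t ut It.
  have [n tn] : exists n, `](- d n), (d n)]%classic t.
    move: It; rewrite /Iaa /= in_itv/= => /andP[h1' h2'].
    have m0 : 0 < a - `|t| by rewrite subr_gt0 ltr_norml h1'.
    exists (Num.truncn (a / 2 / (a - `|t|))); rewrite /= in_itv/=.
    have et : a / 2 / (Num.truncn (a / 2 / (a - `|t|))).+1%:R < a - `|t|.
      by rewrite ltr_pdivrMr// [X in _ < X]mulrC -ltr_pdivrMr// truncnS_gt.
    have := ler_norm t; have := ler_norm (- t); rewrite normrN /d.
    move: et; set e := a / 2 / _ => et ? ?.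
    by apply/andP; split; lra.
  have := ut n tn; rewrite /u; lra.
move=> d1 d2; set D := `](- d), d]%classic.
have d0 : 0 < d by exact: lt_le_trans d1.
have mD : measurable D by exact: measurable_itv.
have DI : D `<=` Iaa a by exact: sub_sym.
have [E00 E01 E10 E11] := dualE d d1 d2.
have K0D : K0 `<=` D by apply: subset_itv; rewrite bnd_simp; lra.
have iN := integrable_sol_sym d0 d2 sN; have ih := rL2_on d0 d2 h2.
have iP := integrable_sol_sym d0 d2 sol_logit.
have i1 := integrable_cst_itvoc 1 (- d) d.
have ihN : mu.-integrable D (EFin \o (fun t => h t - N t)).
  by move: (integrable_lin (-1) mD iN ih); apply: eq_integrable => // t _ /=; congr EFin; ring.
have iu : mu.-integrable D (EFin \o u).
  move: (integrable_lin (- be) mD iP (integrable_lin (- al) mD i1 ihN)).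
  by apply: eq_integrable => // t _ /=; congr EFin; rewrite /u; ring.
have mu_ : measurable_fun D u by case/integrableP : iu => /measurable_EFinP.
(* A sign of [u]; the value -1 at zeros of [u] does not affect [f * u = |u|]. *)
pose f t : R := if 0 < u t then 1 else -1.
have mf : measurable_fun D f.
  apply: measurable_fun_if => //.
  by apply: measurable_fun_ltr => //.
have fM t : D t -> `|f t| <= 1 by move=> _; rewrite /f; case: ifP => _; rewrite ?normrN normr1.
have me0 : measurable_fun D e0 by exact: measurable_funTS.
have me1 : measurable_fun D e1 by exact: measurable_funTS.
have e0M t : D t -> `|e0 t| <= M0 by move=> _; case: (eM t).
have e1M t : D t -> `|e1 t| <= M0 by move=> _; case: (eM t).
pose A := \int[mu]_(t in D) f t; pose B := \int[mu]_(t in D) (f t * logit t).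
pose g t := f t - A * e0 t - B * e1 t.
have ifx F : mu.-integrable D (EFin \o F) -> mu.-integrable D (EFin \o (fun t => f t * F t)).
  exact: (integrable_bounded_mul mD mf fM).
have i0x F : mu.-integrable D (EFin \o F) -> mu.-integrable D (EFin \o (fun t => e0 t * F t)).
  exact: (integrable_bounded_mul mD me0 e0M).
have i1x F : mu.-integrable D (EFin \o F) -> mu.-integrable D (EFin \o (fun t => e1 t * F t)).
  exact: (integrable_bounded_mul mD me1 e1M).
have gI F : mu.-integrable D (EFin \o F) -> \int[mu]_(t in D) (g t * F t) =
   \int[mu]_(t in D) (f t * F t) - A * (\int[mu]_(t in D) (e0 t * F t))
     - B * \int[mu]_(t in D) (e1 t * F t).
  move=> iF; have H1 := Rintegral_lin (- A) mD (i0x _ iF) (ifx _ iF).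
  have I1 := integrable_lin (- A) mD (i0x _ iF) (ifx _ iF).
  have H2 := Rintegral_lin (- B) mD (i1x _ iF) I1.
  transitivity (- B * (\int[mu]_(t in D) (e1 t * F t)) +
    (- A * (\int[mu]_(t in D) (e0 t * F t)) + \int[mu]_(t in D) (f t * F t))); last by ring.
  by rewrite -H1 -H2; apply: eq_Rintegral => t _; rewrite /g; ring.
have one F : \int[mu]_(t in D) F t = \int[mu]_(t in D) (F t * 1).
  by apply: eq_Rintegral => t _; rewrite mulr1.
have W : \int[mu]_(t in D) (g t * (h t - N t)) = 0.
  apply: (@weak_test N r d (1 + `|A| * M0 + `|B| * M0)) => //.
  - apply: measurable_funB; [apply: measurable_funB => //|]; exact: measurable_funM.
  - move=> t Dt; rewrite /g.
    apply: (le_trans (ler_normB _ _)); apply: lerD.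
      apply: (le_trans (ler_normB _ _)); apply: lerD; first exact: fM.
      by rewrite normrM ler_wpM2l// e0M.
    by rewrite normrM ler_wpM2l// e1M.
  - by rewrite one gI// -!one E00 E10 -/A; ring.
  - by rewrite gI// E01 E11 -/B; ring.
rewrite gI// in W.
have Ea : \int[mu]_(t in D) (e0 t * (h t - N t)) = al.
  by rewrite (@Rintegral_sub K0)// => t _ /eK[-> _]; rewrite mul0r.
have Eb : \int[mu]_(t in D) (e1 t * (h t - N t)) = be.
  by rewrite (@Rintegral_sub K0)// => t _ /eK[_ ->]; rewrite mul0r.
rewrite Ea Eb in W.
(* The correction of [f] costs [A * al + B * be] against [h - N], which is exactly the integral of
   [f] against the affine part subtracted in [u]. *)
have U0 : \int[mu]_(t in D) (f t * u t) = 0.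
  have H1 := Rintegral_lin (- al) mD (ifx _ i1) (ifx _ ihN).
  have I1 := integrable_lin (- al) mD (ifx _ i1) (ifx _ ihN).
  have H2 := Rintegral_lin (- be) mD (ifx _ iP) I1.
  transitivity (- be * B + (- al * A + \int[mu]_(t in D) (f t * (h t - N t)))).
    have -> : A = \int[mu]_(t in D) (f t * 1) by exact: one.
    rewrite -H1 -H2; apply: eq_Rintegral => t _; rewrite /u; ring.
  by rewrite -W; ring.
have : (\int[mu]_(t in D) `|(EFin \o u) t|)%E = 0%E.
  have iau : mu.-integrable D (EFin \o (fun t => `|u t|)) by exact: (@integrable_norm _ _ _ mu D u).
  have fin : (\int[mu]_(t in D) `|(EFin \o u) t|)%E \is a fin_num.
    by apply: integrable_fin_num iau; exact: mD.
  rewrite -[LHS]fineK//; congr EFin; rewrite -[RHS]U0.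
  by apply: eq_Rintegral => t _; rewrite /f /=; case: ltP => ut; rewrite ?mul1r ?mulN1r; [rewrite gtr0_norm|rewrite ler0_norm].
move=> U1; have mEu : measurable_fun D (EFin \o u) by exact/measurable_EFinP.
have := (ae_eq_integral_abs mu mD mEu).1 U1.
by apply: aeS => t /= H Dt; have := H Dt => -[].
Qed.

Lemma prim_ae F f g : prim a F f -> measurable_fun (Iaa a) g ->
  {ae mu, forall t, Iaa a t -> g t = f t} -> prim a F g.
Proof.
move=> [intf E] mg gf; split; first exact: (integrable_ae (measurable_Iaa a) intf mg gf).
move=> s t as' st ta; rewrite E//.
have sub : `]s, t]%classic `<=` Iaa a by apply: sub_Iaa => //; exact: ltW.
have /integrableP[/measurable_EFinP mf _] := intf.
apply: ae_eq_Rintegral => //.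
- by apply: measurable_funS mf => //; exact: measurable_Iaa.
- by apply: measurable_funS mg => //; exact: measurable_Iaa.
- by apply: aeS gf => y gf yst; rewrite gf//; exact: sub.
Qed.

(** The representative is [N + al + be * logit]. It solves the equation with [h] on the right-hand
    side, where [prim_ae] then replaces [h] by the representative itself. *)
Lemma weak_rmax : exists x q, rmax a x q k /\ {ae mu, forall t, Iaa a t -> h t = x t}.
Proof.
have m2 : rL2 a (fun t => t ^+ 2 * h t - k t).
  have := rL2_lin (-1) k2 (rL2_sqr a_gt0 h2); apply: rL2_eq => t _; ring.
have [N sN] := sol_exists (rL2_integrable m2).
have [al [be hN]] := weak_affine sN.
have sx := sol_lin be sol_logit (sol_lin al (sol_cst 1) sN).
set x := (X in sol a X _ _) in sx; set q := (X in sol a _ X _) in sx.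
have hx : {ae mu, forall t, Iaa a t -> h t = x t}.
  by apply: aeS hN => t hN It; rewrite hN// /x; ring.
exists x, q; split; last exact: hx.
have x2 : rL2 a x.
  apply: (rL2_ae (sol_derivable sx)) h2.
  by apply: aeS hx => t hx It; rewrite hx.
have [pq dx] := sx; split; [exact: x2|exact: k2|split; last exact: dx].
apply: prim_ae pq _ _.
  have [mx _] := rL2_sqr a_gt0 x2; have [mk _] := k2.
  exact: measurable_funB.
by apply: aeS hx => t hx It; rewrite hx//; ring.
Qed.
End Weak.
End Regularity.

(** * Density of compactly supported elements *)

Section Density.
Context {R : realType} (a : R) (a_gt0 : 0 < a).
Implicit Types (f g h F G : R -> R) (s t c d : R).
Notation mu := (@lebesgue_measure R).

Lemma L2_dominated_cvg f (g : nat -> R -> R) h :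
  (forall n, measurable_fun (Iaa a) (g n)) -> measurable_fun (Iaa a) f ->
  mu.-integrable (Iaa a) (EFin \o h) ->
  (forall n t, Iaa a t -> (f t - g n t) ^+ 2 <= h t) ->
  {ae mu, forall t, Iaa a t -> g n t @[n --> \oo] --> f t} ->
  forall e : R, 0 < e -> exists n, \int[mu]_(t in Iaa a) (f t - g n t) ^+ 2 < e.
Proof.
move=> mg mf ih fgh gf e e0.
have mI := measurable_Iaa a.
have mu2 n : measurable_fun (Iaa a) (fun t => (f t - g n t) ^+ 2).
  by apply: measurable_funX; exact: measurable_funB.
pose u n t : \bar R := ((f t - g n t) ^+ 2)%:E.
have mu_ n : measurable_fun (Iaa a) (u n) by exact/measurable_EFinP.
have m0 : measurable_fun (Iaa a) (cst 0%E : R -> \bar R) by exact: measurable_cst.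
have cu : {ae mu, forall t, Iaa a t -> u ^~ t @ \oo --> cst 0%E t}.
  apply: aeS gf => t gf It; apply: cvg_EFin; first by near=> n.
  rewrite -[X in _ --> X](expr0n R 2) -[X in X ^+ 2](subrr (f t)) /=.
  have c0 : f t - g n t @[n --> \oo] --> f t - f t.
    by apply: cvgB; [exact: cvg_cst|exact: gf].
  exact: (continuous_cvg _ (@exprn_continuous R 2 _) c0).
have iu n : mu.-integrable (Iaa a) (u n).
  by apply: (integrable_le mI (mu2 n) ih) => t It; rewrite ger0_norm ?sqr_ge0// fgh.
have uh : {ae mu, forall t n, Iaa a t -> (`|u n t| <= (EFin \o h) t)%E}.
  by apply: aeW => t n It; rewrite /u abse_EFin ger0_norm ?sqr_ge0// lee_fin fgh.
have [|||_ _ H] := @dominated_convergence _ _ R mu (Iaa a) mI u (cst 0%E) (EFin \o h) mu_ m0.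
- exact: cu.
- exact: ih.
- exact: uh.
have {}H : (\int[mu]_(t in Iaa a) u n t)%E @[n --> \oo] --> 0%:E.
  have E : (\int[mu]_(t in Iaa a) cst 0%E t)%E = 0%:E by exact: integral0.
  by rewrite -E.
have {}H : \int[mu]_(t in Iaa a) (f t - g n t) ^+ 2 @[n --> \oo] --> (0 : R) by exact: fine_cvg H.
have /cvgrPdist_lt K0 := H.
have [n _ /(_ n (leqnn n))] := K0 e e0.
rewrite sub0r normrN => K; exists n; exact: le_lt_trans (ler_norm _) K.
Unshelve. all: by end_near. Qed.

Lemma derive_lipschitz F t (l K : R) : is_derive t 1 F l ->
  (\forall s \near t, `|F s - F t| <= K * `|s - t|) -> `|l| <= K.
Proof.
move=> [dF <-] FK; rewrite leNgt; apply/negP => Kl.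
pose e := (`|'D_1 F t| - K) / 2.
have e0 : 0 < e by rewrite divr_gt0 ?subr_gt0.
have /cvgrPdist_lt /(_ e e0) H := dF.
have FK' : \forall k \near (0 : R), `|F (k + t) - F t| <= K * `|k + t - t|.
  have ck : k + t @[k --> (0 : R)] --> t.
    by rewrite -[X in _ --> X]add0r; apply: cvgD; [exact: cvg_id|exact: cvg_cst].
  exact: (ck _ FK).
near (0 : R)^' => k.
have k0 : k != 0 by near: k; exact: nbhs_dnbhs_neq.
have : `|'D_1 F t - k^-1 *: (F (k *: 1 + t) - F t)| < e by near: k; exact: H.
have : `|F (k + t) - F t| <= K * `|k + t - t| by near: k; exact: cvg_within FK'.
rewrite /GRing.scale /= mulr1 addrK => h1 h2.
have h3 : `|k^-1 * (F (k + t) - F t)| <= K.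
  by rewrite normrM normfV mulrC ler_pdivrMr ?normr_gt0.
have := ler_normD ('D_1 F t - k^-1 * (F (k + t) - F t)) (k^-1 * (F (k + t) - F t)).
rewrite subrK; move: e0 h2 h3; rewrite /e; lra.
Unshelve. all: by end_near. Qed.

(** The density given by absolute continuity is set to 0 where it exceeds [K]. As derivatives of [F]
    are bounded by [K], this alters it on a null set only and makes the bound hold everywhere. *)
Lemma lipschitz_primitive F c d (K : R) : c <= d -> 0 < K ->
  (forall s t, c <= s -> s <= t -> t <= d -> `|F t - F s| <= K * (t - s)) ->
  exists f, primitive_on c d F f /\ forall t, `|f t| <= K.
Proof.
move=> cd K0 FK.
have [g Fg] := seq_abs_cont_primitive cd (lipschitz_seq_abs_cont K0 FK).
have mg := primitive_on_measurable Fg.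
pose f t := if `|g t| <= K then g t else 0.
exists f; split; last first.
  by move=> t; rewrite /f; case: ifP => // _; rewrite normr0 ltW.
apply: (primitive_unique Fg).
  apply: measurable_fun_if => //.
  - apply: measurable_fun_ler => //; exact: measurableT_comp.
  - by apply: measurable_funS mg => // t [].
apply: aeS (primitive_ae_derive Fg) => t dg /andP[ct td].
have D := dg (introT andP (conj ct td)).
rewrite /f (_ : `|g t| <= K)//.
apply: (derive_lipschitz D).
have tcd : t \in `]c, d[ by rewrite in_itv/= ct.
near=> s; have : s \in `]c, d[ by near: s; exact: near_in_itvoo.
rewrite in_itv/= => /andP[cs sd].
have [st|/ltW ts] := leP s t.
  by rewrite distrC [`|s - t|]distrC (ger0_norm (x := t - s)) ?subr_ge0// FK// ltW.
by rewrite (ger0_norm (x := s - t)) ?subr_ge0// FK// ltW.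
Unshelve. all: by end_near. Qed.

(** The mean of [g] over the interval from [t] to [t + k], written with one primitive valid on the
    whole line. *)
Definition steklov g (k : R) t :=
  (\int[mu]_(x in `]-oo, t + k]) g x - \int[mu]_(x in `]-oo, t]) g x) / k.

Definition bounded_supported g (M d : R) : Prop :=
  [/\ measurable_fun setT g, forall t, `|g t| <= M & forall t, t <= - d \/ d < t -> g t = 0].

Section BoundedSupported.
Context (g : R -> R) (M d : R) (gMd : bounded_supported g M d).

Let M0 : 0 <= M.
Proof. by have [_ gM _] := gMd; exact: le_trans (gM 0). Qed.

Lemma integrable_line : mu.-integrable setT (EFin \o g).
Proof.
have [mg gM g0] := gMd; set D := `](- d), d]%classic.
have mD : measurable D by exact: measurable_itv.
have mgD : measurable_fun D g by exact: measurable_funTS.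
have iD : mu.-integrable D (EFin \o g).
  have := integrable_bounded_mul mD mgD (fun t _ => gM t) (integrable_cst_itvoc 1 (- d) d).
  by apply: eq_integrable => // t _ /=; rewrite mulr1.
have := integrable_patch mD measurableT (@subsetT _ D) iD.
apply: eq_integrable => // t _ /=; rewrite patchE; case: ifPn => //.
rewrite notin_setE /D/= in_itv/= => H; rewrite g0//.
by have [h1|h1] := leP t (- d); [left|right; rewrite ltNge; apply/negP => h2; apply: H; rewrite h1].
Qed.

Lemma primitive_line s t : s <= t ->
  \int[mu]_(x in `]-oo, t]) g x - \int[mu]_(x in `]-oo, s]) g x = \int[mu]_(x in `]s, t]) g x.
Proof.
move=> st; apply: Rintegral_itvB; rewrite ?bnd_simp//.
by apply: integrableS integrable_line.
Qed.

Lemma lipschitz_line s t : s <= t ->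
  `|\int[mu]_(x in `]-oo, t]) g x - \int[mu]_(x in `]-oo, s]) g x| <= M * (t - s).
Proof.
move=> st; rewrite primitive_line//; have [mg gM g0] := gMd.
have igs : mu.-integrable `]s, t] (EFin \o g) by exact: integrableS integrable_line.
apply: (le_trans (le_normr_Rintegral _ igs)) => //.
rewrite -Rintegral_cst_itvoc//; apply: le_Rintegral => //.
  exact: (@integrable_norm _ _ _ mu `]s, t] g).
exact: integrable_cst_itvoc.
Qed.

Lemma lipschitz_continuous F (K : R) : 0 <= K ->
  (forall s t, s <= t -> `|F t - F s| <= K * (t - s)) -> continuous F.
Proof.
move=> K0 FK t; apply/cvgrPdist_lt => e e0.
near=> s.
have st : `|t - s| < e / (K + 1).
  by near: s; apply: cvgr_dist_lt; [exact: cvg_id|rewrite divr_gt0// ltr_wpDl].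
have : `|F t - F s| <= K * `|t - s|.
  have [ts|/ltW ts] := leP s t; first by rewrite (ger0_norm (x := t - s)) ?subr_ge0// FK.
  by rewrite distrC [`|t - s|]distrC (ger0_norm (x := s - t)) ?subr_ge0// FK.
move=> H; apply: (le_lt_trans H).
apply: (@le_lt_trans _ _ (K * (e / (K + 1)))); first by rewrite ler_wpM2l// ltW.
by rewrite mulrA ltr_pdivrMr ?ltr_wpDl// [X in _ < X]mulrC ltr_pM2r// ltrDl.
Unshelve. all: by end_near. Qed.

Lemma steklov_lipschitz (k : R) s t : 0 < k -> s <= t ->
  `|steklov g k t - steklov g k s| <= (2 * M / k) * (t - s).
Proof.
move=> k0 st; rewrite /steklov -mulrBl normrM normfV (gtr0_norm k0).
rewrite mulrAC ler_pM2r ?invr_gt0//.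
have h1 := lipschitz_line st; have h2 : s + k <= t + k by rewrite lerD2r.
have := lipschitz_line h2; rewrite opprD addrACA subrr addr0.
move: h1; set A := (\int[mu]_(x in _) _) ; set B := (\int[mu]_(x in _) _).
set A' := (\int[mu]_(x in _) _) ; set B' := (\int[mu]_(x in _) _) => h1 h3.
rewrite (_ : _ - _ = (A' - B') - (A - B)); last by ring.
by apply: (le_trans (ler_normB _ _)); lra.
Qed.

(** Means keep the bound [M]. The support spreads to the left by [k], and [d + k] encloses it
    symmetrically. *)
Lemma steklov_bounded_supported (k : R) : 0 < k -> bounded_supported (steklov g k) M (d + k).
Proof.
move=> k0; have [mg gM g0] := gMd; split.
- apply: continuous_measurable_fun; apply: (@lipschitz_continuous _ (2 * M / k)).
    by rewrite divr_ge0 ?(ltW k0)// mulr_ge0.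
  by move=> s t; exact: steklov_lipschitz.
- move=> t; rewrite /steklov normrM normfV (gtr0_norm k0) ler_pdivrMr//.
  have tk : t <= t + k by rewrite lerDl ltW.
  by have := lipschitz_line tk; rewrite addrAC subrr add0r.
move=> t td; rewrite /steklov primitive_line ?lerDl ?(ltW k0)//.
rewrite (_ : \int[mu]_(x in _) _ = \int[mu]_(x in `]t, t + k]) 0).
  by rewrite Rintegral_cst_itvoc ?lerDl ?(ltW k0)// !mul0r.
apply: eq_Rintegral => x; rewrite inE/= in_itv/= => /andP[tx xt]; apply: g0; move: tx xt.
by case: td => td ? ?; [left|right]; lra.
Qed.

Lemma steklov_derive (k K : R) t : 0 < k -> 0 <= K ->
  (forall s t, s <= t -> `|g t - g s| <= K * (t - s)) ->
  is_derive t 1 (steklov g k) ((g (t + k) - g t) / k).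
Proof.
move=> k0 K0 gK; have cg := lipschitz_continuous K0 gK.
pose G t := \int[mu]_(x in `]-oo, t]) g x.
have dG s : is_derive s 1 G (g s).
  have s1 : s < s + 1 by rewrite ltrDl.
  have ig : mu.-integrable `]-oo, s + 1] (EFin \o g) by exact: integrableS integrable_line.
  have [|dF F'] := continuous_FTC1 s1 ig _ (cg s); first by rewrite ltNyr.
  by apply: DeriveDef; [exact: dF|rewrite -F' derive1E].
have dk : is_derive t 1 (fun s : R => s + k) 1.
  by rewrite -[X in is_derive _ _ _ X]addr0; apply: is_deriveD.
have d1 := @is_derive1_comp R G (fun s : R => s + k) t _ _ (dG (t + k)) dk.
have d2 := is_derive_lin_fun k^-1 (is_derive_lin_fun (-1) (dG t) d1) (is_derive_cst (0 : R) t 1).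
apply: (near_is_derive _ (is_derive_eq d2 _)); last by field; rewrite gt_eqF.
by near=> s; rewrite /steklov /G /=; field; rewrite gt_eqF.
Unshelve. all: by end_near. Qed.

(** The means converge to [g] almost everywhere by Lebesgue differentiation, and the squared errors
    are dominated by the constant [(2 * M) ^+ 2]. *)
Lemma steklov_approx (e dl : R) : d < dl -> 0 < e ->
  exists k : R, [/\ 0 < k, d + k < dl & \int[mu]_(t in Iaa a) (g t - steklov g k t) ^+ 2 < e].
Proof.
move=> ddl e0; have [mg gM g0] := gMd.
pose k n : R := (dl - d) / 2 / n.+1%:R.
have kd : 0 < (dl - d) / 2 by lra.
have k0 n : 0 < k n by rewrite divr_gt0.
have kle n : k n <= (dl - d) / 2 by rewrite ler_pdivrMr// ler_peMr ?ler1n// ltW.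
have k_to0 : k n @[n --> \oo] --> 0.
  rewrite -[X in _ --> X](mulr0 ((dl - d) / 2)); apply: cvgMr; exact: cvg_harmonic.
have i4 := integrable_cst_Iaa a ((2 * M) ^+ 2).
have [||||n gt] := @L2_dominated_cvg g (fun n => steklov g (k n)) _ _ _ i4 _ _ e e0.
- by move=> n; have [ms _ _] := steklov_bounded_supported (k0 n); exact: measurable_funTS.
- exact: measurable_funTS.
- move=> n t _; have [_ sM _] := steklov_bounded_supported (k0 n).
  have H : `|g t - steklov g (k n) t| <= 2 * M.
    by apply: (le_trans (ler_normB _ _)); have := gM t; have := sM t; lra.
  rewrite -[X in X <= _]ger0_norm ?sqr_ge0// normrX; apply: lerXn2r => //; rewrite nnegrE//.
  exact: mulr_ge0.
- pose G t := \int[mu]_(x in `]-oo, t]) g x.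
  have pG : primitive_on (- a) a G g.
    split; first by apply: integrableS integrable_line.
    by move=> s t _ st _; exact: primitive_line.
  apply: aeS (primitive_ae_derive pG) => t dG; rewrite /Iaa/= in_itv/= => /dG[dGt Ev].
  rewrite -Ev.
  (* The derivative is a limit over punctured neighbourhoods, so positivity of [k n] enters here. *)
  have knz : k n @[n --> \oo] --> (0 : R)^'.
    move=> A A0; have : \forall n \near \oo, k n != 0 -> A (k n) by exact: (k_to0 _ A0).
    by apply: filterS => m; apply; rewrite gt_eqF.
  have := cvg_comp _ _ knz dGt.
  apply: cvg_trans; apply: near_eq_cvg; near=> m; rewrite /steklov /= /GRing.scale /= mulr1 mulrC.
  by rewrite [k m + t]addrC.
exists (k n); split => //; have := kle n; lra.
Unshelve. all: by end_near. Qed.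
End BoundedSupported.

Lemma weight_le1 t : weight a t <= 1.
Proof. by rewrite /weight gerBl divr_ge0// sqr_ge0. Qed.

Lemma weight_lipschitz s t : - a <= s -> s <= t -> t <= a ->
  `|weight a t - weight a s| <= 2 / a * (t - s).
Proof.
move=> as' st ta; rewrite /weight.
have a0 : a != 0 by rewrite gt_eqF.
rewrite (_ : _ - _ = - (s + t) / a ^+ 2 * (t - s)); last by field.
rewrite normrM (ger0_norm (x := t - s)) ?subr_ge0// ler_wpM2r ?subr_ge0//.
rewrite normrM normfV normrN (gtr0_norm (x := a ^+ 2)) ?exprn_gt0//.
rewrite ler_pdivrMr ?exprn_gt0// (_ : 2 / a * a ^+ 2 = 2 * a); last by field.
by rewrite ler_norml; apply/andP; split; lra.
Qed.

(** The derivative of the mean is the difference quotient [x'], Lipschitz along with [g]. Then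
    [weight * x'] is Lipschitz and has a bounded, hence square integrable, density. *)
Lemma lipschitz_rmax g (M K d k : R) : 0 < d -> 0 < k -> d + k < a -> 0 <= K ->
  bounded_supported g M d -> (forall s t, s <= t -> `|g t - g s| <= K * (t - s)) ->
  exists q y, rmax a (steklov g k) q y.
Proof.
move=> d0 k0 dka K0 gMd gK; have [mg gM g0] := gMd.
have M0 : 0 <= M by exact: le_trans (gM 0).
pose x' t := (g (t + k) - g t) / k.
have x'M t : `|x' t| <= 2 * M / k.
  rewrite normrM normfV (gtr0_norm k0) ler_pM2r ?invr_gt0//.
  by apply: (le_trans (ler_normB _ _)); have := gM t; have := gM (t + k); lra.
have x'K s t : s <= t -> `|x' t - x' s| <= 2 * K / k * (t - s).
  move=> st; rewrite /x' -mulrBl normrM normfV (gtr0_norm k0) mulrAC ler_pM2r ?invr_gt0//.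
  have stk : s + k <= t + k by rewrite lerD2r.
  have := gK _ _ st; have := gK _ _ stk; rewrite opprD addrACA subrr addr0 => h1 h2.
  rewrite (_ : _ - _ - _ = (g (t + k) - g (s + k)) - (g t - g s)); last by ring.
  by apply: (le_trans (ler_normB _ _)); lra.
pose q t := weight a t * x' t.
have aa : - a <= a by have := a_gt0; lra.
(* A Lipschitz constant of the product [weight * x'], using [weight <= 1] and its constant [2 / a];
   the final 1 makes [L] positive. *)
pose L := 2 * K / k + 2 / a * (2 * M / k) + 1.
have L1 : 0 <= 2 * K / k by rewrite divr_ge0 ?(ltW k0)// mulr_ge0.
have L2 : 0 <= 2 * M / k by rewrite divr_ge0 ?(ltW k0)// mulr_ge0.
have L3 : 0 <= 2 / a by rewrite divr_ge0 ?(ltW a_gt0).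
have L0 : 0 < L by rewrite /L ltr_wpDl// addr_ge0// mulr_ge0.
have [|psi [pq psiL]] := @lipschitz_primitive q _ _ L aa L0.
  move=> s t as' st ta; rewrite /q.
  rewrite (_ : _ - _ = weight a t * (x' t - x' s) + (weight a t - weight a s) * x' s); last by ring.
  apply: (le_trans (ler_normD _ _)); rewrite (normrM (weight a t)) (normrM (_ - _)).
  have h1 : `|weight a t| <= 1.
    by rewrite ger0_norm ?weight_le1// weightE// divr_ge0 ?sqr_ge0// mulr_ge0; lra.
  have ts0 : 0 <= t - s by rewrite subr_ge0.
  have h2 : `|weight a t| * `|x' t - x' s| <= 1 * (2 * K / k * (t - s)).
    by apply: ler_pM => //; exact: x'K.
  have h3 : `|weight a t - weight a s| * `|x' s| <= 2 / a * (t - s) * (2 * M / k).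
    by apply: ler_pM => //; exact: weight_lipschitz.
  rewrite (_ : L * (t - s) = 1 * (2 * K / k * (t - s)) + 2 / a * (t - s) * (2 * M / k) + (t - s)).
    by move: h2 h3 ts0; lra.
  by rewrite /L; ring.
have [ipsi Epsi] := pq.
have sub : Iaa a `<=` `](- a), a] by apply: subset_itvl; rewrite bnd_simp.
have mpsi : measurable_fun (Iaa a) psi.
  by apply: measurable_funS (primitive_on_measurable pq).
have [sm sM s0] := steklov_bounded_supported gMd k0.
have sx : sol a (steklov g k) q psi.
  split.
    split; first by apply: integrableS ipsi => //; exact: measurable_Iaa.
    by move=> s t as' st ta; apply: Epsi => //; exact: ltW.
  move=> t h1 h2; rewrite /q mulrC mulKf; last by rewrite gt_eqF// weight_gt0.
  exact: (steklov_derive gMd _  k0 K0 gK).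
exists q, (fun t => t ^+ 2 * steklov g k t - psi t); apply: sol_rmax sx => //.
  by apply: (@rL2_bounded _ _ _ M) => //; exact: measurable_funTS.
by apply: (@rL2_bounded _ _ _ L).
Qed.

(** [f] is cut in height at [n] and in space at [d n]. At each point the truncations are eventually
    equal to [f], and the squared errors are dominated by [f ^+ 2]. *)
Lemma truncation f (e : R) : rL2 a f -> 0 < e -> exists g M d,
  [/\ 0 < d, d < a, bounded_supported g M d & \int[mu]_(t in Iaa a) (f t - g t) ^+ 2 < e].
Proof.
move=> [mf if2] e0; pose d n : R := a - a / 2 / n.+1%:R.
have a2 : 0 < a / 2 by rewrite divr_gt0.
have d1 n : a / 2 <= d n.
  rewrite /d lerBrDl -lerBrDr (_ : a - a / 2 = a / 2); last by field.
  by rewrite ler_pdivrMr// ler_peMr ?ler1n// ltW.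
have d2 n : d n < a by rewrite /d ltrBlDr ltrDl divr_gt0.
have d0 n : 0 < d n by exact: lt_le_trans (d1 n).
have mI := measurable_Iaa a.
pose f1 := f \_ (Iaa a).
have mf1 : measurable_fun setT f1 by apply/(measurable_restrictT _ _).1.
pose g n t : R := if (`|f1 t| <= n%:R) && ((- d n < t) && (t <= d n)) then f1 t else 0.
have gP n : bounded_supported (g n) n%:R (d n).
  split.
  - apply: measurable_fun_if => //.
      apply: measurable_and; first by apply: measurable_fun_ler => //; exact: measurableT_comp.
      by apply: measurable_and; [apply: measurable_fun_ltr|apply: measurable_fun_ler].
    exact: measurable_funTS.
  - by move=> t; rewrite /g; case: ifP => [/andP[]|]//; rewrite normr0.
  - move=> t td; rewrite /g ifF//; apply/negP => /andP[_ /andP[h1 h2]].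
    by case: td => ?; lra.
have f1E t : Iaa a t -> f1 t = f t by move=> It; rewrite /f1 patchE mem_set.
have [||||n gt] := @L2_dominated_cvg f g _ _ _ if2 _ _ e e0.
- by move=> n; have [mg _ _] := gP n; exact: measurable_funTS.
- exact: mf.
- move=> n t It; rewrite /g; case: ifP => _; last by rewrite subr0.
  by rewrite f1E// subrr expr0n/= sqr_ge0.
- apply: aeW => t It; apply: cvg_near_cst.
  move: (It); rewrite /Iaa /= in_itv/= => /andP[h1' h2'].
  have m0 : 0 < a - `|t| by rewrite subr_gt0 ltr_norml h1'.
  near=> n; rewrite /g f1E// ifT//; apply/andP; split; first by near: n; exact: nbhs_infty_ger.
  have et : a / 2 / n.+1%:R < a - `|t|.
    rewrite ltr_pdivrMr// [X in _ < X]mulrC -ltr_pdivrMr//.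
    apply: (@le_lt_trans _ _ n%:R); last by rewrite ltr_nat.
    by near: n; exact: nbhs_infty_ger.
  have := ler_norm t; have := ler_norm (- t); rewrite normrN /d.
  move: et; set e' := a / 2 / _ => et ? ?.
  by apply/andP; split; lra.
by exists (g n), n%:R, (d n).
Unshelve. all: by end_near. Qed.

Lemma rL2_bounded_supported g (M d : R) : bounded_supported g M d -> rL2 a g.
Proof.
by move=> [mg gM _]; apply: (@rL2_bounded _ _ _ M) => //; exact: measurable_funTS.
Qed.

Lemma L2_triangle f g h : rL2 a f -> rL2 a g -> rL2 a h ->
  \int[mu]_(t in Iaa a) (f t - h t) ^+ 2 <=
  2 * (\int[mu]_(t in Iaa a) (f t - g t) ^+ 2) + 2 * (\int[mu]_(t in Iaa a) (g t - h t) ^+ 2).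
Proof.
move=> f2 g2 h2; have mI := measurable_Iaa a.
have sub2 (u v : R -> R) : rL2 a u -> rL2 a v ->
    mu.-integrable (Iaa a) (EFin \o (fun t => (u t - v t) ^+ 2)).
  move=> u2 v2; have [_] := rL2_lin (-1) v2 u2.
  by apply: eq_integrable => // t _ /=; congr EFin; ring.
have i1 := sub2 _ _ f2 g2; have i2 := sub2 _ _ g2 h2.
have i0 : mu.-integrable (Iaa a) (EFin \o (fun=> 0)) by exact: integrable0.
have E2 := Rintegral_lin 2 mI i2 i0; have E1 := Rintegral_lin 2 mI i1 (integrable_lin 2 mI i2 i0).
have Z : \int[mu]_(t in Iaa a) (0 : R) = 0 by rewrite Rintegral_cst ?mul0r//; exact: measurable_Iaa.
rewrite Z addr0 in E2; rewrite E2 in E1; rewrite -E1.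
apply: le_Rintegral => //; first exact: sub2.
  exact: (integrable_lin 2 mI i1 (integrable_lin 2 mI i2 i0)).
move=> t _; have := sqr_ge0 ((f t - g t) - (g t - h t)); lra.
Qed.

Lemma rmax_dense f (e : R) : rL2 a f -> 0 < e -> exists x q y,
  [/\ rmax a x q y, supported_in a x & \int[mu]_(t in Iaa a) (f t - x t) ^+ 2 < e].
Proof.
(* [L2_triangle] doubles squared errors and is used twice, so three errors below [e / 16] add up to
   less than [(2 + 4 + 4) e / 16]. *)
move=> f2 e0; have e4 : 0 < e / 16 by rewrite divr_gt0.
have [g [M [d [d0 da gP fg]]]] := truncation f2 e4.
pose d1 := (d + a) / 2; have dd1 : d < d1 by rewrite /d1; lra.
have d1a : d1 < a by rewrite /d1; lra.
have [k [k0 dk gs]] := steklov_approx gP dd1 e4.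
have sP := steklov_bounded_supported gP k0.
have sK := fun s t => @steklov_lipschitz g M d gP k s t k0.
have dk0 : 0 < d + k by rewrite addr_gt0.
have [m [m0 dm ss]] := steklov_approx sP dk e4.
have ssP := steklov_bounded_supported sP m0.
have dma : d + k + m < a by exact: lt_trans d1a.
have M0 : 0 <= M by have [_ gM _] := gP; exact: le_trans (gM 0).
have K0 : 0 <= 2 * M / k by rewrite divr_ge0 ?(ltW k0)// mulr_ge0.
have [q [y xq]] := lipschitz_rmax dk0 m0 dma K0 sP sK.
exists (steklov (steklov g k) m), q, y; split; first exact: xq.
  exists ((d + k + m + a) / 2); split; [lra|lra|].
  by move=> t _ _ td; have [_ _ s0] := ssP; apply: s0; case: td => ?; [left|right]; lra.
have g2 := rL2_bounded_supported gP; have s2 := rL2_bounded_supported sP.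
have ss2 := rL2_bounded_supported ssP.
have := L2_triangle f2 g2 ss2; have := L2_triangle g2 s2 ss2; lra.
Qed.
End Density.

Local Notation re x := (fun t => complex.Re (x t)).
Local Notation im x := (fun t => complex.Im (x t)).

(** * Between the integral form of the equation and pointwise derivatives *)

Section RealClassical.
Context {R : realType} (a : R) (a_gt0 : 0 < a).
Implicit Types (x y q f F G : R -> R) (s t c d : R).
Notation mu := (@lebesgue_measure R).

Lemma seq_abs_cont_eq F G c d : (forall t, c <= t -> t <= d -> F t = G t) ->
  seq_abs_cont F c d -> seq_abs_cont G c d.
Proof.
move=> FG Fac e e0; have [dl dl0 H] := Fac e e0; exists dl => // L sL nL lL.
apply: le_trans (H L sL nL lL); rewrite le_eqVlt; apply/orP; left; apply/eqP.
rewrite big_seq [RHS]big_seq; apply: eq_bigr => p pL.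
move/allP : sL => /(_ p pL)/and3P[h1 h2 h3]; rewrite !FG//.
  exact: le_trans h2 h3.
exact: le_trans h1 h2.
Qed.

Lemma seq_abs_cont_weight c d : - a < c -> d < a -> seq_abs_cont (weight a) c d.
Proof.
move=> ac da; have a2 : 0 < 2 / a by rewrite divr_gt0.
apply: (lipschitz_seq_abs_cont a2) => s t cs st td.
by apply: weight_lipschitz => //; rewrite ltW//; [exact: lt_le_trans cs|exact: le_lt_trans da].
Qed.

Lemma seq_abs_cont_weightV c d : - a < c -> c <= d -> d < a ->
  seq_abs_cont (fun t => (weight a t)^-1) c d.
Proof.
move=> ac cd da; pose m := (a - d) * (a + c) / a ^+ 2.
have m0 : 0 < m by rewrite divr_gt0 ?exprn_gt0// mulr_gt0; lra.
have K0 : 0 < 2 / a / m ^+ 2 by rewrite divr_gt0 ?exprn_gt0// divr_gt0.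
apply: (lipschitz_seq_abs_cont K0) => s t cs st td.
have ms : m <= weight a s by apply: weight_ge => //; exact: le_trans td.
have mt : m <= weight a t by apply: weight_ge => //; exact: le_trans st.
have as' : - a < s by exact: lt_le_trans cs.
have ta : t < a by exact: le_lt_trans da.
have W := weight_lipschitz a_gt0 (ltW as') st (ltW ta).
have ws0 : 0 < weight a s by exact: lt_le_trans ms.
have wt0 : 0 < weight a t by exact: lt_le_trans mt.
move: W ms mt ws0 wt0; set u := weight a s; set v := weight a t => W ms mt ws0 wt0.
rewrite (_ : v^-1 - u^-1 = - (v - u) / (u * v)); last by field; rewrite !gt_eqF.
rewrite normrM normrN normfV (gtr0_norm (x := u * v)) ?mulr_gt0//.
apply: (@le_trans _ _ (2 / a * (t - s) / (u * v))).
  by rewrite ler_pM2r// invr_gt0 mulr_gt0.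
rewrite mulrAC ler_wpM2r ?subr_ge0//; apply: ler_wpM2l; first exact: ltW (divr_gt0 _ _).
have muv : m ^+ 2 <= u * v by rewrite expr2; apply: ler_pM; rewrite ?(ltW m0).
have uv0 : 0 < u * v by exact: mulr_gt0.
have m20 : 0 < m ^+ 2 by exact: exprn_gt0.
by rewrite (lef_pV2 uv0 m20).
Qed.

(** Local absolute continuity of [weight * x'] identifies its density as [t ^+ 2 * x - y];
    integrability up to the ends comes from the square integrability of that expression. *)
Lemma classical_rmax x y : (forall t, - a < t -> t < a -> derivable x t 1) ->
  (forall c d, - a < c -> c <= d -> d < a -> seq_abs_cont (derive1 x) c d) ->
  rL2 a x -> rL2 a y ->
  {ae mu, forall t, Iaa a t ->
     y t = - derive1 (fun s => weight a s * derive1 x s) t + t ^+ 2 * x t} ->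
  rmax a x (fun t => weight a t * derive1 x t) y.
Proof.
move=> dx acx x2 y2 yE; split; [exact: x2|exact: y2|split]; last first.
  move=> t h1 h2; rewrite mulrC mulKf ?gt_eqF ?weight_gt0// derive1E.
  exact: derivableP (dx t h1 h2).
have f2 : rL2 a (fun t => t ^+ 2 * x t - y t).
  have := rL2_lin (-1) y2 (rL2_sqr a_gt0 x2); apply: rL2_eq => t _; ring.
split; first exact: rL2_integrable.
move=> s t as' st ta.
have acq : seq_abs_cont (fun t => weight a t * derive1 x t) s t.
  by apply: seq_abs_contM => //; [exact: seq_abs_cont_weight|exact: acx].
have [g qg] := seq_abs_cont_primitive st acq.
have sub : `]s, t]%classic `<=` Iaa a by apply: sub_Iaa => //; exact: ltW.
have [_ E] : primitive_on s t (fun t => weight a t * derive1 x t) (fun t => t ^+ 2 * x t - y t).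
  apply: (primitive_seq_abs_cont_unique st acq).
    by case: f2 => mf _; apply: measurable_funS mf => //; exact: measurable_Iaa.
  apply: aeS (aeI (primitive_ae_derive qg) yE) => z [dq yz] sz.
  have D := dq sz; apply: (is_derive_eq D).
  rewrite yz; last by apply: sub; rewrite /= in_itv/=; case/andP: sz => -> /ltW.
  rewrite derive1E (@derive_val _ _ _ _ _ _ _ D); ring.
exact: E.
Qed.

Lemma prim_ae_derive q f : prim a q f -> {ae mu, forall t, Iaa a t -> is_derive t 1 q (f t)}.
Proof.
move=> [intf E]; pose f1 := f \_ (Iaa a).
have mI := measurable_Iaa a.
have i1 : mu.-integrable `]- a, a] (EFin \o f1).
  by apply: integrable_patch => //; apply: subset_itvl; rewrite bnd_simp.
have pG := primitive_on_integral i1.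
set G := (X in primitive_on _ _ X _) in pG.
have GE s t : - a < s -> s <= t -> t < a -> q t - q s = G t - G s.
  move=> as' st ta; have [_ EG] := pG; rewrite E// (EG _ _ (ltW as') st (ltW ta)).
  apply: eq_Rintegral => z; rewrite inE /f1 => zst; rewrite patchE mem_set//.
  by apply: (sub_Iaa (ltW as') ta).
have qG t : - a < t -> t < a -> q t = G t + (q 0 - G 0).
  move=> h1 h2; have a0 : - a < 0 by rewrite oppr_lt0.
  have [t0|t0] := leP t 0; first by have := GE t 0 h1 t0 a_gt0; lra.
  by have := GE 0 t a0 (ltW t0) h2; lra.
apply: aeS (primitive_ae_derive pG) => t dG It.
have It' := It; move: It'; rewrite /Iaa /= in_itv/= => tI.
have D := dG tI.
have D2 := is_derive_lin_fun 1 D (is_derive_cst (q 0 - G 0 : R) t 1).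
apply: (near_is_derive _ (is_derive_eq D2 _)).
  near=> s; have : s \in `](- a), a[ by near: s; exact: near_in_itvoo.
  by rewrite in_itv/= => /andP[h1 h2]; rewrite mul1r (qG s).
by rewrite mul1r addr0 /f1 patchE mem_set.
Unshelve. all: by end_near. Qed.

(** On compact subintervals the derivative of [x] is the product of the absolutely continuous
    functions [q] and [1 / weight], while [weight * x'] coincides with [q] near each point. *)
Lemma rmax_classical x q y : rmax a x q y ->
  [/\ forall t, - a < t -> t < a -> derivable x t 1,
      forall c d, - a < c -> c <= d -> d < a -> seq_abs_cont (derive1 x) c d &
      {ae mu, forall t, Iaa a t ->
     y t = - derive1 (fun s => weight a s * derive1 x s) t + t ^+ 2 * x t}].
Proof.
move=> rx; have [x2 y2 [pq dx]] := rx; split.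
- by move=> t h1 h2; case: (dx t h1 h2).
- move=> c d ac cd da.
  apply: (@seq_abs_cont_eq (fun t => q t * (weight a t)^-1)).
    by move=> t ct td; rewrite (rmax_derive1 rx)//; [exact: lt_le_trans ct|exact: le_lt_trans da].
  apply: seq_abs_contM => //; last exact: seq_abs_cont_weightV.
  exact: primitive_seq_abs_cont (prim_on pq ac da).
apply: aeS (prim_ae_derive pq) => t dq It.
have D := dq It; move: It; rewrite /Iaa /= in_itv/= => tI.
have [h1 h2] := andP tI.
have D2 : is_derive t 1 (fun s => weight a s * derive1 x s) (t ^+ 2 * x t - y t).
  apply: (near_is_derive _ D); near=> s.
  have : s \in `](- a), a[ by near: s; exact: near_in_itvoo.
  rewrite in_itv/= => /andP[h1' h2']; rewrite (rmax_derive1 rx)// mulrC divfK//.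
  by rewrite gt_eqF// weight_gt0.
rewrite derive1E (@derive_val _ _ _ _ _ _ _ D2); ring.
Unshelve. all: by end_near. Qed.
End RealClassical.

(** * Complex numbers through real and imaginary parts *)

Section ComplexNumbers.
Context {R : realType}.
Implicit Types (z w : R[i]).

Lemma sqr_normc z : Normc.normc z ^+ 2 = complex.Re z ^+ 2 + complex.Im z ^+ 2.
Proof. by case: z => u v; rewrite /= sqr_sqrtr// addr_ge0// sqr_ge0. Qed.

Lemma normc_nneg z : 0 <= Normc.normc z.
Proof. by case: z => u v; exact: sqrtr_ge0. Qed.

Lemma normr_Re_le z : `|complex.Re z| <= Normc.normc z.
Proof. by case: z => u v; rewrite /= -sqrtr_sqr; apply: ler_wsqrtr; rewrite lerDl sqr_ge0. Qed.

Lemma normr_Im_le z : `|complex.Im z| <= Normc.normc z.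
Proof. by case: z => u v; rewrite /= -sqrtr_sqr; apply: ler_wsqrtr; rewrite lerDr sqr_ge0. Qed.

Lemma normc_le z : Normc.normc z <= `|complex.Re z| + `|complex.Im z|.
Proof.
rewrite -(@ler_pXn2r _ 2) ?nnegrE ?normc_nneg ?addr_ge0// sqr_normc sqrrD !real_normK ?num_real//.
by rewrite lerD2r lerDl mulrn_wge0// mulr_ge0.
Qed.

Lemma ReD z w : complex.Re (z + w) = complex.Re z + complex.Re w. Proof. by case: z w => ? ? [? ?]. Qed.
Lemma ImD z w : complex.Im (z + w) = complex.Im z + complex.Im w. Proof. by case: z w => ? ? [? ?]. Qed.
Lemma ReN z : complex.Re (- z) = - complex.Re z. Proof. by case: z. Qed.
Lemma ImN z : complex.Im (- z) = - complex.Im z. Proof. by case: z. Qed.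
Lemma ReM z w : complex.Re (z * w) = complex.Re z * complex.Re w - complex.Im z * complex.Im w.
Proof. by case: z w => ? ? [? ?]. Qed.
Lemma ImM z w : complex.Im (z * w) = complex.Re z * complex.Im w + complex.Im z * complex.Re w.
Proof. by case: z w => ? ? [? ?]. Qed.
Lemma Re_conj z : complex.Re (z^*)%C = complex.Re z. Proof. by case: z. Qed.
Lemma Im_conj z : complex.Im (z^*)%C = - complex.Im z. Proof. by case: z. Qed.

Definition complexE := (ReD, ImD, ReN, ImN, ReM, ImM, Re_conj, Im_conj).

Lemma complex_eqP z w : z = w <-> complex.Re z = complex.Re w /\ complex.Im z = complex.Im w.
Proof. by case: z w => ? ? [? ?] /=; split => [[-> ->]|[-> ->]]. Qed.

(** In the order of [R[i]] a positive [e] is real, so each part gets the tolerance [e / 2]. *)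
Lemma cvg_complex (F : set_system R) (FF : ProperFilter F) (f : R -> R[i]) (l1 l2 : R) :
  complex.Re (f t) @[t --> F] --> l1 -> complex.Im (f t) @[t --> F] --> l2 ->
  lim ((f t : R[i]^o) @[t --> F]) = (l1 +i* l2)%C.
Proof.
move=> f1 f2; apply: cvg_lim; first exact: norm_hausdorff.
apply/cvgrPdist_lt => -[e e'] he.
have [/eqP e'0 e0] : e' == 0 /\ 0 < e by move: he; rewrite ltcE/= => /andP[].
subst e'; have e2 : 0 < e / 2 by rewrite divr_gt0.
have /cvgrPdist_lt H1 := f1; have /cvgrPdist_lt H2 := f2.
near=> t.
have : `|l1 - complex.Re (f t)| < e / 2 by near: t; exact: H1.
have : `|l2 - complex.Im (f t)| < e / 2 by near: t; exact: H2.
case: (f t) => u v /= h2 h1.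
have : `|(l1 +i* l2)%C - (u +i* v)%C| < (e +i* 0)%C.
  rewrite ltcE /= eqxx /=.
  have := normc_le ((l1 +i* l2) - (u +i* v))%C; rewrite /=; lra.
by [].
Unshelve. all: by end_near. Qed.
End ComplexNumbers.

(** * The complex maximal domain *)

Section ComplexBridge.
Context {R : realType} (a : R) (a_gt0 : 0 < a).
Implicit Types (x y z w f g h k : R -> R[i]) (s t c d : R).
Notation mu := (@lebesgue_measure R).

Lemma inL2P f : inL2 a f <-> rL2 a (re f) /\ rL2 a (im f).
Proof.
have mI := measurable_Iaa a; split.
  move=> [[m1 m2] fin].
  have mn : measurable_fun (Iaa a) (fun t => Normc.normc (f t) ^+ 2).
    rewrite (_ : (fun t => _) = (fun t => complex.Re (f t) ^+ 2 + complex.Im (f t) ^+ 2)).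
      by apply: measurable_funD; exact: measurable_funX.
    by apply/funext => t; exact: sqr_normc.
  have inorm : mu.-integrable (Iaa a) (EFin \o (fun t => Normc.normc (f t) ^+ 2)).
    apply/integrableP; split; first exact/measurable_EFinP.
    apply: le_lt_trans fin; rewrite le_eqVlt; apply/orP; left; apply/eqP.
    apply: eq_integral => t _ /=.
    by rewrite ger0_norm ?sqr_ge0.
  split; split => //; (apply: (integrable_le mI _ inorm); first exact: measurable_funX) => t _;
    by rewrite ger0_norm ?sqr_ge0// sqr_normc ?lerDl ?lerDr sqr_ge0.
move=> [[m1 i1] [m2 i2]]; split; first by split.
have /integrableP[_] := integrable_lin 1 mI i1 i2; apply: le_lt_trans.
rewrite le_eqVlt; apply/orP; left; apply/eqP; apply: eq_integral => t _ /=.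
by rewrite mul1r -sqr_normc ger0_norm ?sqr_ge0.
Qed.

Lemma dotL2E f g : inL2 a f -> inL2 a g -> dotL2 a f g =
  ((\int[mu]_(t in Iaa a) (complex.Re (f t) * complex.Re (g t))
    + \int[mu]_(t in Iaa a) (complex.Im (f t) * complex.Im (g t)))
  +i* (\int[mu]_(t in Iaa a) (complex.Im (f t) * complex.Re (g t))
    - \int[mu]_(t in Iaa a) (complex.Re (f t) * complex.Im (g t))))%C.
Proof.
move=> /inL2P[f1 f2] /inL2P[g1 g2]; have mI := measurable_Iaa a.
rewrite /dotL2 /cintegral; apply/complex_eqP => /=; split.
  have := Rintegral_lin 1 mI (rL2_mul f1 g1) (rL2_mul f2 g2); rewrite mul1r => <-.
  by apply: eq_Rintegral => t _; rewrite !complexE; ring.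
have := Rintegral_lin (-1) mI (rL2_mul f1 g2) (rL2_mul f2 g1); rewrite mulN1r addrC => <-.
by apply: eq_Rintegral => t _; rewrite !complexE; ring.
Qed.

(** The expression has real coefficients, so it acts on the two parts separately. [y] is any square
    integrable representative of the image of [x]. *)
Definition cmax x y : Prop :=
  (exists q, rmax a (re x) q (re y)) /\ (exists q, rmax a (im x) q (im y)).

Lemma inL2_lin (b : R[i]) f g : inL2 a f -> inL2 a g -> inL2 a (fun t => b * f t + g t).
Proof.
move=> /inL2P[f1 f2] /inL2P[g1 g2]; apply/inL2P; split.
  have := rL2_lin (complex.Re b) f1 (rL2_lin (- complex.Im b) f2 g1).
  by apply: rL2_eq => t _; rewrite !complexE; ring.
have := rL2_lin (complex.Re b) f2 (rL2_lin (complex.Im b) f1 g2).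
by apply: rL2_eq => t _; rewrite !complexE; ring.
Qed.

Lemma cmax_inL2 x y : cmax x y -> inL2 a x /\ inL2 a y.
Proof. by move=> [[q [x1 y1 _]] [r [x2 y2 _]]]; split; apply/inL2P. Qed.

Lemma rmax_eq (x z q r y w : R -> R) : x = z -> q = r -> y = w -> rmax a x q y -> rmax a z r w.
Proof. by move=> -> -> ->. Qed.

Lemma cmax_lin (b : R[i]) x y z w : cmax x y -> cmax z w ->
  cmax (fun t => b * x t + z t) (fun t => b * y t + w t).
Proof.
move=> [[q1 x1] [q2 x2]] [[r1 z1] [r2 z2]]; split.
  have H := rmax_lin (complex.Re b) x1 (rmax_lin (- complex.Im b) x2 z1).
  eexists; apply: rmax_eq H; [|reflexivity|]; apply/funext => t; rewrite !complexE; ring.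
have H := rmax_lin (complex.Re b) x2 (rmax_lin (complex.Im b) x1 z2).
by eexists; apply: rmax_eq H; [|reflexivity|]; apply/funext => t; rewrite !complexE; ring.
Qed.

Lemma Re_prolate x t : complex.Re (prolate a x t) =
  - derive1 (fun s => weight a s * derive1 (re x) s) t + t ^+ 2 * complex.Re (x t).
Proof.
rewrite /prolate !complexE /= mul0r subr0; congr (- derive1 _ t + _).
by apply/funext => s; rewrite mul0r subr0.
Qed.

Lemma Im_prolate x t : complex.Im (prolate a x t) =
  - derive1 (fun s => weight a s * derive1 (im x) s) t + t ^+ 2 * complex.Im (x t).
Proof.
rewrite /prolate !complexE /= mul0r addr0; congr (- derive1 _ t + _).
by apply/funext => s; rewrite mul0r addr0.
Qed.

Lemma Dmax_cmax x y : Dmax a x -> inL2 a y -> eqL2 a y (prolate a x) -> cmax x y.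
Proof.
move=> [[dx ax] x2 _] y2 yE; have /inL2P[x1 x2'] := x2; have /inL2P[y1 y2'] := y2.
have ac c d : - a < c -> c <= d -> d < a ->
    abs_cont (derive1 (re x)) c d /\ abs_cont (derive1 (im x)) c d.
  move=> ac cd da; split=> e e0; have [dl dl0 H] := ax c d ac cd da e e0;
  exists dl => // n u v h1 h2 h3; apply: le_lt_trans (H n u v h1 h2 h3); apply: ler_sum => i _.
    exact: normr_Re_le (cderive x (v i) - cderive x (u i)).
  exact: normr_Im_le (cderive x (v i) - cderive x (u i)).
split; eexists; apply: classical_rmax => //.
- by move=> t h1 h2; have [] := dx t (introT andP (conj h1 h2)).
- by move=> c d h1 h2 h3; apply: abs_cont_seq; have [] := ac c d h1 h2 h3.
- by apply: aeS yE => t yE It; rewrite yE// Re_prolate.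
- by move=> t h1 h2; have [] := dx t (introT andP (conj h1 h2)).
- by move=> c d h1 h2 h3; apply: abs_cont_seq; have [] := ac c d h1 h2 h3.
- by apply: aeS yE => t yE It; rewrite yE// Im_prolate.
Qed.

Lemma cmax_prolate x y : cmax x y -> eqL2 a y (prolate a x).
Proof.
move=> [[q1 r1] [q2 r2]].
have [_ _ E1] := rmax_classical a_gt0 r1; have [_ _ E2] := rmax_classical a_gt0 r2.
apply: aeS (aeI E1 E2) => t [h1 h2] It; apply/complex_eqP; split.
  by rewrite Re_prolate h1.
by rewrite Im_prolate h2.
Qed.

Lemma cmax_Dmax x y : cmax x y -> Dmax a x.
Proof.
move=> xy; have [x2 y2] := cmax_inL2 xy; have yE := cmax_prolate xy.
have [[q1 r1] [q2 r2]] := xy.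
have [d1 a1 _] := rmax_classical a_gt0 r1; have [d2 a2 _] := rmax_classical a_gt0 r2.
split; [split|exact: x2|by exists y].
  by move=> t /andP[h1 h2]; split; [exact: d1|exact: d2].
move=> c d h1 h2 h3 e e0; have e2 : 0 < e / 2 by rewrite divr_gt0.
have [dl1 dl10 H1] := seq_abs_contP (a1 c d h1 h2 h3) e2.
have [dl2 dl20 H2] := seq_abs_contP (a2 c d h1 h2 h3) e2.
exists (Num.min dl1 dl2); first by rewrite lt_min dl10.
move=> n u v k1 k2; rewrite lt_min => /andP[k3 k4].
have := H1 n u v k1 k2 k3; have := H2 n u v k1 k2 k4.
set S1 := (X in X < _ -> _) => K1; set S2 := (X in X < _ -> _) => K2.
apply: (@le_lt_trans _ _ (S2 + S1)); last by lra.
rewrite /S1 /S2 -big_split /=; apply: ler_sum => i _.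
exact: normc_le (cderive x (v i) - cderive x (u i)).
Qed.

(** Both functions are continuous: a point where they differ would give a whole interval inside a
    null set. *)
Lemma rmax_ae_eq (x z q r y w : R -> R) : rmax a x q y -> rmax a z r w ->
  {ae mu, forall t, Iaa a t -> x t = z t} -> forall t, - a < t -> t < a -> x t = z t.
Proof.
move=> [_ _ [_ dx]] [_ _ [_ dz]] xz t h1 h2; apply/eqP; rewrite -subr_eq0; apply/negPn/negP => n0.
have cxz : {for t, continuous (x \- z)}.
  apply: (@continuousB R R^o); apply: differentiable_continuous; apply/derivable1_diffP.
    by case: (dx t h1 h2).
  by case: (dz t h1 h2).
have near0 : \forall s \near t, (x \- z) s != 0 by exact: (cvgr_neq0 _ cxz n0).
have : \forall s \near t, (x \- z) s != 0 /\ s \in `](- a), a[.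
  by apply: filterI => //; apply: near_in_itvoo; rewrite in_itv/= h1.
move=> /nbhs_ballP[e /= e0 eB].
have [N [mN N0 sub]] := xz.
pose J : set R := `]t - e, t + e[%classic.
have sub2 : J `<=` N.
  move=> s; rewrite /J /= in_itv/= => /andP[s1 s2]; apply: sub => /= H.
  have [] := eB s; first by rewrite /ball /= ltr_distlC s1.
  by rewrite in_itv /= => + sI; rewrite subr_eq0 H ?eqxx// /Iaa /= in_itv.
have : (mu J <= mu N)%E by apply: le_measure; rewrite ?inE//; exact: measurable_itv.
have E : mu J = ((t + e) - (t - e))%:E by apply: lebesgue_itvoo; lra.
have E' : (((t + e) - (t - e))%:E <= 0%:E :> \bar R)%E -> False by rewrite lee_fin => ?; lra.
by move=> K; apply: E'; rewrite -E; apply: (le_trans K); rewrite le_eqVlt; apply/orP; left; apply/eqP.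
Qed.

Lemma cmax_ae_eq x y z w : cmax x y -> cmax z w -> eqL2 a x z ->
  forall t, - a < t -> t < a -> x t = z t.
Proof.
move=> [[q1 x1] [q2 x2]] [[r1 z1] [r2 z2]] xz t h1 h2; apply/complex_eqP; split.
  by apply: (rmax_ae_eq x1 z1) => //; apply: aeS xz => s xz /xz ->.
by apply: (rmax_ae_eq x2 z2) => //; apply: aeS xz => s xz /xz ->.
Qed.

(** Classical representatives of one class agree everywhere on the interval, hence so do their
    derivatives. This makes the operators single-valued on classes. *)
Lemma cmax_ae_eq_image x y z w : cmax x y -> cmax z w -> eqL2 a x z -> eqL2 a y w.
Proof.
move=> xy zw xz; have E := cmax_ae_eq xy zw xz.
apply: aeS (aeI (cmax_prolate xy) (cmax_prolate zw)) => t [h1 h2] It; rewrite h1// h2//.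
have /andP[u1 u2] : - a < t < a by move: It; rewrite /Iaa /= in_itv.
have W (f g : R -> R) : (forall s, - a < s -> s < a -> f s = g s) ->
    derive1 (fun s => weight a s * derive1 f s) t = derive1 (fun s => weight a s * derive1 g s) t.
  move=> fg; apply: (@derive1_eq_Iaa _ a) => // s s1 s2.
  by rewrite (derive1_eq_Iaa (a := a) fg).
apply/complex_eqP; split; rewrite ?Re_prolate ?Im_prolate (E t u1 u2).
  by rewrite (W (re x) (re z))// => s s1 s2; rewrite E.
by rewrite (W (im x) (im z))// => s s1 s2; rewrite E.
Qed.
End ComplexBridge.

(** * Boundary data in C^2 and the complex Green formula *)

Section BoundaryData.
Context {R : realType} (a : R) (a_gt0 : 0 < a).
Implicit Types (x y z w f g h k : R -> R[i]) (s t c d : R) (be ga : 'cV[R[i]]_2).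
Notation mu := (@lebesgue_measure R).

Definition complex_boundary_values x (bl cl br cr : R[i]) : Prop :=
  boundary_values a (re x) (complex.Re bl) (complex.Re cl) (complex.Re br) (complex.Re cr) /\
  boundary_values a (im x) (complex.Im bl) (complex.Im cl) (complex.Im br) (complex.Im cr).

Lemma complex_eta (z : R[i]) : z = (complex.Re z +i* complex.Im z)%C.
Proof. by case: z. Qed.

Lemma complex_boundary_lim x bl cl br cr : complex_boundary_values x bl cl br cr ->
  [/\ b_left a x = bl, c_left a x = cl, b_right a x = br & c_right a x = cr].
Proof.
have E (F : set_system R) (f g : R -> R) (l : R) : f =1 g -> f t @[t --> F] --> l ->
  g t @[t --> F] --> l by move=> /funext ->.
move=> [[r1 r2 r3 r4] [i1 i2 i3 i4]]; split; rewrite [RHS]complex_eta; apply: cvg_complex;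
  [apply: E r1|apply: E i1|apply: E r2|apply: E i2|apply: E r3|apply: E i3|apply: E r4|apply: E i4];
  by move=> t; rewrite !complexE /= mul0r ?subr0 ?addr0.
Qed.

(* The boundary conditions read [ga = - U *m be] in these coordinates, in which
   the boundary form of Green's formula is [<be, be'> - <ga, ga'>]. *)
Definition boundary_data x be ga : Prop := exists bl cl br cr,
  complex_boundary_values x bl cl br cr /\
  [/\ be 0 0 = bl + 'i%C * cl, ga 0 0 = bl - 'i%C * cl,
      be 1 0 = br + 'i%C * cr & ga 1 0 = br - 'i%C * cr].

Definition hdot (u v : 'cV[R[i]]_2) : R[i] :=
  u 0 0 * ((v 0 0)^*)%C + u 1 0 * ((v 1 0)^*)%C.

Lemma cV2_eq (u v : 'cV[R[i]]_2) : u 0 0 = v 0 0 -> u 1 0 = v 1 0 -> u = v.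
Proof.
move=> h0 h1; apply/matrixP => i j; rewrite !ord1.
case: i => [[|[|//]] Hi].
  by rewrite (_ : Ordinal Hi = 0)//; exact: val_inj.
by rewrite (_ : Ordinal Hi = 1)//; exact: val_inj.
Qed.

Lemma boundary_data_exists x y : cmax a x y -> exists be ga, boundary_data x be ga.
Proof.
move=> [[q r1] [q' r2]].
have [bl [cl [br [cr B1]]]] := rmax_boundary a_gt0 r1.
have [bl' [cl' [br' [cr' B2]]]] := rmax_boundary a_gt0 r2.
pose b1 := (bl +i* bl')%C; pose c1 := (cl +i* cl')%C.
pose b2 := (br +i* br')%C; pose c2 := (cr +i* cr')%C.
exists (\col_i (if i == 0 then b1 + 'i%C * c1 else b2 + 'i%C * c2)).
exists (\col_i (if i == 0 then b1 - 'i%C * c1 else b2 - 'i%C * c2)).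
by exists b1, c1, b2, c2; split; [split|rewrite !mxE].
Qed.

Lemma boundary_data_unique x be ga be' ga' : boundary_data x be ga ->
  boundary_data x be' ga' -> be = be' /\ ga = ga'.
Proof.
move=> [bl [cl [br [cr [[B1 B2] [E1 E2 E3 E4]]]]]] [bl' [cl' [br' [cr' [[B1' B2'] [E1' E2' E3' E4']]]]]].
have [h1 h2 h3 h4] := boundary_unique B1 B1'; have [k1 k2 k3 k4] := boundary_unique B2 B2'.
have X1 : bl = bl' by apply/complex_eqP.
have X2 : cl = cl' by apply/complex_eqP.
have X3 : br = br' by apply/complex_eqP.
have X4 : cr = cr' by apply/complex_eqP.
by split; apply: cV2_eq; rewrite ?(E1, E2, E3, E4) ?(E1', E2', E3', E4') ?X1 ?X2 ?X3 ?X4.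
Qed.

Lemma boundary_data_ext x z be ga : (forall t, - a < t -> t < a -> x t = z t) ->
  boundary_data x be ga -> boundary_data z be ga.
Proof.
move=> xz [bl [cl [br [cr [[B1 B2] E]]]]]; exists bl, cl, br, cr; split => //; split.
  by apply: (boundary_ext a_gt0 _ B1) => t h1 h2; rewrite xz.
by apply: (boundary_ext a_gt0 _ B2) => t h1 h2; rewrite xz.
Qed.

(** At each end [b + i c] and [b - i c] are solved for [b] and [c], whose real and imaginary parts
    are then realised separately. *)
Lemma boundary_data_surjective be ga : exists x y, cmax a x y /\ boundary_data x be ga.
Proof.
pose bl := (be 0 0 + ga 0 0) / 2; pose cl := - 'i%C * (be 0 0 - ga 0 0) / 2.
pose br := (be 1 0 + ga 1 0) / 2; pose cr := - 'i%C * (be 1 0 - ga 1 0) / 2.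
have [x1 [q1 [y1 [r1 B1]]]] := boundary_surjective a_gt0 (complex.Re bl) (complex.Re cl)
  (complex.Re br) (complex.Re cr).
have [x2 [q2 [y2 [r2 B2]]]] := boundary_surjective a_gt0 (complex.Im bl) (complex.Im cl)
  (complex.Im br) (complex.Im cr).
exists (fun t => x1 t +i* x2 t)%C, (fun t => y1 t +i* y2 t)%C; split.
  by split; [exists q1|exists q2].
have i2 : 'i%C * 'i%C = -1 :> R[i] by apply/complex_eqP; rewrite !complexE /=; split; ring.
have ic (u v : R[i]) : 'i%C * (- 'i%C * (u - v) / 2) = (u - v) / 2.
  by rewrite !mulrA mulrN i2 opprK mul1r.
exists bl, cl, br, cr; split; first by [].
by rewrite /bl /cl /br /cr !ic; split; field.
Qed.

Lemma boundary_values_eq (x z : R -> R) (bl cl br cr bl' cl' br' cr' : R) : x = z ->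
  bl = bl' -> cl = cl' -> br = br' -> cr = cr' ->
  boundary_values a x bl cl br cr -> boundary_values a z bl' cl' br' cr'.
Proof. by move=> -> -> -> -> ->. Qed.

Lemma boundary_data_lin (b : R[i]) x y z w be ga be' ga' : cmax a x y -> cmax a z w ->
  boundary_data x be ga -> boundary_data z be' ga' ->
  boundary_data (fun t => b * x t + z t) (b *: be + be') (b *: ga + ga').
Proof.
move=> [[q1 x1] [q2 x2]] [[r1 z1] [r2 z2]].
move=> [bl [cl [br [cr [[B1 B2] [E1 E2 E3 E4]]]]]] [bl' [cl' [br' [cr' [[B1' B2'] [E1' E2' E3' E4']]]]]].
exists (b * bl + bl'), (b * cl + cl'), (b * br + br'), (b * cr + cr'); split; last first.
  by split; rewrite !mxE ?E1 ?E2 ?E3 ?E4 ?E1' ?E2' ?E3' ?E4'; ring.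
split.
  have := boundary_lin a_gt0 (complex.Re b) x1 (rmax_lin (- complex.Im b) x2 z1) B1
    (boundary_lin a_gt0 (- complex.Im b) x2 z1 B2 B1').
  by apply: boundary_values_eq; first (apply/funext => t); rewrite !complexE; ring.
have := boundary_lin a_gt0 (complex.Re b) x2 (rmax_lin (complex.Im b) x1 z2) B2
  (boundary_lin a_gt0 (complex.Im b) x1 z2 B1 B2').
by apply: boundary_values_eq; first (apply/funext => t); rewrite !complexE; ring.
Qed.

(** The algebra behind the complex Green formula. [Xi] and [Yi] stand for the real integrals of
    [dotL2E], and the hypotheses are the real formulas for the parts of the two functions: Re with
    Re, Im with Im, Im with Re, Re with Im. *)
Lemma boundary_form (bl cl br cr bl' cl' br' cr' : R[i]) (X1 X2 X3 X4 Y1 Y2 Y3 Y4 : R) :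
  let form (cl bl br cr cl' bl' br' cr' : R) := 2 * (cl * bl' - bl * cl' + (cr * br' - br * cr')) in
  let r := @complex.Re R in let j := @complex.Im R in
  a * (X1 - Y1) = form (r cl) (r bl) (r br) (r cr) (r cl') (r bl') (r br') (r cr') ->
  a * (X2 - Y2) = form (j cl) (j bl) (j br) (j cr) (j cl') (j bl') (j br') (j cr') ->
  a * (X3 - Y3) = form (j cl) (j bl) (j br) (j cr) (r cl') (r bl') (r br') (r cr') ->
  a * (X4 - Y4) = form (r cl) (r bl) (r br) (r cr) (j cl') (j bl') (j br') (j cr') ->
  a%:C%C * 'i%C * (((X1 + X2) +i* (X3 - X4))%C - ((Y1 + Y2) +i* (Y3 - Y4))%C) =
  (bl + 'i%C * cl) * ((bl' + 'i%C * cl')^*)%C + (br + 'i%C * cr) * ((br' + 'i%C * cr')^*)%C -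
  ((bl - 'i%C * cl) * ((bl' - 'i%C * cl')^*)%C + (br - 'i%C * cr) * ((br' - 'i%C * cr')^*)%C).
Proof.
case: bl cl br cr bl' cl' br' cr' => ? ? [? ?] [? ?] [? ?] [? ?] [? ?] [? ?] [? ?] /=.
by move=> G1 G2 G3 G4; apply/complex_eqP => /=; split; lra.
Qed.

Lemma complex_green x y z w be ga be' ga' : cmax a x y -> cmax a z w ->
  boundary_data x be ga -> boundary_data z be' ga' ->
  a%:C%C * 'i%C * (dotL2 a y z - dotL2 a x w) = hdot be be' - hdot ga ga'.
Proof.
move=> xy zw; have [x2 y2] := cmax_inL2 xy; have [z2 w2] := cmax_inL2 zw.
rewrite !dotL2E//; move: xy zw => [[q1 m1] [q2 m2]] [[r1 n1] [r2 n2]].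
move=> [bl [cl [br [cr [[B1 B2] [E1 E2 E3 E4]]]]]] [bl' [cl' [br' [cr' [[B1' B2'] [E1' E2' E3' E4']]]]]].
have a0 : a != 0 by rewrite gt_eqF.
have aK (u v : R) : u = 2 / a * v -> a * u = 2 * v by move=> ->; field.
rewrite /hdot E1 E2 E3 E4 E1' E2' E3' E4'; apply: boundary_form; apply: aK.
- have H := rmax_green a_gt0 m1 n1 B1 B1'; exact: H.
- have H := rmax_green a_gt0 m2 n2 B2 B2'; exact: H.
- have H := rmax_green a_gt0 m2 n1 B2 B1'; exact: H.
- have H := rmax_green a_gt0 m1 n2 B1 B2'; exact: H.
Qed.

Lemma complex_greenP x y z w be ga be' ga' : cmax a x y -> cmax a z w ->
  boundary_data x be ga -> boundary_data z be' ga' ->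
  dotL2 a y z = dotL2 a x w <-> hdot be be' = hdot ga ga'.
Proof.
move=> xy zw B B'; have G := complex_green xy zw B B'.
have ai0 : a%:C%C * 'i%C != 0 :> R[i].
  by rewrite mulf_neq0//; apply/eqP => /complex_eqP/= []; move: a_gt0; lra.
split => [E|E]; first by apply/eqP; rewrite -subr_eq0 -G E subrr mulr0.
by apply/eqP; rewrite -subr_eq0; move/eqP: G; rewrite E subrr mulf_eq0 (negbTE ai0).
Qed.

(** Regrouping suffices: [(1 + u) b - i (1 - u) c] equals [(b - i c) + u (b + i c)], and the
    off-diagonal terms are already multiples of [b + i c] at the other end. *)
Lemma boundary_conditionsP (U : 'M[R[i]]_2) x be ga : boundary_data x be ga ->
  boundary_conditions a U x <-> ga = - (U *m be).
Proof.
move=> [bl [cl [br [cr [B [E1 E2 E3 E4]]]]]]; have [L1 L2 L3 L4] := complex_boundary_lim B.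
rewrite /boundary_conditions L1 L2 L3 L4.
have mE (i : 'I_2) : (U *m be) i 0 = U i 0 * be 0 0 + U i 1 * be 1 0.
  rewrite mxE !big_ord_recl big_ord0 addr0.
  by rewrite (_ : lift ord0 ord0 = 1)//; exact: val_inj.
have H0 : (1 + U 0 0) * bl - 'i%C * (1 - U 0 0) * cl + U 0 1 * br + 'i%C * U 0 1 * cr =
    ga 0 0 + (U *m be) 0 0 by rewrite mE E1 E2 E3; ring.
have H1 : U 1 0 * bl + 'i%C * U 1 0 * cl + (1 + U 1 1) * br - 'i%C * (1 - U 1 1) * cr =
    ga 1 0 + (U *m be) 1 0 by rewrite mE E1 E3 E4; ring.
rewrite H0 H1; split => [[/eqP + /eqP]|->]; last by rewrite !mxE !addNr.
by rewrite !addr_eq0 => /eqP K0 /eqP K1; apply: cV2_eq; rewrite mxE.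
Qed.

(** The condition on [F] fits both ends: [F] eventually enters every open set that contains all
    points outside (-a, a). The complement of the compact support is such a set; [x] vanishes on its
    part in the interval, and being zero near a point kills the derivatives too. *)
Lemma vanishing_end (F : set_system R) (FF : ProperFilter F) x : classA0 a x ->
  (\forall t \near F, Iaa a t) -> (forall O : set R, open O -> (forall t, ~ O t -> Iaa a t) ->
    \forall t \near F, O t) ->
  \forall t \near F, x t = 0 /\ (derive1 (re x) t = 0 /\ derive1 (im x) t = 0).
Proof.
move=> [_ cK] FI FO; pose K := Iaa a `&` closure [set t | Iaa a t /\ x t != 0].
have oK : open (~` K) by apply: closed_openC; apply: compact_closed => //; exact: norm_hausdorff.
have x0 t : Iaa a t -> ~ K t -> x t = 0.
  move=> It nK; apply/eqP/negPn/negP => n0; apply: nK; split => //.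
  by apply: subset_closure.
have oI : open (Iaa a) by exact: interval_open.
have FK : \forall t \near F, (~` K) t.
  by apply: FO => // t /contrapT[].
apply: filterS2 FI FK => t It nK; split; first exact: x0.
have near0 : \forall s \near t, 0 = x s.
  have h1 : \forall s \near t, Iaa a s by exact: open_nbhs_nbhs.
  have h2 : \forall s \near t, (~` K) s by exact: open_nbhs_nbhs.
  by apply: filterS2 h1 h2 => s Is nKs; rewrite x0.
have d0 : is_derive t 1 (cst 0 : R -> R) 0 by exact: is_derive_cst.
split; rewrite derive1E.
  have D : is_derive t 1 (re x) 0.
    by apply: near_is_derive d0; apply: filterS near0 => s <-.
  by rewrite (@derive_val _ _ _ _ _ _ _ D).
have D : is_derive t 1 (im x) 0.
  by apply: near_is_derive d0; apply: filterS near0 => s <-.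
by rewrite (@derive_val _ _ _ _ _ _ _ D).
Qed.

Lemma classA0_boundary_data x : classA0 a x -> boundary_data x 0 0.
Proof.
move=> x0; have aI : ~ Iaa a a by rewrite /Iaa /= in_itv /= ltxx andbF.
have aI' : ~ Iaa a (- a) by rewrite /Iaa /= in_itv /= ltxx.
have I_left : \forall t \near (- a)^'+, Iaa a t.
  by apply: (near_left_end a_gt0) => t h1 h2; rewrite /Iaa /= in_itv /= h1.
have I_right : \forall t \near a^'-, Iaa a t.
  by apply: (near_right_end a_gt0) => t h1 h2; rewrite /Iaa /= in_itv /= h1.
have Vl : \forall t \near (- a)^'+, x t = 0 /\ (derive1 (re x) t = 0 /\ derive1 (im x) t = 0).
  apply: vanishing_end => // O oO IO.
  have Oa : O (- a) by apply: contrapT => /IO.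
  by apply: cvg_within; exact: open_nbhs_nbhs.
have Vr : \forall t \near a^'-, x t = 0 /\ (derive1 (re x) t = 0 /\ derive1 (im x) t = 0).
  apply: vanishing_end => // O oO IO.
  have Oa : O a by apply: contrapT => /IO.
  by apply: cvg_within; exact: open_nbhs_nbhs.
exists 0, 0, 0, 0; split; last by rewrite !mxE mulr0 addr0 subr0.
split; split; apply: cvg_near_cst;
  [apply: filterS Vl|apply: filterS Vl|apply: filterS Vr|apply: filterS Vr
  |apply: filterS Vl|apply: filterS Vl|apply: filterS Vr|apply: filterS Vr];
  by move=> t [xt [rt it]]; rewrite ?rt ?it ?xt mulr0 ?subr0.
Qed.

Lemma supported_classA0 x y : cmax a x y -> supported_in a (re x) -> supported_in a (im x) ->
  classA0 a x.
Proof.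
move=> xy [d1 [d10 d1a x1]] [d2 [d20 d2a x2]]; have [Ax _ _] := cmax_Dmax a_gt0 xy.
split; first exact: Ax.
pose d := Num.max d1 d2; have da : d < a by rewrite gt_max d1a.
set S := [set t | _].
have Sd : S `<=` `[- d, d]%classic.
  move=> t [It n0]; have /andP[h1 h2] : - a < t < a by move: It; rewrite /Iaa /= in_itv.
  rewrite /= in_itv/=; apply: contraPT n0 => H; apply/negP; rewrite negbK; apply/eqP.
  have td : t <= - d \/ d <= t.
    move: H; rewrite negb_and -!ltNge => /orP[/ltW ?|/ltW ?]; [left|right] => //.
  have [dd1 dd2] : d1 <= d /\ d2 <= d by rewrite !le_max !lexx orbT.
  apply/complex_eqP; split; [apply: x1|apply: x2] => //; case: td => ?; [left|right|left|right]; lra.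
have cSd : closure S `<=` `[- d, d]%classic.
  have cl : closed `[- d, d]%classic by exact: interval_closed.
  by rewrite [X in _ `<=` X](closure_id _).1//; exact: closureS.
have -> : Iaa a `&` closure S = closure S.
  apply/setIidPr => t /cSd; rewrite /Iaa /= !in_itv/= => /andP[? ?].
  by apply/andP; split; lra.
apply: subclosed_compact cSd; [exact: closed_closure|exact: segment_compact].
Qed.
End BoundaryData.

(** * Pairings under limits, complex weak solutions and density *)

Section L2Limits.
Context {R : realType} (a : R) (a_gt0 : 0 < a).
Implicit Types (x y z w f g h k u : R -> R[i]) (s t c d : R).
Notation mu := (@lebesgue_measure R).
Notation sqnorm f := (\int[mu]_(t in Iaa a) (Normc.normc (f t) ^+ 2)).

Lemma integrable_sqnorm f : inL2 a f ->
  mu.-integrable (Iaa a) (EFin \o (fun t => Normc.normc (f t) ^+ 2)).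
Proof.
move=> /inL2P[[_ i1] [_ i2]]; have mI := measurable_Iaa a.
move: (integrable_lin 1 mI i1 i2); apply: eq_integrable => // t _ /=.
by rewrite mul1r sqr_normc.
Qed.

Lemma sqnormE f : inL2 a f -> sqnorm f =
  \int[mu]_(t in Iaa a) complex.Re (f t) ^+ 2 + \int[mu]_(t in Iaa a) complex.Im (f t) ^+ 2.
Proof.
move=> /inL2P[[_ i1] [_ i2]]; have mI := measurable_Iaa a.
have := Rintegral_lin 1 mI i1 i2; rewrite mul1r => <-.
by apply: eq_Rintegral => t _; rewrite mul1r sqr_normc.
Qed.

Lemma sqnorm_ge0 f : 0 <= sqnorm f.
Proof. by apply: Rintegral_ge0 => t _; exact: sqr_ge0. Qed.

Lemma normL2_lt f (e : R) : 0 < e -> (normL2 a f < e) = (sqnorm f < e ^+ 2).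
Proof.
move=> e0; rewrite /normL2 -[X in _ < X]ger0_norm ?(ltW e0)// -sqrtr_sqr ltr_sqrt//.
exact: exprn_gt0.
Qed.

Lemma inL2_sub f g : inL2 a f -> inL2 a g -> inL2 a (fun t => f t - g t).
Proof.
move=> f2 g2; have := inL2_lin (-1) g2 f2.
by rewrite (_ : (fun t => _) = (fun t => f t - g t))//; apply/funext => t; ring.
Qed.

Lemma dotL2_sub f g h : inL2 a f -> inL2 a g -> inL2 a h ->
  dotL2 a f (fun t => g t - h t) = dotL2 a f g - dotL2 a f h.
Proof.
move=> f2 g2 h2; rewrite !dotL2E//; last exact: inL2_sub.
move: f2 g2 h2 => /inL2P[f1 f2] /inL2P[g1 g2] /inL2P[h1 h2]; have mI := measurable_Iaa a.
have E (p q r : R -> R) : rL2 a p -> rL2 a q -> rL2 a r ->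
    \int[mu]_(t in Iaa a) (p t * (q t - r t)) =
    \int[mu]_(t in Iaa a) (p t * q t) - \int[mu]_(t in Iaa a) (p t * r t).
  move=> p2 q2 r2; have := Rintegral_lin (-1) mI (rL2_mul p2 r2) (rL2_mul p2 q2).
  by rewrite mulN1r addrC => <-; apply: eq_Rintegral => t _; ring.
have E' (P Q : R[i] -> R) : (forall u v : R[i], Q (u - v) = Q u - Q v) ->
    rL2 a (fun t => P (f t)) -> rL2 a (fun t => Q (g t)) -> rL2 a (fun t => Q (h t)) ->
    \int[mu]_(t in Iaa a) (P (f t) * Q (g t - h t)) =
    \int[mu]_(t in Iaa a) (P (f t) * Q (g t)) - \int[mu]_(t in Iaa a) (P (f t) * Q (h t)).
  by move=> QB p2 q2 r2; rewrite -E//; apply: eq_Rintegral => t _; rewrite QB.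
have RB (u v : R[i]) : complex.Re (u - v) = complex.Re u - complex.Re v :> R by rewrite !complexE.
have IB (u v : R[i]) : complex.Im (u - v) = complex.Im u - complex.Im v :> R by rewrite !complexE.
pose r := @complex.Re R; pose j := @complex.Im R.
rewrite (E' r r RB f1 g1 h1) (E' j r RB f2 g1 h1) (E' r j IB f1 g2 h2) (E' j j IB f2 g2 h2).
by apply/complex_eqP; split => /=; ring.
Qed.

Lemma dotL2_ae f f' g g' : inL2 a f -> inL2 a f' -> inL2 a g -> inL2 a g' ->
  eqL2 a f f' -> eqL2 a g g' -> dotL2 a f g = dotL2 a f' g'.
Proof.
move=> f2 f2' g2 g2' ff gg; rewrite !dotL2E//; have mI := measurable_Iaa a.
move: f2 f2' g2 g2' => /inL2P[[? _] [? _]] /inL2P[[? _] [? _]] /inL2P[[? _] [? _]] /inL2P[[? _] [? _]].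
have E (P Q : R[i] -> R) : measurable_fun (Iaa a) (fun t => P (f t)) ->
    measurable_fun (Iaa a) (fun t => P (f' t)) -> measurable_fun (Iaa a) (fun t => Q (g t)) ->
    measurable_fun (Iaa a) (fun t => Q (g' t)) ->
    \int[mu]_(t in Iaa a) (P (f t) * Q (g t)) = \int[mu]_(t in Iaa a) (P (f' t) * Q (g' t)).
  move=> *; apply: ae_eq_Rintegral => //; try exact: measurable_funM.
  by apply: aeS (aeI ff gg) => t [h1 h2] It; rewrite h1// h2.
by rewrite !(E (@complex.Re R)) ?(E (@complex.Im R))// (E (@complex.Re R) (@complex.Im R)).
Qed.

Lemma eqL2_sym f g : eqL2 a f g -> eqL2 a g f.
Proof. by apply: aeS => t fg /fg ->. Qed.

Lemma eqL2_trans f g h : eqL2 a f g -> eqL2 a g h -> eqL2 a f h.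
Proof. by move=> fg gh; apply: aeS (aeI fg gh) => t [h1 h2] It; rewrite h1// h2. Qed.

(** A weighted substitute for the Cauchy-Schwarz inequality: expanding the square of [dl |f| - |u|]
    bounds [|f| |u|] pointwise. *)
Lemma dotL2_bound f u (dl : R) : inL2 a f -> inL2 a u -> 0 < dl ->
  `|complex.Re (dotL2 a f u)| <= dl / 2 * sqnorm f + (2 * dl)^-1 * sqnorm u /\
  `|complex.Im (dotL2 a f u)| <= dl / 2 * sqnorm f + (2 * dl)^-1 * sqnorm u.
Proof.
move=> f2 u2 dl0; have mI := measurable_Iaa a.
have i0 : mu.-integrable (Iaa a) (EFin \o (fun=> 0)) by exact: integrable0.
have iu := integrable_lin (2 * dl)^-1 mI (integrable_sqnorm u2) i0.
have ifu := integrable_lin (dl / 2) mI (integrable_sqnorm f2) iu.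
have Z : \int[mu]_(t in Iaa a) (0 : R) = 0 by rewrite Rintegral_cst ?mul0r//; exact: measurable_Iaa.
have EB : \int[mu]_(t in Iaa a) (dl / 2 * Normc.normc (f t) ^+ 2 +
    ((2 * dl)^-1 * Normc.normc (u t) ^+ 2 + 0)) = dl / 2 * sqnorm f + (2 * dl)^-1 * sqnorm u.
  have := Rintegral_lin (dl / 2) mI (integrable_sqnorm f2) iu.
  by rewrite (Rintegral_lin (2 * dl)^-1 mI (integrable_sqnorm u2) i0) Z addr0.
have K (F : R -> R) : mu.-integrable (Iaa a) (EFin \o F) ->
    (forall t, `|F t| <= Normc.normc (f t) * Normc.normc (u t)) ->
    `|\int[mu]_(t in Iaa a) F t| <= dl / 2 * sqnorm f + (2 * dl)^-1 * sqnorm u.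
  move=> iF FB; rewrite -EB; apply: (le_trans (le_normr_Rintegral _ iF)) => //.
  apply: le_Rintegral => //; first exact: (@integrable_norm _ _ _ mu (Iaa a) F).
  move=> t _; apply: (le_trans (FB t)); rewrite addr0.
  set p := Normc.normc (f t); set r := Normc.normc (u t).
  rewrite -subr_ge0 (_ : _ - _ = (2 * dl)^-1 * (dl * p - r) ^+ 2).
    by rewrite mulr_ge0 ?sqr_ge0// invr_ge0 mulr_ge0// ltW.
  by field; rewrite gt_eqF.
have nM t : Normc.normc (f t * ((u t)^*)%C) = Normc.normc (f t) * Normc.normc (u t).
  by rewrite Normc.normcM; congr (_ * _); case: (u t) => ? ?; rewrite /= sqrrN.
move: (f2) (u2) => /inL2P[f1 f2'] /inL2P[u1 u2'].
split; apply: K; try by move=> t; rewrite -nM; first [exact: normr_Re_le|exact: normr_Im_le].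
  move: (integrable_lin 1 mI (rL2_mul f1 u1) (rL2_mul f2' u2')).
  by apply: eq_integrable => // t _ /=; congr EFin; rewrite !complexE; ring.
move: (integrable_lin (-1) mI (rL2_mul f1 u2') (rL2_mul f2' u1)).
by apply: eq_integrable => // t _ /=; congr EFin; rewrite !complexE; ring.
Qed.

(** The pairing is continuous for the graph norm: with [dl = e] and errors of norm below [e], both
    terms of [dotL2_bound] are of order [e]. *)
Lemma dotL2_closure f g h k : inL2 a f -> inL2 a g -> inL2 a h -> inL2 a k ->
  (forall e : R, 0 < e -> exists h' k', [/\ inL2 a h', inL2 a k',
     dotL2 a g h' = dotL2 a f k', normL2 a (fun t => h t - h' t) < e &
     normL2 a (fun t => k t - k' t) < e]) ->
  dotL2 a g h = dotL2 a f k.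
Proof.
(* The summand 1 collects the two contributions [e / 2] and makes [N] positive. *)
move=> f2 g2 h2 k2 H; have [N NE] : exists N, N = 1 + (sqnorm g + sqnorm f) by eexists.
have N0 : 0 < N by rewrite NE ltr_pwDl// addr_ge0// sqnorm_ge0.
have small (e : R) : 0 < e ->
    `|complex.Re (dotL2 a g h - dotL2 a f k)| <= e * N /\
    `|complex.Im (dotL2 a g h - dotL2 a f k)| <= e * N.
  move=> e0; have [h' [k' [h2' k2' E n1 n2]]] := H e e0.
  have -> : dotL2 a g h - dotL2 a f k =
      dotL2 a g (fun t => h t - h' t) - dotL2 a f (fun t => k t - k' t).
    by rewrite !dotL2_sub// E; ring.
  have B (p u : R -> R[i]) : inL2 a p -> inL2 a u -> normL2 a u < e ->
      `|complex.Re (dotL2 a p u)| <= e / 2 * sqnorm p + e / 2 /\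
      `|complex.Im (dotL2 a p u)| <= e / 2 * sqnorm p + e / 2.
    move=> p2 u2; rewrite normL2_lt// => ue; have [b1 b2] := dotL2_bound p2 u2 e0.
    have K : (2 * e)^-1 * sqnorm u <= e / 2.
      rewrite (_ : e / 2 = (2 * e)^-1 * e ^+ 2); last by field; rewrite gt_eqF.
      by rewrite ler_wpM2l ?ltW// invr_gt0 mulr_gt0.
    by split; [apply: (le_trans b1)|apply: (le_trans b2)]; rewrite lerD2l.
  have [b1 b2] := B _ _ g2 (inL2_sub h2 h2') n1; have [b3 b4] := B _ _ f2 (inL2_sub k2 k2') n2.
  have eg : 0 <= e * sqnorm g by rewrite mulr_ge0 ?sqnorm_ge0// ltW.
  have ef : 0 <= e * sqnorm f by rewrite mulr_ge0 ?sqnorm_ge0// ltW.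
  rewrite !complexE NE; split; apply: (le_trans (ler_normB _ _)).
    by move: b1 b3 eg ef; lra.
  by move: b2 b4 eg ef; lra.
have zero (r : R) : (forall e : R, 0 < e -> `|r| <= e * N) -> r = 0.
  move=> Hr; apply/eqP; rewrite -normr_le0 leNgt; apply/negP => r0.
  have := Hr (`|r| / (2 * N)) _; rewrite (_ : `|r| / (2 * N) * N = `|r| / 2).
    have e0 : 0 < `|r| / (2 * N) by rewrite divr_gt0// mulr_gt0.
    by move=> /(_ e0); lra.
  by field; rewrite gt_eqF.
apply/eqP; rewrite -subr_eq0; apply/eqP/complex_eqP; split; apply: zero => e e0.
  by have [] := small e e0.
by have [] := small e e0.
Qed.

Lemma rmax0 : rmax a (fun=> 0) (fun=> 0) (fun=> 0).
Proof.
have := sol_rmax a_gt0 (rL2_cst a 0) (rL2_cst a 0) (sol_cst a 0).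
by apply: rmax_eq => //; apply/funext => t; ring.
Qed.

(** Tests with real-valued [x] are enough: their pairing with [h] splits into parts, which leaves
    one real weak equation for each part. *)
Lemma cmax_weak h k : inL2 a h -> inL2 a k ->
  (forall x y, cmax a x y -> classA0 a x -> dotL2 a y h = dotL2 a x k) ->
  exists z, cmax a z k /\ eqL2 a h z.
Proof.
move=> h2 k2 W; move: (h2) (k2) => /inL2P[h1 h2'] /inL2P[k1 k2'].
have Z (f : R -> R) : \int[mu]_(t in Iaa a) (0 * f t) = 0 :> R.
  rewrite (_ : \int[mu]_(t in Iaa a) (0 * f t) = \int[mu]_(t in Iaa a) 0); last first.
    by apply: eq_Rintegral => t _; rewrite mul0r.
  by rewrite Rintegral_cst ?mul0r//; exact: measurable_Iaa.
have a2 : 0 < a / 2 by rewrite divr_gt0.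
have T (x q y : R -> R) : rmax a x q y -> supported_in a x ->
    \int[mu]_(t in Iaa a) (y t * complex.Re (h t)) = \int[mu]_(t in Iaa a) (x t * complex.Re (k t)) /\
    \int[mu]_(t in Iaa a) (y t * complex.Im (h t)) = \int[mu]_(t in Iaa a) (x t * complex.Im (k t)).
  move=> xy sx.
  have c : cmax a (fun t => (x t)%:C%C) (fun t => (y t)%:C%C).
    by split; [exists q; exact: xy|eexists; exact: rmax0].
  have s0 : supported_in a (im (fun t => (x t)%:C%C)) by exists (a / 2); split => //; lra.
  have [x2 y2] := cmax_inL2 c.
  have /complex_eqP[] := W _ _ c (supported_classA0 a_gt0 c sx s0).
  rewrite !dotL2E//= !Z !addr0 !sub0r => e1 e2; split; first exact: e1.
  exact: oppr_inj.
have [z1 [q1 [r1 E1]]] := weak_rmax a_gt0 h1 k1 (fun (x q y : R -> R) xy sx => (T x q y xy sx).1).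
have [z2 [q2 [r2 E2]]] := weak_rmax a_gt0 h2' k2' (fun (x q y : R -> R) xy sx => (T x q y xy sx).2).
exists (fun t => z1 t +i* z2 t)%C; split; first by split; [exists q1|exists q2].
apply: aeS (aeI E1 E2) => t [e1 e2] It; apply/complex_eqP => /=.
by split; [exact: e1|exact: e2].
Qed.

Lemma cmax_dense f (e : R) : inL2 a f -> 0 < e -> exists x y,
  [/\ cmax a x y, classA0 a x & normL2 a (fun t => f t - x t) < e].
Proof.
move=> f2 e0; move: (f2) => /inL2P[f1 f2']; have e2 : 0 < e ^+ 2 / 2 by rewrite divr_gt0 ?exprn_gt0.
have [x1 [q1 [y1 [r1 s1 n1]]]] := rmax_dense a_gt0 f1 e2.
have [x2 [q2 [y2 [r2 s2 n2]]]] := rmax_dense a_gt0 f2' e2.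
have c : cmax a (fun t => x1 t +i* x2 t)%C (fun t => y1 t +i* y2 t)%C.
  by split; [exists q1|exists q2].
exists (fun t => x1 t +i* x2 t)%C, (fun t => y1 t +i* y2 t)%C; split; first exact: c.
  exact: (supported_classA0 a_gt0 c).
have [x2' _] := cmax_inL2 c.
rewrite normL2_lt// sqnormE; last exact: inL2_sub.
rewrite (_ : \int[mu]_(t in Iaa a) complex.Re _ ^+ 2 = \int[mu]_(t in Iaa a) (complex.Re (f t) - x1 t) ^+ 2).
  rewrite (_ : \int[mu]_(t in Iaa a) complex.Im _ ^+ 2 = \int[mu]_(t in Iaa a) (complex.Im (f t) - x2 t) ^+ 2).
    lra.
  by apply: eq_Rintegral => t _; rewrite !complexE.
by apply: eq_Rintegral => t _; rewrite !complexE.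
Qed.
End L2Limits.

(** * Linear algebra in the plane C^2 *)

Section HermitianPlane.
Context {R : realType}.
Implicit Types (u v w : 'cV[R[i]]_2) (U : 'M[R[i]]_2).
Local Open Scope sesquilinear_scope.

Lemma sum_I2 (F : 'I_2 -> R[i]) : \sum_i F i = F 0 + F 1.
Proof.
rewrite !big_ord_recl big_ord0 addr0; congr (_ + F _).
exact: val_inj.
Qed.

Lemma hdotE u v : hdot u v = (v ^t* *m u) 0 0.
Proof. by rewrite mxE sum_I2 !mxE /hdot mulrC [X in _ + X]mulrC. Qed.

Lemma hdotDl u v w : hdot (u + v) w = hdot u w + hdot v w.
Proof. by rewrite !hdotE mulmxDr mxE. Qed.

Lemma hdotNl u w : hdot (- u) w = - hdot u w.
Proof. by rewrite !hdotE mulmxN mxE. Qed.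

Lemma hdotC u v : hdot v u = ((hdot u v)^*)%C.
Proof. by rewrite /hdot rmorphD !rmorphM /= !conjcK ![(_^*)%C * _]mulrC. Qed.

Lemma hdotNr u w : hdot u (- w) = - hdot u w.
Proof. by rewrite hdotC hdotNl rmorphN /= -hdotC. Qed.

Lemma hdotDr u v w : hdot w (u + v) = hdot w u + hdot w v.
Proof. by rewrite hdotC hdotDl rmorphD /= -!hdotC. Qed.

Lemma hdot0l w : hdot 0 w = 0.
Proof. by rewrite hdotE mulmx0 mxE. Qed.

Lemma hdot0r w : hdot w 0 = 0.
Proof. by rewrite hdotC hdot0l rmorph0. Qed.

Lemma hdot_eq0 u : hdot u u = 0 -> u = 0.
Proof.
rewrite /hdot => /complex_eqP/=[+ _]; rewrite !complexE => E.
have h (z : R[i]) : complex.Re z * complex.Re z - complex.Im z * - complex.Im z =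
    complex.Re z ^+ 2 + complex.Im z ^+ 2 by ring.
move: E; rewrite !h => E.
have s (z : R[i]) : 0 <= complex.Re z ^+ 2 /\ 0 <= complex.Im z ^+ 2 by split; exact: sqr_ge0.
have [a1 a2] := s (u 0 0); have [a3 a4] := s (u 1 0).
have z0 (r : R) : r ^+ 2 = 0 -> r = 0 by move/eqP; rewrite sqrf_eq0 => /eqP.
by apply: cV2_eq; rewrite mxE; apply/complex_eqP; split; apply: z0; lra.
Qed.

Lemma hdot_unitary U u v : U \is unitarymx -> hdot (U *m u) (U *m v) = hdot u v.
Proof.
move=> /unitarymxP /mulmx1C uU; rewrite !hdotE trmx_mul map_mxM /=.
by rewrite mulmxA -[_ *m U^t* *m U]mulmxA uU mulmx1.
Qed.

Lemma hdot_adjoint U u v : hdot (U *m u) v = hdot u (U^t* *m v).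
Proof.
rewrite !hdotE trmx_mul map_mxM /= mulmxA; congr ((_ *m _ *m _) 0 0).
by apply/matrixP => i j; rewrite !mxE conjCK.
Qed.

Lemma hdot_nondeg u v : (forall w, hdot w u = hdot w v) -> u = v.
Proof.
move=> H; apply/eqP; rewrite -subr_eq0; apply/eqP/hdot_eq0.
by rewrite hdotDr hdotNr H subrr.
Qed.

Lemma unitary_hdot U : (forall u v, hdot (U *m u) (U *m v) = hdot u v) -> U \is unitarymx.
Proof.
move=> H; apply/unitarymxP/mulmx1C/matrixP => i j.
have := H (delta_mx j 0) (delta_mx i 0).
rewrite -!colE !hdotE => E.
transitivity (((col i U)^t* *m col j U) 0 0).
  by rewrite !mxE; apply: eq_bigr => k _; rewrite !mxE.
rewrite E; rewrite mxE sum_I2 !mxE.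
by case: i j {E} => [[|[|//]] ?] [[|[|//]] ?];
  rewrite /= ?(conjC0, conjC1) ?(mul0r, mul1r, mulr0, addr0, add0r).
Qed.

Lemma mulmx_cV_inj U1 U2 : (forall u, U1 *m u = U2 *m u) -> U1 = U2.
Proof.
move=> H; apply/matrixP => i j; have := congr1 (fun M : 'cV_2 => M i 0) (H (delta_mx j 0)).
by rewrite -!colE !mxE.
Qed.

(* A maximal isotropic subspace of the form <be, be'> - <ga, ga'> is the graph
   of a unitary operator: a vector orthogonal to its first projection would be
   isotropic against it, hence isotropic in the definite form. *)
Lemma maximal_isotropic_unitary (V : 'cV[R[i]]_2 -> 'cV[R[i]]_2 -> Prop) :
  (forall (b : R[i]) be ga be' ga', V be ga -> V be' ga' -> V (b *: be + be') (b *: ga + ga')) ->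
  V 0 0 ->
  (forall be ga be' ga', V be ga -> V be' ga' -> hdot be be' = hdot ga ga') ->
  (forall be ga, (forall be' ga', V be' ga' -> hdot be' be = hdot ga' ga) -> V be ga) ->
  exists2 U, U \is unitarymx & forall be ga, V be ga <-> ga = - (U *m be).
Proof.
move=> Vlin V0 Viso Vmax.
have full u : u != 0 -> exists be ga, V be ga /\ hdot be u != 0.
  move=> u0; apply: contrapT => H.
  have Vu : V u 0.
    apply: Vmax => be' ga' V'; rewrite hdot0r; apply/eqP/negPn/negP => n0.
    by apply: H; exists be', ga'.
  by have := Viso _ _ _ _ Vu Vu; rewrite hdot0r => /hdot_eq0 E; rewrite E eqxx in u0.
pose vec (p q : R[i]) : 'cV[R[i]]_2 := \col_i (if i == 0 then p else q).
have vec0 p q : vec p q 0 0 = p by rewrite mxE.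
have vec1 p q : vec p q 1 0 = q by rewrite mxE.
have e0 : vec 1 0 != 0.
  by apply/eqP => /matrixP/(_ 0 0)/eqP; rewrite vec0 mxE oner_eq0.
have [w [gw [Vw w0]]] := full _ e0.
have {}w0 : w 0 0 != 0 by move: w0; rewrite /hdot vec0 vec1 rmorph1 rmorph0 mulr1 mulr0 addr0.
(* This vector is orthogonal to [w], and the product of any [v] with it is the determinant of [w]
   and [v]; a nonzero product thus yields a basis. *)
have wp0 : vec (- ((w 1 0)^*)%C) (((w 0 0)^*)%C) != 0.
  apply/eqP => /matrixP/(_ 1 0)/eqP; rewrite vec1 mxE => /eqP E.
  by move/eqP: w0; apply; rewrite -[LHS]conjcK E rmorph0.
have [v [gv [Vv D0]]] := full _ wp0.
have {}D0 : w 0 0 * v 1 0 - w 1 0 * v 0 0 != 0.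
  move: D0; rewrite /hdot vec0 vec1 rmorphN /= !conjcK.
  by rewrite (_ : _ + _ = w 0 0 * v 1 0 - w 1 0 * v 0 0)//; ring.
have all u : exists gu, V u gu.
  pose D := w 0 0 * v 1 0 - w 1 0 * v 0 0.
  (* Coordinates of [u] in the basis [w], [v], by Cramer's rule. *)
  pose p := (u 0 0 * v 1 0 - u 1 0 * v 0 0) / D.
  pose r := (w 0 0 * u 1 0 - w 1 0 * u 0 0) / D.
  exists (p *: gw + (r *: gv + 0)).
  suff -> : u = p *: w + (r *: v + 0) by apply: (Vlin _ _ _ _ _ Vw); exact: Vlin.
  by apply: cV2_eq; rewrite !mxE /p /r /D; field.
have [g0 Vg0] := all (vec 1 0); have [g1 Vg1] := all (vec 0 1).
pose U : 'M[R[i]]_2 := \matrix_(i, j) - (if j == 0 then g0 i 0 else g1 i 0).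
have VU be : V be (- (U *m be)).
  have -> : - (U *m be) = be 0 0 *: g0 + (be 1 0 *: g1 + 0).
    by apply: cV2_eq; rewrite !mxE sum_I2 !mxE /=; ring.
  have {1}-> : be = be 0 0 *: vec 1 0 + (be 1 0 *: vec 0 1 + 0).
    by apply: cV2_eq; rewrite !mxE /=; ring.
  by apply: (Vlin _ _ _ _ _ Vg0); exact: Vlin.
exists U.
  apply: unitary_hdot => u u'.
  by rewrite (Viso _ _ _ _ (VU u) (VU u')) hdotNl hdotNr opprK.
move=> be ga; split => [Vb|->]; last exact: VU.
(* The difference of two pairs over the same [be] has first component 0, so isotropy annihilates the
   second. *)
have Vd := Vlin (-1) _ _ _ _ (VU be) Vb; rewrite !scaleN1r addNr opprK in Vd.
have := Viso _ _ _ _ Vd Vd; rewrite hdot0l => /esym/hdot_eq0 E.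
by apply/eqP; rewrite -addr_eq0 addrC E.
Qed.
End HermitianPlane.

(** * Selfadjoint extensions and unitary matrices *)

Section Extensions.
Context {R : realType} (a : R) (a_gt0 : 0 < a).
Implicit Types (x y z f g h k : R -> R[i]) (U : 'M[R[i]]_2) (A : @graph R).
Implicit Types (be ga : 'cV[R[i]]_2).
Local Open Scope sesquilinear_scope.

(** The working form of [LU]: only [f] needs a classical representative, since [cmax] leaves the
    image free up to null sets, and the boundary conditions are solved for the second datum. *)
Lemma LUP U f g : LU a U (f, g) <-> inL2 a f /\ exists x be,
  [/\ eqL2 a f x, cmax a x g & boundary_data a x be (- (U *m be))].
Proof.
split.
  move=> [/= f2 g2 [x [[Dx bcx] fx gx]]]; split; first exact: f2.
  have xg : cmax a x g by exact: Dmax_cmax.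
  have [be [ga B]] := boundary_data_exists a_gt0 xg.
  by exists x, be; split => //; move: (B); rewrite ((boundary_conditionsP U B).1 bcx).
move=> [f2 [x [be [fx xg B]]]]; have [_ g2] := cmax_inL2 xg; split => //=.
exists x; split; [split|exact: fx|exact: cmax_prolate].
  exact: cmax_Dmax xg.
exact/(boundary_conditionsP U B).
Qed.

Lemma green_pairing f x g h z k be ga be' ga' : inL2 a f -> inL2 a h ->
  eqL2 a f x -> cmax a x g -> eqL2 a h z -> cmax a z k ->
  boundary_data a x be ga -> boundary_data a z be' ga' ->
  dotL2 a g h = dotL2 a f k <-> hdot be be' = hdot ga ga'.
Proof.
move=> f2 h2 fx xg hz zk B B'; have [x2 g2] := cmax_inL2 xg; have [z2 k2] := cmax_inL2 zk.
have gg : eqL2 a g g by exact: aeW.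
have kk : eqL2 a k k by exact: aeW.
rewrite (dotL2_ae g2 g2 h2 z2 gg hz) (dotL2_ae f2 x2 k2 k2 fx kk).
exact: complex_greenP.
Qed.

(** An element of the adjoint satisfies the weak equation as soon as [A] contains the compactly
    supported pairs. *)
Lemma adjoint_cmax A h k : (forall x y, cmax a x y -> classA0 a x -> A (x, y)) ->
  adjoint a A (h, k) -> inL2 a h /\ exists z, eqL2 a h z /\ cmax a z k.
Proof.
move=> A0 [/= h2 k2 Ahk]; split => //.
have [z [zk hz]] := cmax_weak a_gt0 h2 k2 (fun x y c s => Ahk x y (A0 x y c s)).
by exists z.
Qed.

Lemma eqL2_refl f : eqL2 a f f.
Proof. exact: aeW. Qed.

Lemma classA0_LU U x y : cmax a x y -> classA0 a x -> LU a U (x, y).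
Proof.
move=> xy x0; have [x2 _] := cmax_inL2 xy; apply/LUP; split => //.
exists x, 0; split; [exact: eqL2_refl|exact: xy|].
by rewrite mulmx0 oppr0; exact: classA0_boundary_data.
Qed.

(** Data of the form [(be', - U be')] occur for every [be']. Testing against them determines [be] as
    minus the adjoint matrix applied to [ga], which unitarity inverts; the converse inclusion is the
    isometry of [U]. *)
Lemma LU_adjoint U : U \is unitarymx -> adjoint a (LU a U) = LU a U.
Proof.
move=> uU; apply/seteqP; split => -[h k].
  move=> hk; have [h2 [z [hz zk]]] := adjoint_cmax (@classA0_LU U) hk.
  have [be [ga B]] := boundary_data_exists a_gt0 zk.
  suff E : ga = - (U *m be) by apply/LUP; split => //; exists z, be; rewrite -E.
  have Hb be' : hdot be' (- (U^t* *m ga)) = hdot be' be.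
    have [x [y [xy B']]] := boundary_data_surjective a_gt0 be' (- (U *m be')).
    have [x2 _] := cmax_inL2 xy; have [_ _ H] := hk.
    have LUx : LU a U (x, y).
      by apply/LUP; split => //; exists x, be'; split; [exact: eqL2_refl|exact: xy|exact: B'].
    have := (green_pairing x2 h2 (eqL2_refl x) xy hz zk B' B).1 (H _ _ LUx).
    by rewrite hdotNl hdot_adjoint hdotNr => ->.
  rewrite -(hdot_nondeg Hb) mulmxN mulmxA opprK.
  by have /unitarymxP -> := uU; rewrite mul1mx.
move=> /LUP[h2 [z [be' [hz zk B']]]]; have [z2 k2] := cmax_inL2 zk; split => //= f g.
move=> /LUP[f2 [x [be [fx xg B]]]].
apply/(green_pairing f2 h2 fx xg hz zk B B').
by rewrite hdotNl hdotNr opprK hdot_unitary.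
Qed.

Lemma cmax0 : cmax a (cst 0) (cst 0).
Proof. by split; eexists; exact: rmax0. Qed.

Lemma classA0_cst0 : classA0 a (cst 0 : R -> R[i]).
Proof.
by apply: (supported_classA0 a_gt0 cmax0); exists (a / 2); split => //; have := a_gt0; lra.
Qed.

Lemma LU_operator U : is_operator a (LU a U).
Proof.
split.
- by move=> f g [].
- move=> f g f' g' [/= _ _ [x [Dx fx gx]]] f2' g2' ff gg; split => //=.
  exists x; split; first exact: Dx.
    by apply: eqL2_trans fx; exact: eqL2_sym.
  by apply: eqL2_trans gx; exact: eqL2_sym.
- by apply: classA0_LU; [exact: cmax0|exact: classA0_cst0].
- move=> b f g f' g' /LUP[f2 [x [be [fx xg B]]]] /LUP[f2' [x' [be' [fx' xg' B']]]].
  apply/LUP; split; first exact: inL2_lin.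
  exists (fun t => b * x t + x' t), (b *: be + be'); split.
  + by apply: aeS (aeI fx fx') => t [h1 h2] It; rewrite h1// h2.
  + exact: cmax_lin.
  + by rewrite mulmxDr opprD -scalemxAr -scalerN; exact: boundary_data_lin xg xg' B B'.
move=> f g g' /LUP[_ [x [_ [fx xg _]]]] /LUP[_ [x' [_ [fx' xg' _]]]].
apply: (cmax_ae_eq_image a_gt0 xg xg').
by apply: eqL2_trans fx'; exact: eqL2_sym.
Qed.

Lemma LU_selfadjoint U : U \is unitarymx -> selfadjoint a (LU a U).
Proof.
move=> uU; split; [exact: LU_operator| |exact: LU_adjoint].
move=> f f2 e e0; have [x [y [xy x0 fx]]] := cmax_dense a_gt0 f2 e0.
by exists x, y; split; [exact: classA0_LU|exact: fx].
Qed.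

(** With [LU] rewritten as its own adjoint, which is closed, only compactly supported elements have
    to be paired with [LU], and their boundary data vanish. *)
Lemma Lmin_LU U : U \is unitarymx -> Lmin a `<=` LU a U.
Proof.
move=> uU [h k] [/= h2 k2 H]; rewrite -LU_adjoint//; split => //= f g fg.
have [f2 g2] : inL2 a f /\ inL2 a g by case: fg.
apply: dotL2_closure => // e e0; have [h' [k' [B n1 n2]]] := H e e0.
exists h', k'; have [/= h2' k2' [x [[Dx x0] hx kx]]] := B; split => //.
have xk : cmax a x k' by exact: Dmax_cmax.
have /LUP[_ [z [be [fz zg Bz]]]] := fg.
apply/(green_pairing f2 h2' fz zg hx xk Bz (classA0_boundary_data a_gt0 x0)).
by rewrite !hdot0r.
Qed.

Lemma LU_Lmax U : LU a U `<=` Lmax a.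
Proof. by move=> fg [f2 g2 [x [[Dx _] fx gx]]]; split => //; exists x. Qed.

Lemma classA0_Lmin x y : cmax a x y -> classA0 a x -> Lmin a (x, y).
Proof.
move=> xy x0; have [x2 y2] := cmax_inL2 xy; split => //= e e0; exists x, y.
have n0 f : normL2 a (fun t => f t - f t) < e.
  rewrite /normL2 (_ : Rintegral _ _ _ = \int[lebesgue_measure]_(t in Iaa a) 0).
    by rewrite Rintegral_cst ?mul0r ?sqrtr0//; exact: measurable_Iaa.
  by apply: eq_Rintegral => t _; rewrite subrr Normc.normc0 expr0n.
split => //; split => //=; exists x; split; [split => //|exact: eqL2_refl|exact: cmax_prolate].
exact: cmax_Dmax xy.
Qed.

(** The boundary data occurring in [A] form a subspace [V], isotropic because [A] lies in its
    adjoint and maximal because [A] contains it. *)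
Lemma selfadjoint_extension A : selfadjoint a A -> Lmin a `<=` A ->
  exists2 U, U \is unitarymx & A = LU a U.
Proof.
move=> [[A2 Asat A00 Alin _] _ adjA] minA.
have A0 x y : cmax a x y -> classA0 a x -> A (x, y).
  by move=> xy x0; apply: minA; exact: classA0_Lmin.
have Acmax f g : A (f, g) -> exists x, [/\ eqL2 a f x, cmax a x g & A (x, g)].
  move=> fg; have [f2 g2] := A2 _ _ fg.
  have [_ [x [fx xg]]] : inL2 a f /\ exists z, eqL2 a f z /\ cmax a z g.
    by apply: (adjoint_cmax A0); rewrite adjA.
  have [x2 _] := cmax_inL2 xg; exists x; split => //.
  exact: Asat fg x2 g2 fx (eqL2_refl g).
pose V be ga := exists x y, [/\ A (x, y), cmax a x y & boundary_data a x be ga].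
have Viso be ga be' ga' : V be ga -> V be' ga' -> hdot be be' = hdot ga ga'.
  move=> [x [y [Axy xy B]]] [z [w [Azw zw B']]].
  have [x2 _] := cmax_inL2 xy; have [z2 _] := cmax_inL2 zw.
  apply: (green_pairing x2 z2 (eqL2_refl x) xy (eqL2_refl z) zw B B').1.
  by move: Azw; rewrite -adjA => -[_ _]; exact.
(* Membership in [A] is decided by boundary data alone: Green's formula puts [(z, w)] in the
   adjoint. *)
have Vmax be ga z w : (forall be' ga', V be' ga' -> hdot be' be = hdot ga' ga) ->
    cmax a z w -> boundary_data a z be ga -> A (z, w).
  move=> H zw B; have [z2 w2] := cmax_inL2 zw; rewrite -adjA; split => //= f g fg.
  have [f2 _] := A2 _ _ fg; have [x [fx xg Axg]] := Acmax f g fg.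
  have [be' [ga' B']] := boundary_data_exists a_gt0 xg.
  apply/(green_pairing f2 z2 fx xg (eqL2_refl z) zw B' B); apply: H.
  by exists x, g.
have [|||U uU VU] := @maximal_isotropic_unitary R V _ _ Viso _.
- move=> b be ga be' ga' [x [y [Axy xy B]]] [z [w [Azw zw B']]].
  exists (fun t => b * x t + z t), (fun t => b * y t + w t).
  by split; [exact: Alin|exact: cmax_lin|exact: boundary_data_lin xy zw B B'].
- exists (cst 0), (cst 0); split; [exact: A00|exact: cmax0|].
  exact: (classA0_boundary_data a_gt0 classA0_cst0).
- move=> be ga H; have [z [w [zw B]]] := boundary_data_surjective a_gt0 be ga.
  by exists z, w; split => //; exact: Vmax H zw B.
exists U; first exact: uU.
apply/seteqP; split => -[f g].
  move=> fg; have [f2 _] := A2 _ _ fg; have [x [fx xg Axg]] := Acmax f g fg.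
  have [be [ga B]] := boundary_data_exists a_gt0 xg.
  have E : ga = - (U *m be) by apply/VU; exists x, g.
  by apply/LUP; split => //; exists x, be; rewrite -E.
move=> /LUP[f2 [x [be [fx xg B]]]]; have [x2 g2] := cmax_inL2 xg.
have Vb : V be (- (U *m be)) by apply/VU.
have Axg : A (x, g) by apply: (Vmax _ _ _ _ _ xg B) => be' ga' V'; exact: Viso V' Vb.
exact: Asat Axg f2 g2 (eqL2_sym fx) (eqL2_refl g).
Qed.

(** For each [be] an element with data [(be, - U1 be)] exists. Its classical representative is
    unique, so reading the same element in the second operator gives [U1 be = U2 be]. *)
Lemma LU_inj U1 U2 : LU a U1 = LU a U2 -> U1 = U2.
Proof.
move=> E; apply: mulmx_cV_inj => be.
have [x [y [xy B]]] := boundary_data_surjective a_gt0 be (- (U1 *m be)).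
have [x2 _] := cmax_inL2 xy.
have : LU a U1 (x, y) by apply/LUP; split => //; exists x, be; split => //; exact: eqL2_refl.
rewrite E => /LUP[_ [x' [be' [xx' x'y B']]]].
have xE := cmax_ae_eq xy x'y xx'.
have [-> /oppr_inj ->] := boundary_data_unique (boundary_data_ext a_gt0 xE B) B'.
by [].
Qed.
End Extensions.

Theorem theorem4p1 (R : realType) (a : R) (ha : 0 < a) :
  [/\ forall U : 'M[R[i]]_2, U \is unitarymx ->
        [/\ selfadjoint a (LU a U), Lmin a `<=` LU a U & LU a U `<=` Lmax a],
      forall A : graph, selfadjoint a A -> Lmin a `<=` A ->
        exists2 U : 'M[R[i]]_2, U \is unitarymx & A = LU a U &
      forall U1 U2 : 'M[R[i]]_2, U1 \is unitarymx -> U2 \is unitarymx ->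
        (U1 = U2 <-> LU a U1 = LU a U2)].
Proof.
split.
- by move=> U uU; split; [exact: LU_selfadjoint|exact: Lmin_LU|exact: LU_Lmax].
- by move=> A; exact: selfadjoint_extension.
- by move=> U1 U2 _ _; split => [->|]; [|exact: LU_inj].
Qed.
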